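(* Let $(\theta,\phi)\in U(1)\times U(1)$ with $(\theta,\phi)\ne(1,1)$ and let $k\ge1$. For every $\gamma=\left(\begin{array}{cc}a&b\\ c&d\end{array}\right)\in SL(2,\mathbb Z)$, $z\in\mathbb C$ and $\tau$ in the complex upper half plane, $$P_k\!\left(\gamma.\!\left[\begin{array}{c}\theta\\ \phi\end{array}\right]\right)\!(\gamma.z,\gamma.\tau)=(c\tau+d)^k\,P_k\!\left[\begin{array}{c}\theta\\ \phi\end{array}\right](z,\tau).$$
   Context: $U(1)$ is the group of complex numbers of modulus one; $q=e^{2\pi i\tau}$, $q^n=e^{2\pi in\tau}$. With $\phi=\exp(2\pi i\lambda)$, $0\le\lambda<1$, the twisted Weierstrass functions are $$P_k\!\left[\begin{array}{c}\theta\\ \phi\end{array}\right](z,\tau)=\frac{(-1)^k}{(k-1)!}\sum_{n\in\mathbb Z+\lambda}\frac{n^{k-1}e^{nz}}{1-\theta^{-1}q^n}$$ for $|q|<|e^z|<1$ (here $(\theta,\phi)\neq(1,1)$; $0^0=1$), continued meromorphically to $z\in\mathbb C$. The actions are $\gamma.z=\frac z{c\tau+d}$, $\gamma.\tau=\frac{a\tau+b}{c\tau+d}$ and $$\gamma.\left[\begin{array}{c}\theta\\ \phi\end{array}\right]=\left[\begin{array}{c}\theta^a\phi^b\\ \theta^c\phi^d\end{array}\right].$$ The identity is an identity of meromorphic functions of $z$. *)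

(* Defs.v *)
From Stdlib Require Import Reals ZArith ClassicalEpsilon.
From Coquelicot Require Import Coquelicot.

Open Scope C_scope.

Definition Cexp (z : C) : C :=
  (exp (Re z) * cos (Im z), exp (Re z) * sin (Im z))%R.

Definition e2pii (w : C) : C := Cexp (RtoC (2 * PI) * Ci * w).

Definition CpowZ (w : C) (n : Z) : C :=
  match n with
  | Z0 => 1
  | Zpos p => Cpow w (Pos.to_nat p)
  | Zneg p => / Cpow w (Pos.to_nat p)
  end.

Definition analytic_at (f : C -> C) (z0 : C) : Prop :=
  exists (a : nat -> C) (r : R), (0 < r)%R /\
    forall z : C, (Cmod (z - z0) < r)%R ->
      @is_pseries C_AbsRing C_NormedModule a (z - z0) (f z).

Definition pole_at (f : C -> C) (z0 : C) : Prop :=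
  exists (m : nat) (g : C -> C) (r : R),
    (1 <= m)%nat /\ analytic_at g z0 /\ g z0 <> 0 /\ (0 < r)%R /\
    forall z : C, z <> z0 -> (Cmod (z - z0) < r)%R ->
      f z = g z / Cpow (z - z0) m.

(* A meromorphic function on C is represented by a total function that is
   analytic wherever the meromorphic function has no pole and is given the
   value 0 at its poles.  The representative is unique, so two meromorphic
   functions are equal iff their representatives agree at every point. *)
Definition meromorphic (f : C -> C) : Prop :=
  forall z0 : C, analytic_at f z0 \/ (pole_at f z0 /\ f z0 = 0).

Definition is_Zseries (a : Z -> C) (s : C) : Prop :=
  exists s1 s2 : C,
    @is_series C_AbsRing C_NormedModule (fun j : nat => a (Z.of_nat j)) s1 /\
    @is_series C_AbsRing C_NormedModule
      (fun j : nat => a (- Z.of_nat (S j))%Z) s2 /\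
    s = s1 + s2.

(* [n] is real since it ranges over Z + lambda; [pow 0 0 = 1] in Stdlib. *)
Definition twP_term (k : nat) (theta z tau : C) (n : R) : C :=
  RtoC (n ^ (k - 1)) * Cexp (RtoC n * z) / (1 - / theta * e2pii (RtoC n * tau)).

Definition twP_coef (k : nat) : C := RtoC ((-1) ^ k / INR (fact (k - 1))).

Definition is_twP_series (k : nat) (theta : C) (lambda : R) (z tau s : C)
    : Prop :=
  exists t : C,
    is_Zseries (fun m : Z => twP_term k theta z tau (IZR m + lambda)) t /\
    s = twP_coef k * t.

Definition is_twP (k : nat) (ch : C * C) (tau : C) (P : C -> C) : Prop :=
  meromorphic P /\
  exists lambda : R, (0 <= lambda < 1)%R /\ snd ch = e2pii (RtoC lambda) /\
    forall z : C, (Cmod (e2pii tau) < Cmod (Cexp z) < 1)%R ->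
      is_twP_series k (fst ch) lambda z tau (P z).

(* P_k[theta; phi](z, tau) with [ch = (theta, phi)]: the meromorphic
   continuation to C of the series. *)
Definition twP (k : nat) (ch : C * C) (z tau : C) : C :=
  epsilon (inhabits (fun _ : C => RtoC 0)) (is_twP k ch tau) z.

Definition act_char (a b c d : Z) (ch : C * C) : C * C :=
  (CpowZ (fst ch) a * CpowZ (snd ch) b, CpowZ (fst ch) c * CpowZ (snd ch) d).

Definition autfac (c d : Z) (tau : C) : C :=
  RtoC (IZR c) * tau + RtoC (IZR d).

Definition act_z (c d : Z) (tau z : C) : C := z / autfac c d tau.

Definition act_tau (a b c d : Z) (tau : C) : C :=
  (RtoC (IZR a) * tau + RtoC (IZR b)) / autfac c d tau.

(* Main.v *)
Require Import Defs.
From Stdlib Require Import Reals ZArith Lra Lia Psatz Classical ClassicalEpsilon.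
From Coquelicot Require Import Coquelicot.

(** [P_1(., tau)] continues to all of [C]: it is quasi-periodic, with multiplier [theta]
    along [2 pi i tau] and [phi] along [2 pi i], and its only singularities are simple
    poles at the lattice points, with residue [1] at [0].  The function [P_k] is
    [(-1)^(k-1)] times the Taylor coefficient of order [k-1] of [P_1] at the point, so the
    case [k = 1] implies the others.  For [k = 1] put [alpha = c tau + d]; the difference
    [D(w) = P_1[gamma.(theta,phi)](w, gamma.tau) - alpha P_1[theta;phi](alpha w, tau)] is
    quasi-periodic with unitary, not both trivial, multipliers, and the poles cancel.
    Hence [|D|] attains its maximum on a period parallelogram, [D] is constant by the
    maximum principle, and the constant is [0] because of the multipliers.  *)

Open Scope C_scope.

(** * Complex series *)

(** Put T = 2 pi Im tau. In the series of P_1 the terms with n >= 0 converge only for Re z < 0 and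
    those with n < 0 only for Re z > -T, so the given strip leaves no room for translates by 2 pi i
    tau to overlap. Splitting off a geometric series with an elementary sum widens the strip to |Re
    z| < T; there the translates overlap and can be glued with powers of theta. The factor alpha in
    D is forced by the residues: dilation by alpha divides the residue at 0 by alpha. Since alpha
    maps the lattice of gamma.tau onto that of tau, equality of residues at 0 spreads to every pole
    by quasi-periodicity. The coefficient of order k-1 of P_1(alpha w) contributes alpha^(k-1),
    which together with this alpha is the weight alpha^k. The continuations are total functions with
    arbitrary values at their poles. Local statements therefore live on punctured discs, and values
    at single points are normalised only when a Taylor coefficient is extracted. *)

Definition csum (a : nat -> C) (s : C) : Prop :=
  @is_series C_AbsRing C_NormedModule a s.

Definition csum_val (a : nat -> C) : C := epsilon (inhabits (RtoC 0)) (csum a).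

Lemma csum_eps (a : nat -> C) (s : C) :
  csum a s <->
  (forall e : R, (0 < e)%R ->
    exists N : nat, forall n, (N <= n)%nat -> (Cmod (sum_n a n - s) < e)%R).
Proof.
unfold csum, is_series.
rewrite (@filterlim_locally_ball_norm C_AbsRing nat C_NormedModule eventually _).
split.
- intros H e he. destruct (H (mkposreal e he)) as [N HN]. now exists N.
- intros H e. destruct (H e (cond_pos e)) as [N HN]. now exists N.
Qed.

Lemma csum_ext (a b : nat -> C) (s : C) :
  (forall n, a n = b n) -> csum a s -> csum b s.
Proof. apply (@is_series_ext C_AbsRing C_NormedModule). Qed.

Lemma csum_plus (a b : nat -> C) (s t : C) :
  csum a s -> csum b t -> csum (fun n => a n + b n) (s + t).
Proof. apply (@is_series_plus C_AbsRing C_NormedModule). Qed.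

Lemma csum_scal (k : C) (a : nat -> C) (s : C) :
  csum a s -> csum (fun n => k * a n) (k * s).
Proof. apply (@is_series_scal C_AbsRing C_NormedModule). Qed.

Lemma csum_minus (a b : nat -> C) (s t : C) :
  csum a s -> csum b t -> csum (fun n => a n - b n) (s - t).
Proof. apply (@is_series_minus C_AbsRing C_NormedModule). Qed.

Lemma csum_incr (a : nat -> C) (s : C) :
  csum a s -> csum (fun n => a (S n)) (s - a 0%nat).
Proof.
intros H. apply (@is_series_incr_1 C_AbsRing C_NormedModule).
refine (eq_ind s (csum a) H _ _).
change (s = s - a 0%nat + a 0%nat); ring.
Qed.

Lemma csum_decr (a : nat -> C) (s : C) :
  csum (fun n => a (S n)) (s - a 0%nat) -> csum a s.
Proof. apply (@is_series_decr_1 C_AbsRing C_NormedModule). Qed.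

Lemma Cmod_small (x : C) : (forall e : R, (0 < e)%R -> (Cmod x < e)%R) -> x = 0.
Proof.
intros H. apply Cmod_eq_0. destruct (Cmod_ge_0 x) as [h|h]; [|now symmetry].
exfalso; exact (Rlt_irrefl _ (H _ h)).
Qed.

Lemma Cmod_minus_sym (x y : C) : Cmod (x - y) = Cmod (y - x).
Proof. rewrite <- Cmod_opp. f_equal. ring. Qed.

Lemma Cmod_minus_trans (x y z : C) :
  (Cmod (x - z) <= Cmod (x - y) + Cmod (y - z))%R.
Proof. replace (x - z) with ((x - y) + (y - z)) by ring. apply Cmod_triangle. Qed.

Lemma csum_unique (a : nat -> C) (s t : C) : csum a s -> csum a t -> s = t.
Proof.
intros H1 H2. apply Ceq_minus, Cmod_small. intros e he.
rewrite csum_eps in H1, H2.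
destruct (H1 (e / 2)%R) as [N1 h1]; [lra|].
destruct (H2 (e / 2)%R) as [N2 h2]; [lra|].
pose proof (h1 (max N1 N2) ltac:(lia)) as h1'. pose proof (h2 (max N1 N2) ltac:(lia)) as h2'.
pose proof (Cmod_minus_trans s (sum_n a (max N1 N2)) t) as h.
rewrite (Cmod_minus_sym s (sum_n _ _)) in h. lra.
Qed.

Lemma csum_val_eq (a : nat -> C) (s : C) : csum a s -> csum_val a = s.
Proof.
intros H. apply (csum_unique a); [|easy].
unfold csum_val. apply epsilon_spec. now exists s.
Qed.

Lemma csum_val_abs (a : nat -> C) :
  ex_series (fun n => Cmod (a n)) -> csum a (csum_val a).
Proof.
intros H.
destruct (@ex_series_le C_AbsRing C_CompleteNormedModule a (fun n => Cmod (a n))) as [s hs].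
- intros n. apply Rle_refl.
- exact H.
- unfold csum_val. apply epsilon_spec. now exists s.
Qed.

Lemma Cmod_sum_n (a : nat -> C) (n : nat) :
  (Cmod (sum_n a n) <= sum_n (fun k => Cmod (a k)) n)%R.
Proof.
induction n as [|n IH].
- rewrite !sum_O. apply Rle_refl.
- rewrite !sum_Sn. change plus with Cplus at 1. change plus with Rplus.
  eapply Rle_trans; [apply Cmod_triangle|]. lra.
Qed.

Lemma sum_n_le_Series (a : nat -> R) (n : nat) :
  (forall k, (0 <= a k)%R) -> ex_series a -> (sum_n a n <= Series a)%R.
Proof.
intros h0 hs. apply (is_lim_seq_incr_compare (sum_n a)).
- apply Series_correct in hs. exact hs.
- intros k. rewrite sum_Sn. change plus with Rplus. specialize (h0 (S k)). lra.
Qed.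

Lemma csum_Cmod_le (a : nat -> C) (s : C) (M : R) :
  csum a s -> (forall n, (Cmod (sum_n a n) <= M)%R) -> (Cmod s <= M)%R.
Proof.
intros H h. apply Rnot_lt_le. intros hlt.
rewrite csum_eps in H. destruct (H (Cmod s - M)%R) as [N hN]; [lra|].
specialize (hN N (le_n _)). specialize (h N).
assert (Cmod s <= Cmod (sum_n a N) + Cmod (sum_n a N - s))%R.
{ rewrite (Cmod_minus_sym _ s).
  replace s with (sum_n a N + (s - sum_n a N)) at 1 by ring. apply Cmod_triangle. }
lra.
Qed.

Lemma csum_finite (a : nat -> C) (N : nat) :
  (forall n, (N < n)%nat -> a n = 0) -> csum a (sum_n a N).
Proof.
intros h. apply csum_eps. intros e he. exists N. intros n hn.
replace (sum_n a n - sum_n a N) with (RtoC 0); [now rewrite Cmod_0|].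
induction hn as [|n hn IH]; [ring|].
rewrite sum_Sn, h by lia. change plus with Cplus. rewrite IH at 1. ring.
Qed.

Lemma ex_series_R_le (a b : nat -> R) :
  (forall n, (0 <= a n <= b n)%R) -> ex_series b -> ex_series a.
Proof.
intros h. apply (@ex_series_le R_AbsRing R_CompleteNormedModule).
intros n. change norm with Rabs. rewrite Rabs_pos_eq; apply h.
Qed.

Lemma ex_series_finite (a : nat -> R) (N : nat) :
  (forall n, (N < n)%nat -> a n = 0%R) -> is_series a (sum_n a N).
Proof.
intros h. unfold is_series. apply filterlim_ext_loc with (fun _ => sum_n a N).
2: apply filterlim_const.
exists N. intros n hn.
induction hn as [|n hn IH]; [easy|].
rewrite sum_Sn, h by lia. change plus with Rplus. rewrite <- IH. symmetry; apply Rplus_0_r.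
Qed.

Lemma sum_n_C_plus (a b : nat -> C) n :
  sum_n (fun k => a k + b k) n = sum_n a n + sum_n b n.
Proof. apply (@sum_n_plus C_AbelianMonoid). Qed.

Lemma sum_n_C_scal (k : C) (a : nat -> C) n :
  sum_n (fun j => k * a j) n = k * sum_n a n.
Proof. apply (@sum_n_mult_l C_Ring). Qed.

(** * Dominated convergence and interchange of summations *)

Lemma csum_sum_n (a : nat -> nat -> C) (s : nat -> C) (J : nat) :
  (forall j, csum (fun i => a i j) (s j)) ->
  csum (fun i => sum_n (a i) J) (sum_n s J).
Proof.
intros h. induction J as [|J IH].
- rewrite sum_O. eapply csum_ext; [|apply (h 0%nat)]. intros; now rewrite sum_O.
- rewrite sum_Sn. eapply csum_ext; [|apply csum_plus; [apply IH|apply (h (S J))]].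
  intros; now rewrite sum_Sn.
Qed.

(** Choose M so that the tail of [A] beyond M is below e/4. This bounds the tails of all the series
    in i uniformly in J, and that of the limit series too because the bound passes to [y]; the
    finitely many remaining terms converge one by one. *)
Lemma csum_dominated (x : nat -> nat -> C) (A : nat -> R) (y s : nat -> C) (t : C) :
  ex_series A ->
  (forall i J, (Cmod (x i J) <= A i)%R) ->
  (forall i, forall e : R, (0 < e)%R ->
     exists N, forall J, (N <= J)%nat -> (Cmod (x i J - y i) < e)%R) ->
  (forall J, csum (fun i => x i J) (s J)) ->
  csum y t ->
  forall e : R, (0 < e)%R ->
    exists N, forall J, (N <= J)%nat -> (Cmod (s J - t) < e)%R.
Proof.
intros hA hx hlim hs ht e he.
assert (hA0 : forall i, (0 <= A i)%R).
{ intros i. eapply Rle_trans; [apply Cmod_ge_0|apply (hx i 0%nat)]. }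
assert (hy : forall i, (Cmod (y i) <= A i)%R).
{ intros i. apply Rnot_lt_le. intros hlt.
  destruct (hlim i (Cmod (y i) - A i)%R) as [N hN]; [lra|].
  specialize (hN N (le_n _)). specialize (hx i N).
  pose proof (Cmod_minus_trans (y i) (x i N) 0) as h.
  rewrite (Cmod_minus_sym (y i) (x i N)) in h.
  replace (y i - 0) with (y i) in h by ring. replace (x i N - 0) with (x i N) in h by ring.
  lra. }
assert (htail : exists M, forall n, (M <= n)%nat -> (Series A - sum_n A n < e / 4)%R).
{ pose proof (Series_correct _ hA) as h. unfold is_series in h.
  rewrite (@filterlim_locally_ball_norm R_AbsRing nat R_NormedModule eventually _) in h.
  destruct (h (mkposreal (e/4) ltac:(lra))) as [M hM].
  exists M. intros n hn. specialize (hM n hn).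
  unfold ball_norm in hM. simpl in hM.
  change (Rabs (sum_n A n - Series A) < e / 4)%R in hM.
  apply Rabs_def2 in hM. lra. }
destruct htail as [M hM]. specialize (hM M (le_n _)).
assert (htl : forall (b : nat -> C) (u : C),
  (forall i, (Cmod (b i) <= A i)%R) -> csum b u ->
  (Cmod (u - sum_n b M) <= Series A - sum_n A M)%R).
{ intros b u hb hu.
  apply (csum_Cmod_le (fun i => if le_lt_dec i M then RtoC 0 else b i)).
  - assert (h1 : csum (fun i => if le_lt_dec i M then b i else RtoC 0) (sum_n b M)).
    { replace (sum_n b M) with (sum_n (fun i => if le_lt_dec i M then b i else RtoC 0) M).
      - apply csum_finite. intros n hn. destruct (le_lt_dec n M); [lia|easy].
      - apply sum_n_ext_loc. intros n hn. destruct (le_lt_dec n M); [easy|lia]. }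
    eapply csum_ext; [|apply (csum_minus _ _ _ _ hu h1)].
    intros n; simpl. destruct (le_lt_dec n M); ring.
  - intros n. eapply Rle_trans; [apply Cmod_sum_n|].
    assert (hmon : forall p, (sum_n A p <= Series A)%R).
    { intros p. now apply sum_n_le_Series. }
    assert (h : forall p, (p <= M)%nat ->
      sum_n (fun i => Cmod (if le_lt_dec i M then RtoC 0 else b i)) p = 0%R).
    { intros p hp. transitivity (sum_n (fun _ => 0%R) p).
      2: rewrite sum_n_const; apply Rmult_0_r.
      apply sum_n_ext_loc.
      intros i hi. destruct (le_lt_dec i M); [apply Cmod_0|lia]. }
    destruct (le_lt_dec n M) as [hn|hn].
    + rewrite h by easy. specialize (hmon M). lra.
    + assert (h2 : forall p, (M <= p)%nat ->
       (sum_n (fun i => Cmod (if le_lt_dec i M then RtoC 0 else b i)) p <= sum_n A p - sum_n A M)%R).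
      { intros p hp. induction hp as [|p hp IH].
        - rewrite h by easy. apply Req_le. symmetry; apply Rminus_diag_eq; reflexivity.
        - rewrite !sum_Sn. change plus with Rplus.
          destruct (le_lt_dec (S p) M); [lia|]. specialize (hb (S p)). lra. }
      specialize (h2 n ltac:(lia)). specialize (hmon n). lra. }
assert (hfin : exists N, forall J, (N <= J)%nat ->
  (Cmod (sum_n (fun i => x i J) M - sum_n y M) < e / 4)%R).
{ assert (hg : forall p (d : R), (0 < d)%R -> exists N, forall J, (N <= J)%nat ->
    (Cmod (sum_n (fun i => x i J) p - sum_n y p) < d)%R).
  { induction p as [|p IH]; intros d hd.
    - destruct (hlim 0%nat d hd) as [N hN]. exists N. intros J hJ.
      rewrite !sum_O. now apply hN.
    - destruct (IH (d/2)%R ltac:(lra)) as [N1 h1].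
      destruct (hlim (S p) (d/2)%R ltac:(lra)) as [N2 h2].
      exists (max N1 N2). intros J hJ.
      specialize (h1 J ltac:(lia)). specialize (h2 J ltac:(lia)).
      rewrite !sum_Sn. change plus with Cplus.
      replace (sum_n (fun i => x i J) p + x (S p) J - (sum_n y p + y (S p)))
        with ((sum_n (fun i => x i J) p - sum_n y p) + (x (S p) J - y (S p))) by ring.
      eapply Rle_lt_trans; [apply Cmod_triangle|]. lra. }
  apply hg. lra. }
destruct hfin as [N hN]. exists N. intros J hJ. specialize (hN J hJ).
pose proof (htl _ _ (fun i => hx i J) (hs J)) as h1.
pose proof (htl _ _ hy ht) as h2. rewrite Cmod_minus_sym in h2.
pose proof (Cmod_minus_trans (s J) (sum_n (fun i => x i J) M) t) as h3.
pose proof (Cmod_minus_trans (sum_n (fun i => x i J) M) (sum_n y M) t) as h4.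
lra.
Qed.

(** Dominated convergence for the partial row sums [sum_n (a i) J]: they tend to [r i], are bounded
    by [A i], and their sum over i is the J-th partial sum of the column sums. *)
Lemma fubini (a : nat -> nat -> C) (r : nat -> C) (A : nat -> R) :
  (forall i, ex_series (fun j => Cmod (a i j))) ->
  (forall i, (Series (fun j => Cmod (a i j)) <= A i)%R) ->
  ex_series A ->
  (forall i, csum (a i) (r i)) ->
  exists s, csum r s /\
    csum (fun j => csum_val (fun i => a i j)) s /\
    (forall j, csum (fun i => a i j) (csum_val (fun i => a i j))).
Proof.
intros h1 h2 h3 h4.
assert (hpart : forall i J, (Cmod (sum_n (a i) J) <= A i)%R).
{ intros i J. eapply Rle_trans; [apply Cmod_sum_n|].
  eapply Rle_trans; [|apply (h2 i)].
  apply sum_n_le_Series; [|apply h1]. intros; apply Cmod_ge_0. }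
assert (hterm : forall i j, (Cmod (a i j) <= A i)%R).
{ intros i j. eapply Rle_trans; [|apply (h2 i)].
  apply Rle_trans with (sum_n (fun j => Cmod (a i j)) j).
  - destruct j; [rewrite sum_O; apply Rle_refl|].
    rewrite sum_Sn. change plus with Rplus.
    assert (0 <= sum_n (fun j0 => Cmod (a i j0)) j)%R; [|lra].
    eapply Rle_trans; [apply Cmod_ge_0|apply Cmod_sum_n].
  - apply sum_n_le_Series; [|apply h1]. intros; apply Cmod_ge_0. }
assert (hr : forall i, (Cmod (r i) <= A i)%R).
{ intros i. apply (csum_Cmod_le (a i)); [apply h4|]. apply hpart. }
assert (hcol : forall j, csum (fun i => a i j) (csum_val (fun i => a i j))).
{ intros j. apply csum_val_abs. apply (ex_series_R_le _ A); [|easy].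
  intros i. split; [apply Cmod_ge_0|apply hterm]. }
assert (hrs : csum r (csum_val r)).
{ apply csum_val_abs. apply (ex_series_R_le _ A); [|easy].
  intros i. split; [apply Cmod_ge_0|apply hr]. }
exists (csum_val r). split; [easy|]. split; [|easy].
apply csum_eps.
apply (csum_dominated (fun i J => sum_n (a i) J) A r); try easy.
- intros i. apply csum_eps, h4.
- intros J. apply csum_sum_n. apply hcol.
Qed.

(** Serves for triangular arrays, whose rows or columns vanish up to the diagonal and are re-indexed
    from there. *)
Lemma is_series_drop_zeros {K : AbsRing} {V : NormedModule K} (x : nat -> V)
  (j : nat) (s : V) :
  (forall n, (n < j)%nat -> x n = zero) ->
  is_series x s <-> is_series (fun n => x (j + n)%nat) s.
Proof.
revert x. induction j as [|j IH]; intros x h; [easy|].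
assert (h0 : plus s (opp (x 0%nat)) = s).
{ rewrite h by lia. exact (eq_trans (f_equal (plus s) opp_zero) (plus_zero_r s)). }
assert (h0' : plus s (x 0%nat) = s).
{ rewrite h by lia. apply plus_zero_r. }
transitivity (is_series (fun n => x (S n)) s).
- split; intros H.
  + apply is_series_incr_1. now rewrite h0'.
  + apply is_series_decr_1. now rewrite h0.
- apply (IH (fun n => x (S n))). intros n hn. apply h. lia.
Qed.

(** * Power series *)

Definition psum (a : nat -> C) (w s : C) : Prop := csum (fun n => a n * w ^ n) s.

Definition abs_conv (a : nat -> C) (r : R) : Prop :=
  ex_series (fun n => (Cmod (a n) * r ^ n)%R).

Lemma is_pseries_psum (a : nat -> C) (w s : C) :
  @is_pseries C_AbsRing C_NormedModule a w s <-> psum a w s.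
Proof.
assert (hp : forall n, pow_n w n = w ^ n).
{ induction n as [|n IH]; [easy|]. simpl. now rewrite IH. }
assert (h : forall n, scal (pow_n w n : C_AbsRing) (a n : C_NormedModule) = a n * w ^ n).
{ intros n. rewrite hp. apply Cmult_comm. }
split; apply csum_ext; intros n; [apply h|symmetry; apply h].
Qed.

Lemma csum_bounded (x : nat -> C) (s : C) :
  csum x s -> exists M : R, (0 <= M)%R /\ forall n, (Cmod (x n) <= M)%R.
Proof.
intros H. rewrite csum_eps in H. destruct (H 1%R Rlt_0_1) as [N hN].
set (B := sum_n (fun k => Cmod (x k)) N).
assert (hB : forall n, (n <= N)%nat -> (Cmod (x n) <= B)%R).
{ intros n hn. unfold B. clear hN B. induction hn as [|m hm IH].
  - destruct n; [rewrite sum_O; apply Rle_refl|]. rewrite sum_Sn.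
    change plus with Rplus.
    pose proof (Cmod_sum_n x n). pose proof (Cmod_ge_0 (sum_n x n)).
    lra.
  - rewrite sum_Sn. change plus with Rplus. pose proof (Cmod_ge_0 (x (S m))). lra. }
exists (B + 2)%R. split.
{ specialize (hB 0%nat ltac:(lia)). pose proof (Cmod_ge_0 (x 0%nat)). lra. }
intros n. destruct (le_lt_dec n N) as [hn|hn].
- specialize (hB n hn). lra.
- destruct n as [|n]; [lia|].
  pose proof (hN n ltac:(lia)) as h1. pose proof (hN (S n) ltac:(lia)) as h2.
  rewrite sum_Sn in h2. change plus with Cplus in h2.
  replace (x (S n)) with ((sum_n x n + x (S n) - s) - (sum_n x n - s)) by ring.
  eapply Rle_trans; [apply Cmod_triangle|]. rewrite Cmod_opp.
  specialize (hB 0%nat ltac:(lia)). pose proof (Cmod_ge_0 (x 0%nat)). lra.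
Qed.

Lemma abs_conv_le (a : nat -> C) (r r' : R) :
  (0 <= r' <= r)%R -> abs_conv a r -> abs_conv a r'.
Proof.
intros hr. apply ex_series_R_le. intros n. split.
- apply Rmult_le_pos; [apply Cmod_ge_0|apply pow_le; lra].
- apply Rmult_le_compat_l; [apply Cmod_ge_0|]. now apply pow_incr.
Qed.

Lemma ex_series_scaled_geom (M q : R) :
  (0 <= q < 1)%R -> ex_series (fun n => (M * q ^ n)%R).
Proof.
intros hq. apply (@ex_series_scal R_AbsRing R_NormedModule).
apply ex_series_geom. rewrite Rabs_pos_eq; lra.
Qed.

Lemma abs_conv_geom (a : nat -> C) (M r r' : R) :
  (0 <= r' < r)%R -> (forall n, (Cmod (a n) * r ^ n <= M)%R) -> abs_conv a r'.
Proof.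
intros hr h. apply (ex_series_R_le _ (fun n => (M * (r' / r) ^ n)%R)).
- intros n. split.
  + apply Rmult_le_pos; [apply Cmod_ge_0|apply pow_le; lra].
  + unfold Rdiv. rewrite Rpow_mult_distr.
    replace (Cmod (a n) * r' ^ n)%R with ((Cmod (a n) * r ^ n) * (r' ^ n * (/ r) ^ n))%R.
    * apply Rmult_le_compat_r; [|apply h].
      apply Rmult_le_pos; apply pow_le; [lra|]. left; apply Rinv_0_lt_compat; lra.
    * rewrite pow_inv. field. apply pow_nonzero. lra.
- apply ex_series_scaled_geom. split.
  + apply Rdiv_le_0_compat; lra.
  + apply (Rdiv_lt_1 r' r); lra.
Qed.

Lemma psum_abs_conv (a : nat -> C) (w s : C) (r : R) :
  psum a w s -> (0 <= r < Cmod w)%R -> abs_conv a r.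
Proof.
intros H hr. destruct (csum_bounded _ _ H) as [M [_ hM]].
apply (abs_conv_geom a M (Cmod w)); [easy|].
intros n. specialize (hM n). now rewrite Cmod_mult, Cmod_pow in hM.
Qed.

Lemma abs_conv_term (a : nat -> C) (r : R) (w : C) :
  abs_conv a r -> (Cmod w <= r)%R -> ex_series (fun n => Cmod (a n * w ^ n)).
Proof.
intros H hw. apply (ex_series_R_le _ (fun n => (Cmod (a n) * r ^ n)%R)); [|easy].
intros n. split; [apply Cmod_ge_0|]. rewrite Cmod_mult, Cmod_pow.
apply Rmult_le_compat_l; [apply Cmod_ge_0|]. apply pow_incr.
split; [apply Cmod_ge_0|easy].
Qed.

Definition psum_val (a : nat -> C) (w : C) : C := csum_val (fun n => a n * w ^ n).

Lemma abs_conv_psum (a : nat -> C) (r : R) (w : C) :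
  abs_conv a r -> (Cmod w <= r)%R -> psum a w (psum_val a w).
Proof. intros H hw. apply csum_val_abs. now apply abs_conv_term with r. Qed.

Lemma psum_unique (a : nat -> C) (w s t : C) : psum a w s -> psum a w t -> s = t.
Proof. apply csum_unique. Qed.

Lemma psum_ext (a b : nat -> C) (w s : C) :
  (forall n, a n = b n) -> psum a w s -> psum b w s.
Proof. intros h. apply csum_ext. intros n. now rewrite h. Qed.

Lemma abs_conv_ext (a b : nat -> C) (r : R) :
  (forall n, a n = b n) -> abs_conv a r -> abs_conv b r.
Proof. intros h. apply ex_series_ext. intros n. now rewrite h. Qed.

Lemma psum_0 (a : nat -> C) : psum a 0 (a 0%nat).
Proof.
replace (a 0%nat) with (sum_n (fun n => a n * 0 ^ n) 0).
- apply csum_finite. intros n hn. destruct n; [lia|]. rewrite Cpow_S. ring.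
- rewrite sum_O. simpl. ring.
Qed.

Lemma psum_plus (a b : nat -> C) (w s t : C) :
  psum a w s -> psum b w t -> psum (fun n => a n + b n) w (s + t).
Proof.
intros h1 h2. eapply csum_ext; [|apply (csum_plus _ _ _ _ h1 h2)].
intros n; simpl. ring.
Qed.

Lemma psum_scal (k : C) (a : nat -> C) (w s : C) :
  psum a w s -> psum (fun n => k * a n) w (k * s).
Proof.
intros h1. eapply csum_ext; [|apply (csum_scal k _ _ h1)].
intros n; simpl. ring.
Qed.

Lemma psum_minus (a b : nat -> C) (w s t : C) :
  psum a w s -> psum b w t -> psum (fun n => a n - b n) w (s - t).
Proof.
intros h1 h2. eapply csum_ext; [|apply (csum_minus _ _ _ _ h1 h2)].
intros n; simpl. ring.
Qed.

Lemma abs_conv_plus (a b : nat -> C) (r : R) :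
  (0 <= r)%R -> abs_conv a r -> abs_conv b r -> abs_conv (fun n => a n + b n) r.
Proof.
intros hr h1 h2.
apply (ex_series_R_le _ (fun n => (Cmod (a n) * r ^ n + Cmod (b n) * r ^ n)%R)).
- intros n. pose proof (pow_le r n hr). split.
  + apply Rmult_le_pos; [apply Cmod_ge_0|easy].
  + rewrite <- Rmult_plus_distr_r. apply Rmult_le_compat_r; [easy|apply Cmod_triangle].
- now apply (@ex_series_plus R_AbsRing R_NormedModule).
Qed.

Lemma abs_conv_scal (k : C) (a : nat -> C) (r : R) :
  abs_conv a r -> abs_conv (fun n => k * a n) r.
Proof.
intros h1. apply (ex_series_ext (fun n => (Cmod k * (Cmod (a n) * r ^ n))%R)).
- intros n. rewrite Cmod_mult. apply eq_sym, Rmult_assoc.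
- now apply (@ex_series_scal R_AbsRing R_NormedModule).
Qed.

Lemma abs_conv_minus (a b : nat -> C) (r : R) :
  (0 <= r)%R -> abs_conv a r -> abs_conv b r -> abs_conv (fun n => a n - b n) r.
Proof.
intros hr h1 h2. apply (abs_conv_ext (fun n => a n + (- (1)) * b n)).
- intros n. ring.
- apply abs_conv_plus; [easy|easy|]. now apply abs_conv_scal.
Qed.

Lemma psum_decr (a : nat -> C) (w s : C) :
  w <> 0 -> psum a w s -> psum (fun n => a (S n)) w ((s - a 0%nat) / w).
Proof.
intros hw H. apply csum_incr in H.
apply (csum_scal (/ w)) in H.
replace ((s - a 0%nat) / w) with (/ w * (s - a 0%nat * w ^ 0)).
- eapply csum_ext; [|exact H]. intros n; simpl. field. easy.
- simpl. field. easy.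
Qed.

Lemma psum_incr (a : nat -> C) (w s : C) :
  psum (fun n => a (S n)) w s -> psum a w (a 0%nat + w * s).
Proof.
intros H. apply csum_decr. apply (csum_scal w) in H.
replace (a 0%nat + w * s - a 0%nat * w ^ 0) with (w * s) by (simpl; ring).
eapply csum_ext; [|exact H]. intros n; simpl. ring.
Qed.

Lemma abs_conv_decr (a : nat -> C) (r : R) :
  (0 < r)%R -> abs_conv a r -> abs_conv (fun n => a (S n)) r.
Proof.
intros hr H. apply ex_series_incr_1 in H.
apply (@ex_series_scal R_AbsRing R_NormedModule (/ r)%R) in H.
eapply ex_series_ext; [|exact H]. intros n. unfold scal; simpl. unfold mult; simpl.
field. lra.
Qed.

Lemma abs_conv_incr (a : nat -> C) (r : R) :
  abs_conv (fun n => a (S n)) r -> abs_conv a r.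
Proof.
intros H. apply ex_series_incr_1.
apply (@ex_series_scal R_AbsRing R_NormedModule r%R) in H.
eapply ex_series_ext; [|exact H]. intros n. unfold scal; simpl. unfold mult; simpl.
ring.
Qed.

Lemma abs_conv_bound (a : nat -> C) (r : R) :
  (0 <= r)%R -> abs_conv a r ->
  exists M : R, (0 <= M)%R /\
    forall w s, (Cmod w <= r)%R -> psum a w s -> (Cmod s <= M)%R.
Proof.
intros hr H. exists (Series (fun n => (Cmod (a n) * r ^ n)%R)).
assert (hn : forall n, (0 <= Cmod (a n) * r ^ n)%R).
{ intros n. apply Rmult_le_pos; [apply Cmod_ge_0|now apply pow_le]. }
split.
- eapply Rle_trans; [apply (hn 0%nat)|].
  pose proof (sum_n_le_Series _ 0%nat hn H) as h. now rewrite sum_O in h.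
- intros w s hw hs. apply (csum_Cmod_le _ _ _ hs). intros n.
  eapply Rle_trans; [apply Cmod_sum_n|].
  eapply Rle_trans; [|apply (sum_n_le_Series _ n hn H)].
  induction n as [|n IH].
  + rewrite !sum_O. rewrite Cmod_mult, Cmod_pow. apply Rle_refl.
  + rewrite !sum_Sn. apply Rplus_le_compat; [exact IH|].
    rewrite Cmod_mult, Cmod_pow. apply Rmult_le_compat_l; [apply Cmod_ge_0|].
    apply pow_incr. split; [apply Cmod_ge_0|easy].
Qed.

(** The quotient (s - a_0)/w is a value of the shifted series, which is bounded on the closed
    disc. *)
Lemma psum_near_0 (a : nat -> C) (r : R) :
  (0 < r)%R -> abs_conv a r ->
  exists M : R, (0 <= M)%R /\
    forall w s, (Cmod w <= r)%R -> psum a w s -> (Cmod (s - a 0%nat) <= M * Cmod w)%R.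
Proof.
intros hr H.
destruct (abs_conv_bound _ r ltac:(lra) (abs_conv_decr _ _ hr H)) as [M [hM h]].
exists M. split; [easy|]. intros w s hw hs.
destruct (Ceq_dec w 0) as [->|hw0].
- rewrite (psum_unique _ _ _ _ hs (psum_0 a)).
  replace (a 0%nat - a 0%nat) with (RtoC 0) by ring. rewrite Cmod_0. lra.
- specialize (h w _ hw (psum_decr _ _ _ hw0 hs)).
  replace (s - a 0%nat) with ((s - a 0%nat) / w * w) by (field; easy).
  rewrite Cmod_mult. apply Rmult_le_compat_r; [apply Cmod_ge_0|easy].
Qed.

Lemma psum_zero_coef_0 (b : nat -> C) (r : R) :
  (0 < r)%R -> abs_conv b r ->
  (forall d : R, (0 < d)%R -> exists w, (0 < Cmod w < d)%R /\ psum b w 0) ->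
  b 0%nat = 0.
Proof.
intros hr hb h.
destruct (psum_near_0 b r hr hb) as [M [hM hn]].
apply Cmod_small. intros e he.
assert (hM1 : (0 < M + 1)%R) by lra.
destruct (h (Rmin r (e / (M + 1)))) as [w [[hw0 hw] hs]].
{ apply Rmin_pos; [easy|]. now apply Rdiv_lt_0_compat. }
assert (hw1 : (Cmod w < r)%R). { eapply Rlt_le_trans; [apply hw|apply Rmin_l]. }
assert (hw2 : (Cmod w < e / (M + 1))%R). { eapply Rlt_le_trans; [apply hw|apply Rmin_r]. }
specialize (hn w 0 ltac:(lra) hs).
replace (0 - b 0%nat) with (- b 0%nat) in hn by ring. rewrite Cmod_opp in hn.
apply Rlt_div_r in hw2; [|easy]. nra.
Qed.

(** Once b_0 = 0, division by w leaves a shifted series with the same zeros w, so the induction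
    passes to the next coefficient. *)
Lemma psum_zero_coef (b : nat -> C) (r : R) :
  (0 < r)%R -> abs_conv b r ->
  (forall d : R, (0 < d)%R -> exists w, (0 < Cmod w < d)%R /\ psum b w 0) ->
  forall n, b n = 0.
Proof.
intros hr hb h n. revert b hb h. induction n as [|n IH]; intros b hb h.
- now apply psum_zero_coef_0 with r.
- pose proof (psum_zero_coef_0 b r hr hb h) as hb0.
  apply (IH (fun n => b (S n))); [now apply abs_conv_decr|].
  intros d hd. destruct (h d hd) as [w [hw hs]]. exists w. split; [easy|].
  assert (hw0 : w <> 0) by (apply Cmod_gt_0; lra).
  apply (psum_decr _ _ _ hw0) in hs. rewrite hb0 in hs.
  now replace ((0 - 0) / w) with (RtoC 0) in hs by (field; easy).
Qed.

(** * Change of centre of a power series *)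

Fixpoint bin (m l : nat) : nat :=
  match l, m with
  | O, _ => 1
  | S _, O => 0
  | S l', S m' => bin m' l' + bin m' l
  end.

Lemma bin_gt (m l : nat) : (m < l)%nat -> bin m l = 0%nat.
Proof.
revert l. induction m as [|m IH]; intros [|l] h; try lia; simpl; [easy|].
rewrite !IH by lia. easy.
Qed.

Lemma bin_0 (m : nat) : bin m 0 = 1%nat.
Proof. now destruct m. Qed.

Lemma sum_n_C_O (f : nat -> C) : sum_n f 0 = f 0%nat :> C.
Proof. exact (sum_O f). Qed.

Lemma sum_n_C_S (f : nat -> C) (n : nat) : sum_n f (S n) = sum_n f n + f (S n) :> C.
Proof. exact (sum_Sn f n). Qed.

Lemma sum_n_C_ext_loc (f g : nat -> C) (n : nat) :
  (forall k, (k <= n)%nat -> f k = g k) -> sum_n f n = sum_n g n :> C.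
Proof. exact (sum_n_ext_loc f g n). Qed.

Lemma sum_n_C_ext (f g : nat -> C) (n : nat) :
  (forall k, f k = g k) -> sum_n f n = sum_n g n :> C.
Proof. exact (sum_n_ext f g n). Qed.

Lemma sum_n_S_first (f : nat -> C) (n : nat) :
  sum_n f (S n) = f 0%nat + sum_n (fun k => f (S k)) n :> C.
Proof.
induction n as [|n IH].
- now rewrite sum_n_C_S, !sum_n_C_O.
- rewrite sum_n_C_S, IH, sum_n_C_S. ring.
Qed.

Lemma binomial_C (v u : C) (m : nat) :
  sum_n (fun l => RtoC (INR (bin m l)) * v ^ (m - l) * u ^ l) m = (v + u) ^ m :> C.
Proof.
induction m as [|m IH].
- rewrite sum_n_C_O. simpl. ring.
- rewrite Cpow_S, <- IH, sum_n_S_first.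
  rewrite (sum_n_C_ext (fun k => RtoC (INR (bin (S m) (S k))) * v ^ (S m - S k) * u ^ S k)
    (fun k => u * (RtoC (INR (bin m k)) * v ^ (m - k) * u ^ k)
       + RtoC (INR (bin m (S k))) * v ^ (m - k) * u ^ S k)).
  2:{ intros k. change (bin (S m) (S k)) with (bin m k + bin m (S k))%nat.
      rewrite plus_INR, RtoC_plus. change (S m - S k)%nat with (m - k)%nat.
      rewrite Cpow_S. ring. }
  rewrite sum_n_C_plus, sum_n_C_scal.
  assert (h : v * sum_n (fun l => RtoC (INR (bin m l)) * v ^ (m - l) * u ^ l) m
    = v ^ S m + sum_n (fun k => RtoC (INR (bin m (S k))) * v ^ (m - k) * u ^ S k) m).
  { rewrite <- sum_n_C_scal.
    transitivity (sum_n (fun l => RtoC (INR (bin m l)) * v ^ (S m - l) * u ^ l) (S m)).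
    - rewrite sum_n_C_S. rewrite (bin_gt m (S m)) by lia.
      simpl INR. rewrite !Cmult_0_l, Cplus_0_r. apply sum_n_C_ext_loc. intros l hl.
      replace (S m - l)%nat with (S (m - l)) by lia. rewrite Cpow_S. ring.
    - rewrite sum_n_S_first. rewrite bin_0. simpl INR. rewrite Nat.sub_0_r.
      simpl (u ^ 0). rewrite Cmult_1_l, Cmult_1_r. reflexivity. }
  rewrite Cmult_plus_distr_r, h, bin_0. simpl INR. rewrite Nat.sub_0_r.
  simpl (u ^ 0). ring.
Qed.

Lemma RtoC_sum_n (f : nat -> R) (n : nat) :
  RtoC (sum_n f n) = sum_n (fun k => RtoC (f k)) n.
Proof.
induction n as [|n IH]; [now rewrite !sum_O|].
rewrite !sum_Sn, <- IH. apply RtoC_plus.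
Qed.

Lemma binomial_R (v u : R) (m : nat) :
  (sum_n (fun l => INR (bin m l) * v ^ (m - l) * u ^ l) m = (v + u) ^ m)%R.
Proof.
apply RtoC_inj. rewrite RtoC_sum_n, RtoC_pow, RtoC_plus, <- binomial_C.
apply sum_n_C_ext. intros l. now rewrite !RtoC_mult, !RtoC_pow.
Qed.

Lemma Cmod_INR (n : nat) : Cmod (RtoC (INR n)) = INR n.
Proof. rewrite Cmod_R. apply Rabs_pos_eq, pos_INR. Qed.

(** This is f^(l)(v) / l! for f the sum of [a]. For fixed l it is itself a power series in v, which
    later makes Taylor coefficients analytic in the base point. *)
Definition recentered (a : nat -> C) (v : C) (l : nat) : C :=
  psum_val (fun k => RtoC (INR (bin (l + k) l)) * a (l + k)%nat) v.

(** Row m of the array is the binomial expansion of a_m (v + u)^m, with absolute values summing to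
    |a_m| (|v| + |u|)^m; column l is u^l times the l-th Taylor coefficient at v. Absolute
    convergence at radius |v| + |u| allows summation by columns. *)
Lemma psum_recenter_aux (a : nat -> C) (r : R) (v u : C) :
  abs_conv a r -> (Cmod v + Cmod u <= r)%R ->
  exists c : nat -> C, psum_val a (v + u) = csum_val c /\ csum c (csum_val c) /\
    forall l, csum (fun k => (RtoC (INR (bin (l + k) l)) * a (l + k)%nat) * v ^ k * u ^ l)
      (c l).
Proof.
intros ha hr.
set (A := fun m l => a m * (RtoC (INR (bin m l)) * v ^ (m - l) * u ^ l)).
assert (hz : forall m l, (m < l)%nat -> A m l = 0).
{ intros m l h. unfold A. rewrite bin_gt by easy. simpl. ring. }
destruct (fubini A (fun m => a m * (v + u) ^ m)
  (fun m => (Cmod (a m) * (Cmod v + Cmod u) ^ m)%R)) as [s [h1 [h2 h3]]].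
- intros m. exists (sum_n (fun l => Cmod (A m l)) m). apply ex_series_finite.
  intros l hl. rewrite hz by easy. apply Cmod_0.
- intros m. apply Req_le.
  rewrite <- binomial_R.
  transitivity (sum_n (fun l => Cmod (A m l)) m).
  + apply is_series_unique, ex_series_finite.
    intros l hl. rewrite hz by easy. apply Cmod_0.
  + etransitivity; [|apply (@sum_n_mult_l R_Ring)]. apply sum_n_ext. intros l.
    unfold A. now rewrite !Cmod_mult, !Cmod_pow, Cmod_INR.
- apply (abs_conv_le a r); [|easy].
  pose proof (Cmod_ge_0 v). pose proof (Cmod_ge_0 u). lra.
- intros m. rewrite <- binomial_C, <- sum_n_C_scal.
  apply (csum_finite (A m)). apply hz.
- exists (fun l => csum_val (fun i => A i l)). split; [|split].
  + rewrite (csum_val_eq _ _ h2). unfold psum_val. now apply csum_val_eq.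
  + now rewrite (csum_val_eq _ _ h2).
  + intros l. specialize (h3 l).
    apply (is_series_drop_zeros _ l) in h3.
    * eapply csum_ext; [|exact h3]. intros k. unfold A; simpl.
      replace (l + k - l)%nat with k by lia. ring.
    * intros n hn. now apply hz.
Qed.

Lemma psum_recentered_coef (a : nat -> C) (r : R) (v : C) (l : nat) :
  abs_conv a r -> (Cmod v < r)%R ->
  psum (fun k => RtoC (INR (bin (l + k) l)) * a (l + k)%nat) v (recentered a v l).
Proof.
intros ha hr.
(* A nonzero admissible u, so that the factor u^l of column l can be divided out. *)
set (u := RtoC (r - Cmod v)).
assert (hu : u <> 0).
{ intros h. apply RtoC_inj in h. lra. }
destruct (psum_recenter_aux a r v u ha) as [c [_ [_ h]]].
{ unfold u. rewrite Cmod_R, Rabs_pos_eq; lra. }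
specialize (h l). apply (csum_scal (/ u ^ l)) in h.
assert (hp := Cpow_nz _ l hu).
assert (h' : psum (fun k => RtoC (INR (bin (l + k) l)) * a (l + k)%nat) v (/ u ^ l * c l)).
{ eapply csum_ext; [|exact h]. intros k; simpl. field. easy. }
unfold recentered, psum_val. unfold psum in *. now rewrite (csum_val_eq _ _ h').
Qed.

Lemma psum_recentered (a : nat -> C) (r : R) (v u s : C) :
  abs_conv a r -> (Cmod v < r)%R -> (Cmod v + Cmod u <= r)%R ->
  psum a (v + u) s -> psum (recentered a v) u s.
Proof.
intros ha hv hr hs.
destruct (psum_recenter_aux a r v u ha hr) as [c [h1 [h2 h3]]].
assert (hs' : psum_val a (v + u) = s) by now apply csum_val_eq.
rewrite <- h1, hs' in h2.
eapply csum_ext; [|exact h2]. intros l. simpl.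
apply (csum_unique _ _ _ (h3 l)).
pose proof (psum_recentered_coef a r v l ha hv) as h.
apply (csum_scal (u ^ l)) in h. rewrite Cmult_comm.
eapply csum_ext; [|exact h]. intros k; simpl. ring.
Qed.

Lemma abs_conv_recentered (a : nat -> C) (r p : R) (v : C) :
  abs_conv a r -> (0 <= p)%R -> (Cmod v + p < r)%R -> abs_conv (recentered a v) p.
Proof.
intros ha hp hr.
assert (hc : Cmod (RtoC (r - Cmod v)) = (r - Cmod v)%R).
{ rewrite Cmod_R, Rabs_pos_eq; lra. }
(* Convergence at the single point r - |v| gives absolute convergence at every smaller radius. *)
apply (psum_abs_conv _ (RtoC (r - Cmod v)) (psum_val a (v + RtoC (r - Cmod v)))).
- apply psum_recentered with r; [easy|lra|lra|].
  apply abs_conv_psum with r; [easy|].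
  eapply Rle_trans; [apply Cmod_triangle|]. lra.
- lra.
Qed.

(** * Products and quotients of power series *)

Definition conv_prod (a b : nat -> C) (n : nat) : C :=
  sum_n (fun j => a j * b (n - j)%nat) n.

(** In the array with entries a_j b_(n-j) w^n for j <= n, row j sums to a_j w^j t and column n is
    the n-th term of the Cauchy product. *)
Lemma psum_conv_prod (a b : nat -> C) (r : R) (w s t : C) :
  abs_conv a r -> abs_conv b r -> (Cmod w <= r)%R ->
  psum a w s -> psum b w t -> psum (conv_prod a b) w (s * t).
Proof.
intros ha hb hw hs ht.
set (A := fun j n => if le_lt_dec j n then (a j * w ^ j) * (b (n - j)%nat * w ^ (n - j))
                     else RtoC 0).
assert (hz : forall j n, (n < j)%nat -> A j n = 0).
{ intros j n h. unfold A. destruct (le_lt_dec j n); [lia|easy]. }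
assert (hA : forall j n, A j (j + n)%nat = (a j * w ^ j) * (b n * w ^ n)).
{ intros j n. unfold A. destruct (le_lt_dec j (j + n)); [|lia].
  now replace (j + n - j)%nat with n by lia. }
pose proof (abs_conv_term b r w hb hw) as hbt.
assert (hrow : forall j, is_series (fun n => Cmod (A j n))
  (Cmod (a j * w ^ j) * Series (fun n => Cmod (b n * w ^ n)))%R).
{ intros j. apply (is_series_drop_zeros _ j).
  - intros n hn. rewrite hz by easy. apply Cmod_0.
  - apply (is_series_ext (fun n => (Cmod (a j * w ^ j) * Cmod (b n * w ^ n))%R)).
    + intros n. rewrite hA. now rewrite <- Cmod_mult.
    + apply (@is_series_scal R_AbsRing R_NormedModule). now apply Series_correct. }
destruct (fubini A (fun j => (a j * w ^ j) * t)
  (fun j => (Cmod (a j * w ^ j) * Series (fun n => Cmod (b n * w ^ n)))%R)) as [v [h1 [h2 h3]]].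
- intros j. eexists. apply hrow.
- intros j. apply Req_le, is_series_unique, hrow.
- apply ex_series_scal_r. now apply abs_conv_term with r.
- intros j. apply (is_series_drop_zeros _ j).
  + intros n hn. now apply hz.
  + apply (csum_ext (fun n => (a j * w ^ j) * (b n * w ^ n))).
    * intros n. now rewrite hA.
    * now apply csum_scal.
- assert (hv : v = s * t).
  { apply (csum_unique _ _ _ h1). rewrite Cmult_comm.
    eapply csum_ext; [|apply (csum_scal t _ _ hs)]. intros n; simpl. ring. }
  rewrite <- hv. eapply csum_ext; [|exact h2]. intros n. simpl.
  apply csum_val_eq. unfold conv_prod. rewrite Cmult_comm, <- sum_n_C_scal.
  replace (sum_n (fun j => w ^ n * (a j * b (n - j)%nat)) n) with (sum_n (fun j => A j n) n).
  + apply csum_finite. intros j hj. now apply hz.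
  + apply sum_n_C_ext_loc. intros j hj. unfold A. destruct (le_lt_dec j n); [|lia].
    replace n with (j + (n - j))%nat at 3 by lia. rewrite Cpow_add_r. ring.
Qed.

(* Row [n] agrees with the quotient series up to index [n]. *)
Fixpoint quot_rows (g u : nat -> C) (n : nat) : nat -> C :=
  match n with
  | O => fun _ => g 0%nat / u 0%nat
  | S n' => fun k =>
      if le_lt_dec k n' then quot_rows g u n' k
      else (g n - sum_n (fun j => u (n - j)%nat * quot_rows g u n' j) n') / u 0%nat
  end.

Definition quot (g u : nat -> C) (n : nat) : C := quot_rows g u n n.

Lemma quot_rows_eq (g u : nat -> C) (n k : nat) :
  (k <= n)%nat -> quot_rows g u n k = quot g u k.
Proof.
intros h. induction h as [|n h IH]; [easy|].
simpl quot_rows. destruct (le_lt_dec k n); [easy|lia].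
Qed.

Lemma quot_S (g u : nat -> C) (n : nat) :
  quot g u (S n) = (g (S n) - sum_n (fun j => u (S n - j)%nat * quot g u j) n) / u 0%nat.
Proof.
unfold quot at 1.
change (quot_rows g u (S n) (S n)) with
  (if le_lt_dec (S n) n then quot_rows g u n (S n)
   else (g (S n) - sum_n (fun j => u (S n - j)%nat * quot_rows g u n j) n) / u 0%nat).
destruct (le_lt_dec (S n) n); [lia|].
f_equal. f_equal. apply sum_n_C_ext_loc. intros j hj.
now rewrite quot_rows_eq.
Qed.

Lemma conv_prod_quot (g u : nat -> C) (n : nat) :
  u 0%nat <> 0 -> conv_prod (quot g u) u n = g n.
Proof.
intros hu. unfold conv_prod. destruct n as [|n].
- rewrite sum_n_C_O. unfold quot; simpl. field. easy.
- rewrite sum_n_C_S. rewrite Nat.sub_diag, quot_S.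
  rewrite (sum_n_C_ext (fun j => quot g u j * u (S n - j)%nat)
             (fun j => u (S n - j)%nat * quot g u j)).
  2:{ intros; apply Cmult_comm. }
  field. easy.
Qed.

(** With c the quotient and S_n = 1 + the sum of |c_j| r^j over j <= n, the recursion gives
    |c_(n+1)| r^(n+1) <= M S_n, hence S_(n+1) <= (1 + M) S_n. The induction therefore carries a
    bound for S_n along. *)
Lemma quot_bound (g u : nat -> C) (r M : R) :
  (0 < r)%R -> (0 <= M)%R ->
  (forall n, (Cmod (g n / u 0%nat) * r ^ n <= M)%R) ->
  (forall n, (Cmod (u n / u 0%nat) * r ^ n <= M)%R) -> u 0%nat <> 0 ->
  forall n, (Cmod (quot g u n) * r ^ n <= (1 + M) ^ (S n))%R.
Proof.
intros hr hM hg hu hu0.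
assert (H : forall n,
  (1 + sum_n (fun j => Cmod (quot g u j) * r ^ j) n <= (1 + M) ^ (S n))%R /\
  (Cmod (quot g u n) * r ^ n <= (1 + M) ^ (S n))%R).
{ induction n as [|n [IH _]].
  - rewrite sum_O. specialize (hg 0%nat). unfold quot; simpl in *. lra.
  - assert (h : (Cmod (quot g u (S n)) * r ^ S n <=
      M * (1 + sum_n (fun j => Cmod (quot g u j) * r ^ j) n))%R).
    { rewrite quot_S.
      replace ((g (S n) - sum_n (fun j => u (S n - j)%nat * quot g u j) n) / u 0%nat)
        with (g (S n) / u 0%nat + - (sum_n (fun j => (u (S n - j)%nat / u 0%nat) * quot g u j) n)).
      2:{ rewrite (sum_n_C_ext (fun j => u (S n - j)%nat / u 0%nat * quot g u j)
           (fun j => / u 0%nat * (u (S n - j)%nat * quot g u j))).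
          - rewrite sum_n_C_scal. field. easy.
          - intros j. field. easy. }
      apply Rle_trans with ((Cmod (g (S n) / u 0%nat) +
        sum_n (fun j => Cmod (u (S n - j)%nat / u 0%nat * quot g u j)) n) * r ^ S n)%R.
      { apply Rmult_le_compat_r; [apply pow_le; lra|].
        eapply Rle_trans; [apply Cmod_triangle|]. rewrite Cmod_opp.
        apply Rplus_le_compat_l, Cmod_sum_n. }
      rewrite Rmult_plus_distr_r, Rmult_plus_distr_l, Rmult_1_r.
      apply Rplus_le_compat; [apply hg|].
      rewrite Rmult_comm.
      rewrite <- (sum_n_mult_l (K := R_Ring) (r ^ S n)%R), <- (sum_n_mult_l (K := R_Ring) M).

      rewrite !sum_n_Reals. apply sum_Rle. intros j hj.
      change mult with Rmult. rewrite Cmod_mult.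
      specialize (hu (S n - j)%nat).
      replace (r ^ S n)%R with (r ^ (S n - j) * r ^ j)%R
        by (rewrite <- pow_add; f_equal; lia).
      replace (r ^ (S n - j) * r ^ j * (Cmod (u (S n - j)%nat / u 0%nat) * Cmod (quot g u j)))%R
        with ((Cmod (u (S n - j)%nat / u 0%nat) * r ^ (S n - j)) * (Cmod (quot g u j) * r ^ j))%R
        by ring.
      apply Rmult_le_compat_r; [|easy].
      apply Rmult_le_pos; [apply Cmod_ge_0|apply pow_le; lra]. }
    rewrite sum_Sn. change plus with Rplus.
    assert (hp : (0 <= (1 + M) ^ S n)%R) by (apply pow_le; lra).
    change ((1 + M) ^ S (S n))%R with ((1 + M) * (1 + M) ^ S n)%R.
    set (X := sum_n (fun j => (Cmod (quot g u j) * r ^ j)%R) n) in *.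
    change (AbelianMonoid.sort R_AbelianMonoid) with R in X.
    set (Y := (Cmod (quot g u (S n)) * r ^ S n)%R) in *.
    set (Z := ((1 + M) ^ S n)%R) in *.
    clearbody X Y Z. split; nra. }
intros n. apply H.
Qed.

Lemma psum_quot (g u : nat -> C) (r : R) :
  (0 < r)%R -> abs_conv g r -> abs_conv u r -> u 0%nat <> 0 ->
  exists p : R, (0 < p <= r)%R /\ abs_conv (quot g u) p /\
    forall w s t, (Cmod w <= p)%R -> psum g w s -> psum u w t ->
      t <> 0 /\ psum (quot g u) w (s / t).
Proof.
intros hr hg hu hu0.
assert (hb : forall a : nat -> C, abs_conv a r -> exists M, (0 <= M)%R /\
  forall n, (Cmod (a n / u 0%nat) * r ^ n <= M)%R).
{ intros a ha.
  destruct (csum_bounded _ _ (abs_conv_psum a r (RtoC r) ha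
    ltac:(rewrite Cmod_R, Rabs_pos_eq; lra))) as [M [hM h]].
  exists (M * / Cmod (u 0%nat))%R.
  assert (hi : (0 < / Cmod (u 0%nat))%R) by now apply Rinv_0_lt_compat, Cmod_gt_0.
  split; [nra|]. intros n. specialize (h n).
  rewrite Cmod_mult, Cmod_pow, Cmod_R, (Rabs_pos_eq r) in h by lra.
  rewrite Cmod_div by easy. unfold Rdiv.
  replace (Cmod (a n) * / Cmod (u 0%nat) * r ^ n)%R
    with ((Cmod (a n) * r ^ n) * / Cmod (u 0%nat))%R by ring.
  apply Rmult_le_compat_r; lra. }
destruct (hb g hg) as [M1 [hM1 h1]]. destruct (hb u hu) as [M2 [hM2 h2]].
set (M := (M1 + M2)%R).
assert (hM : (0 <= M)%R) by (unfold M; lra).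
assert (hq : forall n, (Cmod (quot g u n) * r ^ n <= (1 + M) ^ (S n))%R).
{ apply quot_bound; [easy|easy| | |easy]; intros n;
    [specialize (h1 n)|specialize (h2 n)]; unfold M; lra. }
assert (hcv : abs_conv (quot g u) (r / (2 * (1 + M)))).
{ apply (abs_conv_geom _ (1 + M) (r / (1 + M))).
  - split; [left; apply Rdiv_lt_0_compat; lra|].
    unfold Rdiv. apply Rmult_lt_compat_l; [easy|]. apply Rinv_lt_contravar; nra.
  - intros n. unfold Rdiv. rewrite Rpow_mult_distr, <- Rmult_assoc, pow_inv.
    apply Rle_div_l; [apply Rlt_gt, pow_lt; lra|]. apply hq. }
destruct (psum_near_0 u r hr hu) as [K [hK hnear]].
assert (hc0 : (0 < Cmod (u 0%nat))%R) by now apply Cmod_gt_0.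
assert (hd : (0 < Cmod (u 0%nat) / (2 * (K + 1)))%R) by (apply Rdiv_lt_0_compat; lra).
assert (hp0 : (0 < r / (2 * (1 + M)))%R) by (apply Rdiv_lt_0_compat; lra).
(* Three constraints: the given series converge within r; the coefficient bound makes the quotient
   converge below r / (1 + M), of which half is taken; and for |w| <= |u_0| / (2 (K + 1)) the
   denominator stays within |u_0| / 2 of u_0, hence nonzero. *)
exists (Rmin r (Rmin (r / (2 * (1 + M))) (Cmod (u 0%nat) / (2 * (K + 1))))).
set (p := Rmin r _).
assert (hpr : (p <= r)%R) by apply Rmin_l.
assert (hp1 : (p <= r / (2 * (1 + M)))%R).
{ eapply Rle_trans; [apply Rmin_r|apply Rmin_l]. }
assert (hp2 : (p <= Cmod (u 0%nat) / (2 * (K + 1)))%R).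
{ eapply Rle_trans; [apply Rmin_r|apply Rmin_r]. }
assert (hp : (0 < p)%R) by now repeat apply Rmin_pos.
split; [easy|].
assert (hcp : abs_conv (quot g u) p) by (apply abs_conv_le with (2 := hcv); lra).
split; [easy|].
intros w s t hw hs ht.
assert (ht0 : t <> 0).
{ intros ->. specialize (hnear w 0 ltac:(lra) ht).
  replace (0 - u 0%nat) with (- u 0%nat) in hnear by ring. rewrite Cmod_opp in hnear.
  assert (hw2 : (Cmod w * (2 * (K + 1)) <= Cmod (u 0%nat))%R).
  { apply Rle_div_r; [lra|]. lra. }
  pose proof (Cmod_ge_0 w). nra. }
split; [easy|].
pose proof (abs_conv_psum _ _ w hcp hw) as hqs.
(* The value of the quotient series is identified by multiplying it back with the denominator. *)
pose proof (psum_conv_prod _ _ p w _ _ hcp (abs_conv_le _ r p ltac:(lra) hu) hw hqs ht) as h.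
assert (hst : psum_val (quot g u) w * t = s).
{ apply (psum_unique g w); [|easy]. eapply psum_ext; [|exact h].
  intros n. now apply conv_prod_quot. }
replace (s / t) with (psum_val (quot g u) w); [easy|]. rewrite <- hst. field. easy.
Qed.

(** * The exponential *)

Lemma Re_sum_n (a : nat -> C) (n : nat) : Re (sum_n a n) = sum_n (fun k => Re (a k)) n.
Proof.
induction n as [|n IH]; [now rewrite !sum_O|]. rewrite !sum_Sn, <- IH. easy.
Qed.

Lemma Im_sum_n (a : nat -> C) (n : nat) : Im (sum_n a n) = sum_n (fun k => Im (a k)) n.
Proof.
induction n as [|n IH]; [now rewrite !sum_O|]. rewrite !sum_Sn, <- IH. easy.
Qed.

Lemma im_le_Cmod (c : C) : (Rabs (Im c) <= Cmod c)%R.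
Proof.
replace (Im c) with (- Re (c * Ci))%R by (rewrite re_mult_Ci; ring).
rewrite Rabs_Ropp. eapply Rle_trans; [apply re_le_Cmod|].
rewrite Cmod_mult, Cmod_Ci. lra.
Qed.

Lemma csum_Re (a : nat -> C) (s : C) : csum a s -> is_series (fun n => Re (a n)) (Re s).
Proof.
intros H. unfold is_series.
apply (@filterlim_locally_ball_norm R_AbsRing nat R_NormedModule eventually _).
intros e. destruct (proj1 (csum_eps a s) H e (cond_pos e)) as [N hN]. exists N.
intros n hn. unfold ball_norm. rewrite <- Re_sum_n.
change (Rabs (Re (sum_n a n - s)) < e)%R.
eapply Rle_lt_trans; [apply re_le_Cmod|]. now apply hN.
Qed.

Lemma csum_Im (a : nat -> C) (s : C) : csum a s -> is_series (fun n => Im (a n)) (Im s).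
Proof.
intros H. unfold is_series.
apply (@filterlim_locally_ball_norm R_AbsRing nat R_NormedModule eventually _).
intros e. destruct (proj1 (csum_eps a s) H e (cond_pos e)) as [N hN]. exists N.
intros n hn. unfold ball_norm. rewrite <- Im_sum_n.
change (Rabs (Im (sum_n a n - s)) < e)%R.
eapply Rle_lt_trans; [apply im_le_Cmod|]. now apply hN.
Qed.

Lemma INR_fact_pos (n : nat) : (0 < INR (fact n))%R.
Proof. apply lt_0_INR, lt_O_fact. Qed.

Lemma is_series_exp (x : R) : is_series (fun n => x ^ n / INR (fact n))%R (exp x).
Proof.
pose proof (is_exp_Reals x) as h. apply is_pseries_R in h.
eapply is_series_ext; [|exact h]. intros n; simpl. field. apply INR_fact_neq_0.
Qed.

Lemma CV_radius_all (a : nat -> R) (x : R) :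
  (forall y, ex_series (fun n => a n * y ^ n)%R) -> Rbar_lt (Rabs x) (CV_radius a).
Proof.
intros h. apply Rbar_not_le_lt. intros hle.
apply (CV_disk_outside a (Rabs x + 1)).
- eapply Rbar_le_lt_trans; [apply hle|]. simpl.
  rewrite (Rabs_pos_eq (Rabs x + 1)); [lra|]. pose proof (Rabs_pos x). lra.
- apply ex_series_lim_0, h.
Qed.

(** Since [Cexp] is built from the real exp, cos and sin, the series is restricted to the points t w
    with t real; its real and imaginary parts are then real power series in t. *)
Lemma csum_Cexp (w : C) : csum (fun n => w ^ n / RtoC (INR (fact n))) (Cexp w).
Proof.
set (c := fun n => w ^ n / RtoC (INR (fact n))).
assert (hf : forall n, RtoC (INR (fact n)) <> 0).
{ intros n h. apply RtoC_inj in h. pose proof (INR_fact_pos n). lra. }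
assert (hcm : forall n, Cmod (c n) = (Cmod w ^ n / INR (fact n))%R).
{ intros n. unfold c. rewrite Cmod_div, Cmod_pow, Cmod_INR; easy. }
assert (habs : forall r, (0 <= r)%R -> abs_conv c r).
{ intros r hr. eexists. eapply is_series_ext; [|apply (is_series_exp (Cmod w * r))].
  intros n. simpl. rewrite hcm, Rpow_mult_distr. unfold Rdiv. ring. }
assert (hps : forall t : R, psum c (RtoC t) (psum_val c (RtoC t))).
{ intros t. apply abs_conv_psum with (Rabs t); [apply habs, Rabs_pos|]. rewrite Cmod_R.
  apply Rle_refl. }
set (x := Re w). set (y := Im w).
set (a := fun n => Re (c n)). set (b := fun n => Im (c n)).
assert (ha : forall t, is_series (fun n => a n * t ^ n)%R (Re (psum_val c (RtoC t)))).
{ intros t. eapply is_series_ext; [|apply (csum_Re _ _ (hps t))]. intros n. cbv beta.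
  now rewrite <- RtoC_pow, re_scal_r. }
assert (hb : forall t, is_series (fun n => b n * t ^ n)%R (Im (psum_val c (RtoC t)))).
{ intros t. eapply is_series_ext; [|apply (csum_Im _ _ (hps t))]. intros n. cbv beta.
  now rewrite <- RtoC_pow, im_scal_r. }
(* This recursion is F' = w F at the level of coefficients; its real and imaginary parts yield a
   linear system for the two real series. *)
assert (hc1 : forall n, INR (S n) * c (S n) = w * c n).
{ intros n. unfold c. rewrite fact_simpl, mult_INR, RtoC_mult, Cpow_S.
  field. split; [easy|]. intros h. apply RtoC_inj in h. revert h. apply not_0_INR. lia. }
assert (hda : forall n, PS_derive a n = (x * a n - y * b n)%R).
{ intros n. unfold PS_derive, a, b. rewrite <- re_scal_l, hc1, re_mult. easy. }
assert (hdb : forall n, PS_derive b n = (x * b n + y * a n)%R).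
{ intros n. unfold PS_derive, a, b. rewrite <- im_scal_l, hc1, im_mult. unfold x, y. ring. }
assert (hsa : forall t, PSeries a t = Re (psum_val c (RtoC t))).
{ intros t. apply is_pseries_unique, is_pseries_R, ha. }
assert (hsb : forall t, PSeries b t = Im (psum_val c (RtoC t))).
{ intros t. apply is_pseries_unique, is_pseries_R, hb. }
assert (hea : forall t, ex_series (fun n => a n * t ^ n)%R) by (intros t; eexists; apply ha).
assert (heb : forall t, ex_series (fun n => b n * t ^ n)%R) by (intros t; eexists; apply hb).
assert (hua : forall t, is_derive (PSeries a) t (x * PSeries a t - y * PSeries b t)%R).
{ intros t.
  replace (x * PSeries a t - y * PSeries b t)%R with (PSeries (PS_derive a) t).
  - apply is_derive_PSeries, CV_radius_all, hea.
  - apply is_pseries_unique, is_pseries_R.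
    apply (is_series_ext (fun n => (x * (a n * t ^ n) + - (y * (b n * t ^ n)))%R)).
    { intros n. rewrite hda. apply Rminus_diag_uniq. ring. }
    rewrite hsa, hsb.
    apply (@is_series_minus R_AbsRing R_NormedModule);
      apply (@is_series_scal R_AbsRing R_NormedModule); [apply ha|apply hb]. }
assert (hub : forall t, is_derive (PSeries b) t (x * PSeries b t + y * PSeries a t)%R).
{ intros t.
  replace (x * PSeries b t + y * PSeries a t)%R with (PSeries (PS_derive b) t).
  - apply is_derive_PSeries, CV_radius_all, heb.
  - apply is_pseries_unique, is_pseries_R.
    apply (is_series_ext (fun n => (x * (b n * t ^ n) + (y * (a n * t ^ n)))%R)).
    { intros n. rewrite hdb. apply Rminus_diag_uniq. ring. }
    rewrite hsa, hsb.
    apply (@is_series_plus R_AbsRing R_NormedModule);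
      apply (@is_series_scal R_AbsRing R_NormedModule); [apply hb|apply ha]. }
assert (hDa : forall t, Derive (fun s : R => PSeries a s) t
  = (x * PSeries a t - y * PSeries b t)%R).
{ intros t. apply is_derive_unique, hua. }
assert (hDb : forall t, Derive (fun s : R => PSeries b s) t
  = (x * PSeries b t + y * PSeries a t)%R).
{ intros t. apply is_derive_unique, hub. }
(* [exp (- t w) * sum_n c_n t^n] has derivative zero in the real variable [t]. *)
set (p := fun t => (exp (- t * x) * (PSeries a t * cos (t * y) + PSeries b t * sin (t * y)))%R).
set (q := fun t => (exp (- t * x) * (PSeries b t * cos (t * y) - PSeries a t * sin (t * y)))%R).
assert (hp : p 0%R = p 1%R).
{ apply (@eq_is_derive R_NormedModule); [|lra]. intros t _. unfold p. auto_derive.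
  - repeat split; eexists; [apply hua|apply hub].
  - rewrite hDa, hDb. change zero with 0%R. ring. }
assert (hq : q 0%R = q 1%R).
{ apply (@eq_is_derive R_NormedModule); [|lra]. intros t _. unfold q. auto_derive.
  - repeat split; eexists; [apply hub|apply hua].
  - rewrite hDa, hDb. change zero with 0%R. ring. }
assert (ha0 : PSeries a 0 = 1%R).
{ rewrite PSeries_0. unfold a, c. simpl. field. }
assert (hb0 : PSeries b 0 = 0%R).
{ rewrite PSeries_0. unfold b, c. simpl. field. }
unfold p, q in hp, hq. rewrite ha0, hb0, Ropp_0, !Rmult_0_l, exp_0 in hp, hq.
rewrite cos_0 in hp. rewrite sin_0 in hq. rewrite !Rmult_1_l in hp, hq.
replace (- (1) * x)%R with (- x)%R in hp, hq by ring.
rewrite exp_Ropp in hp, hq.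
assert (hex : (exp x <> 0)%R) by (pose proof (exp_pos x); lra).
set (U := PSeries a 1) in *. set (V := PSeries b 1) in *.
assert (h1 : (U * cos y + V * sin y = exp x)%R).
{ apply (Rmult_eq_reg_l (/ exp x)); [|now apply Rinv_neq_0_compat].
  rewrite Rinv_l by easy. lra. }
assert (h2 : (V * cos y - U * sin y = 0)%R).
{ apply (Rmult_eq_reg_l (/ exp x)); [|now apply Rinv_neq_0_compat]. lra. }
assert (hcs := sin2_cos2 y). unfold Rsqr in hcs.
assert (hU : U = (exp x * cos y)%R).
{ transitivity ((U * cos y + V * sin y) * cos y - (V * cos y - U * sin y) * sin y)%R.
  - transitivity (U * (sin y * sin y + cos y * cos y))%R; [rewrite hcs|]; ring.
  - rewrite h1, h2. ring. }
assert (hV : V = (exp x * sin y)%R).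
{ transitivity ((U * cos y + V * sin y) * sin y + (V * cos y - U * sin y) * cos y)%R.
  - transitivity (V * (sin y * sin y + cos y * cos y))%R; [rewrite hcs|]; ring.
  - rewrite h1, h2. ring. }
assert (hE : Cexp w = psum_val c (RtoC 1)).
{ unfold U in hU; unfold V in hV. rewrite hsa in hU. rewrite hsb in hV.
  unfold Cexp. fold x y. rewrite <- hU, <- hV. now destruct (psum_val c 1). }
rewrite hE. eapply csum_ext; [|apply (hps 1%R)].
intros n; simpl. rewrite Cpow_1_l. ring.
Qed.

Lemma Cexp_plus (z w : C) : Cexp (z + w) = Cexp z * Cexp w.
Proof.
unfold Cexp. rewrite re_plus, im_plus, exp_plus, cos_plus, sin_plus.
unfold Cmult; simpl. f_equal; ring.
Qed.

Lemma Cmod_Cexp (z : C) : Cmod (Cexp z) = exp (Re z).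
Proof.
unfold Cmod, Cexp; simpl.
replace (exp (Re z) * cos (Im z) * (exp (Re z) * cos (Im z) * 1) +
   exp (Re z) * sin (Im z) * (exp (Re z) * sin (Im z) * 1))%R
  with (exp (Re z) * exp (Re z) * (sin (Im z) * sin (Im z) + cos (Im z) * cos (Im z)))%R by ring.
pose proof (sin2_cos2 (Im z)) as h. unfold Rsqr in h. rewrite h, Rmult_1_r.
apply sqrt_square. left; apply exp_pos.
Qed.

Lemma Cexp_nz (z : C) : Cexp z <> 0.
Proof. apply Cmod_gt_0. rewrite Cmod_Cexp. apply exp_pos. Qed.

Lemma Cexp_0 : Cexp 0 = 1.
Proof. unfold Cexp; simpl. rewrite exp_0, cos_0, sin_0. unfold RtoC. f_equal; ring. Qed.

Lemma Cexp_pow (z : C) (n : nat) : Cexp z ^ n = Cexp (RtoC (INR n) * z).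
Proof.
induction n as [|n IH].
- simpl. rewrite Cmult_0_l. now rewrite Cexp_0.
- rewrite Cpow_S, IH, <- Cexp_plus, S_INR, RtoC_plus. f_equal. ring.
Qed.

(** * Series of exponentials *)

(** Expanding each exponential around z0 gives a double series whose row m has absolute sum |c_m|
    e^(nu_m Re z0) e^(|nu_m| |w|), so the hypothesis is the majorant required by [fubini]. The
    explicit formula for the coefficients is kept because the series of P_k is read off from it. *)
Lemma Cexp_series_taylor (c : nat -> C) (nu : nat -> R) (z0 : C) (r : R) :
  (0 < r)%R ->
  ex_series (fun m => Cmod (c m) * exp (nu m * Re z0) * exp (Rabs (nu m) * r))%R ->
  exists a : nat -> C,
    (forall l, csum (fun m => c m * (RtoC (nu m ^ l / INR (fact l)) * Cexp (RtoC (nu m) * z0)))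
      (a l)) /\
    (forall w, (Cmod w <= r)%R ->
      csum (fun m => c m * Cexp (RtoC (nu m) * (z0 + w))) (psum_val a w)) /\
    (forall p, (0 <= p < r)%R -> abs_conv a p).
Proof.
intros hr hs.
assert (key : forall w, (Cmod w <= r)%R -> exists s,
   csum (fun m => c m * Cexp (RtoC (nu m) * (z0 + w))) s /\
   exists b, csum b s /\ forall l, csum (fun m =>
     c m * (RtoC (nu m ^ l / INR (fact l)) * Cexp (RtoC (nu m) * z0)) * w ^ l) (b l)).
{ intros w hw.
  set (A := fun m l => c m * (RtoC (nu m ^ l / INR (fact l)) * Cexp (RtoC (nu m) * z0)) * w ^ l).
  assert (hA : forall m l, A m l = c m * Cexp (RtoC (nu m) * z0) *
    ((RtoC (nu m) * w) ^ l / RtoC (INR (fact l)))).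
  { intros m l. unfold A. rewrite RtoC_div by apply INR_fact_neq_0.
    rewrite RtoC_pow, Cpow_mult_l. field. intros h. apply RtoC_inj in h.
    now apply INR_fact_neq_0 in h. }
  assert (hrow : forall m, csum (A m) (c m * Cexp (RtoC (nu m) * (z0 + w)))).
  { intros m. rewrite Cmult_plus_distr_l, Cexp_plus, Cmult_assoc.
    eapply csum_ext; [|apply csum_scal, csum_Cexp]. intros l. simpl. now rewrite hA. }
  assert (habs : forall m, is_series (fun l => Cmod (A m l))
     (Cmod (c m) * exp (nu m * Re z0) * exp (Rabs (nu m) * Cmod w))%R).
  { intros m. eapply is_series_ext;
     [|apply (@is_series_scal R_AbsRing R_NormedModule), (is_series_exp (Rabs (nu m) * Cmod w))].
    intros l. rewrite hA, !Cmod_mult, Cmod_div, Cmod_pow, Cmod_mult, !Cmod_R, Cmod_Cexp, re_scal_l.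
    - rewrite (Rabs_pos_eq (INR (fact l))) by apply pos_INR. reflexivity.
    - intros h. apply RtoC_inj in h. now apply INR_fact_neq_0 in h. }
  destruct (fubini A (fun m => c m * Cexp (RtoC (nu m) * (z0 + w)))
    (fun m => Cmod (c m) * exp (nu m * Re z0) * exp (Rabs (nu m) * r))%R) as [s [h1 [h2 h3]]].
  - intros m. eexists; apply habs.
  - intros m. rewrite (is_series_unique _ _ (habs m)).
    apply Rmult_le_compat_l.
    + apply Rmult_le_pos; [apply Cmod_ge_0|left; apply exp_pos].
    +
      destruct (Rle_lt_or_eq_dec _ _ hw) as [h|h]; [|rewrite h; apply Rle_refl].
      destruct (Rle_lt_or_eq_dec _ _ (Rabs_pos (nu m))) as [h'|h'].
      * left. apply exp_increasing. now apply Rmult_lt_compat_l.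
      * rewrite <- h', !Rmult_0_l. apply Rle_refl.
  - easy.
  - easy.
  - exists s. split; [easy|]. exists (fun l => csum_val (fun m => A m l)). easy. }
assert (hcr : Cmod (RtoC r) = r) by (rewrite Cmod_R, Rabs_pos_eq; lra).
assert (hr0 : RtoC r <> 0) by (apply Cmod_gt_0; lra).
set (a := fun l => csum_val (fun m =>
   c m * (RtoC (nu m ^ l / INR (fact l)) * Cexp (RtoC (nu m) * z0)))).
(* Column l carries the factor w^l, which is removed at the nonzero point w = r. *)
assert (ha : forall l, csum (fun m =>
   c m * (RtoC (nu m ^ l / INR (fact l)) * Cexp (RtoC (nu m) * z0))) (a l)).
{ intros l. destruct (key (RtoC r)) as [s [_ [b [_ hb]]]]; [lra|].
  assert (hrl := Cpow_nz _ l hr0).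
  assert (h : csum (fun m =>
    c m * (RtoC (nu m ^ l / INR (fact l)) * Cexp (RtoC (nu m) * z0))) (/ RtoC r ^ l * b l)).
  { eapply csum_ext; [|apply (csum_scal _ _ _ (hb l))]. intros m; cbv beta.
    field. easy. }
  unfold a. now rewrite (csum_val_eq _ _ h). }
assert (hpw : forall w, (Cmod w <= r)%R -> exists s,
   csum (fun m => c m * Cexp (RtoC (nu m) * (z0 + w))) s /\ psum a w s).
{ intros w hw. destruct (key w hw) as [s [h1 [b [h2 h3]]]]. exists s. split; [easy|].
  eapply csum_ext; [|exact h2]. intros l. cbv beta.
  apply (csum_unique _ _ _ (h3 l)). rewrite Cmult_comm.
  eapply csum_ext; [|apply (csum_scal (w ^ l) _ _ (ha l))]. intros m; cbv beta. ring. }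
exists a. split; [easy|split].
- intros w hw. destruct (hpw w hw) as [s [h1 h2]].
  unfold psum_val. now rewrite (csum_val_eq _ _ h2).
- intros p hp. destruct (hpw (RtoC r)) as [s [_ h2]]; [lra|].
  apply (psum_abs_conv _ _ _ _ h2). lra.
Qed.

(** * Germs with at most a simple pole *)

(** Laurent expansion with residue [c] and regular part [a]. The disc is punctured so that the value
    of [f] at [z0], arbitrary at a pole, does not intervene. *)
Definition germ (f : C -> C) (z0 c : C) (a : nat -> C) : Prop :=
  exists r : R, (0 < r)%R /\ abs_conv a r /\
    forall w, (0 < Cmod w < r)%R -> psum a w (f (z0 + w) - c / w).

Lemma small_point (d : R) : (0 < d)%R -> exists w : C, (0 < Cmod w < d)%R.
Proof.
intros hd. exists (RtoC (d / 2)). rewrite Cmod_R, Rabs_pos_eq; lra.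
Qed.

Lemma Cmod_pos_nz (w : C) : (0 < Cmod w)%R -> w <> 0.
Proof. apply Cmod_gt_0. Qed.

Lemma germ_unique (f : C -> C) (z0 c c' : C) (a a' : nat -> C) :
  germ f z0 c a -> germ f z0 c' a' -> c = c' /\ forall n, a n = a' n.
Proof.
intros [r [hr [ha h]]] [r' [hr' [ha' h']]].
(* Multiplication by w turns the difference of the two expansions into a power series with constant
   term c - c', and this series vanishes at all small nonzero w. *)
set (b := fun n => match n with O => c - c' | S n => a n - a' n end).
assert (hb : forall n, b n = 0).
{ apply (psum_zero_coef b (Rmin r r')).
  - now apply Rmin_pos.
  - apply abs_conv_incr. apply abs_conv_minus.
    + left; now apply Rmin_pos.
    + apply abs_conv_le with (2 := ha). split; [left; now apply Rmin_pos|apply Rmin_l].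
    + apply abs_conv_le with (2 := ha'). split; [left; now apply Rmin_pos|apply Rmin_r].
  - intros d hd. destruct (small_point (Rmin d (Rmin r r'))) as [w [hw0 hw]].
    { now repeat apply Rmin_pos. }
    assert (hw1 : (Cmod w < d)%R) by (eapply Rlt_le_trans; [apply hw|apply Rmin_l]).
    assert (hw2 : (Cmod w < Rmin r r')%R) by (eapply Rlt_le_trans; [apply hw|apply Rmin_r]).
    assert (hw3 : (Cmod w < r)%R) by (eapply Rlt_le_trans; [apply hw2|apply Rmin_l]).
    assert (hw4 : (Cmod w < r')%R) by (eapply Rlt_le_trans; [apply hw2|apply Rmin_r]).
    exists w. split; [lra|].
    assert (hwn := Cmod_pos_nz w hw0).
    pose proof (psum_minus _ _ _ _ _ (h w (conj hw0 hw3)) (h' w (conj hw0 hw4))) as hs.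
    apply (psum_incr b) in hs. simpl b in hs.
    replace (c - c' + w * (f (z0 + w) - c / w - (f (z0 + w) - c' / w))) with (RtoC 0) in hs;
      [easy|]. field. easy. }
split.
- apply Ceq_minus, (hb 0%nat).
- intros n. apply Ceq_minus, (hb (S n)).
Qed.

Lemma germ_ext (f : C -> C) (z0 c : C) (a b : nat -> C) :
  (forall n, a n = b n) -> germ f z0 c a -> germ f z0 c b.
Proof.
intros h [r [hr [ha H]]]. exists r. split; [easy|]. split.
- now apply (abs_conv_ext a).
- intros w hw. apply (psum_ext a); [easy|]. now apply H.
Qed.

Lemma germ_transport (f g : C -> C) (z0 z1 c : C) (a : nat -> C) (d : R) :
  (0 < d)%R -> (forall w, (0 < Cmod w < d)%R -> g (z1 + w) = f (z0 + w)) ->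
  germ f z0 c a -> germ g z1 c a.
Proof.
intros hd h [r [hr [ha H]]]. exists (Rmin d r).
split; [now apply Rmin_pos|]. split.
- apply abs_conv_le with (2 := ha). split; [left; now apply Rmin_pos|apply Rmin_r].
- intros w [hw0 hw].
  rewrite h; [apply H|]; split; try easy.
  + eapply Rlt_le_trans; [apply hw|apply Rmin_r].
  + eapply Rlt_le_trans; [apply hw|apply Rmin_l].
Qed.

Lemma germ_plus (f g : C -> C) (z0 c c' : C) (a a' : nat -> C) :
  germ f z0 c a -> germ g z0 c' a' ->
  germ (fun z => f z + g z) z0 (c + c') (fun n => a n + a' n).
Proof.
intros [r [hr [ha h]]] [r' [hr' [ha' h']]]. exists (Rmin r r').
assert (hm : (0 < Rmin r r')%R) by now apply Rmin_pos.
split; [easy|]. split.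
- apply abs_conv_plus; [lra| |].
  + apply abs_conv_le with (2 := ha). split; [lra|apply Rmin_l].
  + apply abs_conv_le with (2 := ha'). split; [lra|apply Rmin_r].
- intros w [hw0 hw].
  assert (hw3 : (Cmod w < r)%R) by (eapply Rlt_le_trans; [apply hw|apply Rmin_l]).
  assert (hw4 : (Cmod w < r')%R) by (eapply Rlt_le_trans; [apply hw|apply Rmin_r]).
  assert (hwn := Cmod_pos_nz w hw0).
  replace (f (z0 + w) + g (z0 + w) - (c + c') / w)
    with ((f (z0 + w) - c / w) + (g (z0 + w) - c' / w)) by (field; easy).
  apply psum_plus; [apply h|apply h']; easy.
Qed.

Lemma germ_scal (k : C) (f : C -> C) (z0 c : C) (a : nat -> C) :
  germ f z0 c a -> germ (fun z => k * f z) z0 (k * c) (fun n => k * a n).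
Proof.
intros [r [hr [ha h]]]. exists r. split; [easy|]. split.
- now apply abs_conv_scal.
- intros w hw. assert (hwn := Cmod_pos_nz w (proj1 hw)).
  replace (k * f (z0 + w) - k * c / w) with (k * (f (z0 + w) - c / w)) by (field; easy).
  apply psum_scal. now apply h.
Qed.

Lemma germ_dilate (al : C) (f : C -> C) (z0 c : C) (a : nat -> C) :
  al <> 0 -> germ f (al * z0) c a ->
  germ (fun z => f (al * z)) z0 (c / al) (fun n => a n * al ^ n).
Proof.
intros hal [r [hr [ha h]]].
assert (hm := proj1 (Cmod_gt_0 al) hal).
exists (r / Cmod al)%R. split; [now apply Rdiv_lt_0_compat|]. split.
- eapply ex_series_ext; [|exact ha]. intros n. cbv beta.
  rewrite Cmod_mult, Cmod_pow. unfold Rdiv. rewrite Rpow_mult_distr, pow_inv.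
  apply Rminus_diag_uniq. field. apply pow_nonzero. lra.
- intros w [hw0 hw]. assert (hwn := Cmod_pos_nz w hw0).
  replace (al * (z0 + w)) with (al * z0 + al * w) by ring.
  replace (c / al / w) with (c / (al * w)) by (field; easy).
  assert (hw' : (0 < Cmod (al * w) < r)%R).
  { rewrite Cmod_mult. split; [now apply Rmult_lt_0_compat|].
    rewrite Rmult_comm. now apply Rlt_div_r. }
  eapply csum_ext; [|apply (h _ hw')]. intros n; cbv beta. rewrite Cpow_mult_l. ring.
Qed.

Lemma csum_geom (x : C) : (Cmod x < 1)%R -> csum (fun n => x ^ n) (1 / (1 - x)).
Proof.
intros hx.
assert (h : ex_series (fun n => Cmod (x ^ n))).
{ apply (ex_series_ext (fun n => (Cmod x ^ n)%R)).
  - intros n. now rewrite Cmod_pow.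
  - apply ex_series_geom. rewrite Rabs_pos_eq; [easy|apply Cmod_ge_0]. }
apply csum_val_abs in h. set (s := csum_val _) in h.
assert (hx1 : 1 - x <> 0).
{ intros e. assert (hx2 : x = 1) by (replace x with (1 - (1 - x)) by ring; rewrite e; ring).
  rewrite hx2, Cmod_1 in hx. lra. }
assert (e : s - 1 = x * s).
{ apply (csum_unique (fun n => x ^ S n)).
  - apply (csum_incr _ _ h).
  - apply (csum_scal x _ _ h). }
replace (1 / (1 - x)) with s; [easy|].
replace s with (((s - 1) - x * s + 1) / (1 - x)) at 1 by (field; easy).
rewrite e. field. easy.
Qed.

(** Around z0 + v the polar part c / (v + w) is a geometric series in -w / v, whence the
    coefficients c (-1)^l / v^(l+1); the regular part is recentered. *)
Lemma germ_recenter (f : C -> C) (z0 c : C) (a : nat -> C) :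
  germ f z0 c a ->
  exists r : R, (0 < r)%R /\ abs_conv a r /\
    forall v, (0 < Cmod v < r)%R ->
      germ f (z0 + v) 0 (fun l => c * (- (1)) ^ l / v ^ S l + recentered a v l).
Proof.
intros [r [hr [ha h]]]. exists r. split; [easy|]. split; [easy|].
intros v [hv0 hv]. assert (hvn := Cmod_pos_nz v hv0).
(* Half the distance from v to the nearer of the pole and the circle of radius r. *)
set (p := (Rmin (Cmod v) (r - Cmod v) / 2)%R).
assert (hp : (0 < p)%R).
{ unfold p. assert (0 < Rmin (Cmod v) (r - Cmod v))%R; [|lra]. apply Rmin_pos; lra. }
assert (hp1 : (p < Cmod v)%R).
{ unfold p. pose proof (Rmin_l (Cmod v) (r - Cmod v)). lra. }
assert (hp2 : (Cmod v + p < r)%R).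
{ unfold p. pose proof (Rmin_r (Cmod v) (r - Cmod v)). lra. }
assert (hg : forall w, (Cmod w < Cmod v)%R ->
  v + w <> 0 /\ psum (fun l => c * (- (1)) ^ l / v ^ S l) w (c / (v + w))).
{ intros w hw.
  assert (hvw : v + w <> 0).
  { intros e. replace w with (- v) in hw; [rewrite Cmod_opp in hw; lra|].
    replace w with ((v + w) - v) by ring. rewrite e. ring. }
  split; [easy|].
  assert (hx : (Cmod (- w / v) < 1)%R).
  { rewrite Cmod_div, Cmod_opp by easy. apply (Rdiv_lt_1 _ (Cmod v)); easy. }
  apply csum_geom, (csum_scal (c / v)) in hx.
  replace (c / (v + w)) with (c / v * (1 / (1 - - w / v))).
  - eapply csum_ext; [|exact hx]. intros n; cbv beta.
    replace (- w / v) with ((- (1)) * w * / v) by (field; easy).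
    rewrite !Cpow_mult_l, Cpow_inv, Cpow_S by easy. field. split; [|easy]. now apply Cpow_nz.
  - field. split; [|easy].
    replace (v - - w) with (v + w) by ring. easy. }
exists p. split; [easy|]. split.
- apply abs_conv_plus; [lra| |].
  + destruct (hg (RtoC ((p + Cmod v) / 2))) as [_ hs].
    { rewrite Cmod_R, Rabs_pos_eq; lra. }
    apply (psum_abs_conv _ _ _ p hs). rewrite Cmod_R, Rabs_pos_eq; lra.
  + apply abs_conv_recentered with r; [easy|lra|easy].
- intros w [hw0 hw]. destruct (hg w) as [hvw hs]; [lra|].
  assert (hwn := Cmod_pos_nz w hw0).
  replace (f (z0 + v + w) - 0 / w) with (c / (v + w) + (f (z0 + (v + w)) - c / (v + w)));
    [|rewrite <- Cplus_assoc; field; easy].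
  apply psum_plus; [easy|].
  apply psum_recentered with r; [easy|lra|lra|]. apply h. split.
  + now apply Cmod_gt_0.
  + eapply Rle_lt_trans; [apply Cmod_triangle|]. lra.
Qed.

(** * Taylor coefficients as functions of the base point *)

(** Where an expansion exists, [germ_unique] determines the residue and every coefficient of the
    chosen pair. *)
Definition germ_at (f : C -> C) (z0 : C) : C * (nat -> C) :=
  epsilon (inhabits (RtoC 0, fun _ => RtoC 0))
    (fun p => germ f z0 (fst p) (snd p)).

(* [(-1)^(k-1) f^(k-1) / (k-1)!], with value [0] at the poles of [f]. *)
Definition twisted_deriv (k : nat) (f : C -> C) (z0 : C) : C :=
  if Ceq_dec (fst (germ_at f z0)) 0
  then (- (1)) ^ (k - 1) * snd (germ_at f z0) (k - 1)%nat else 0.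

Lemma twisted_deriv_eq (k : nat) (f : C -> C) (z0 c : C) (a : nat -> C) :
  germ f z0 c a ->
  twisted_deriv k f z0 = if Ceq_dec c 0 then (- (1)) ^ (k - 1) * a (k - 1)%nat else 0.
Proof.
intros h.
assert (h' : germ f z0 (fst (germ_at f z0)) (snd (germ_at f z0))).
{ unfold germ_at. apply epsilon_spec. now exists (c, a). }
destruct (germ_unique _ _ _ _ _ _ h h') as [hc ha].
unfold twisted_deriv. now rewrite <- hc, <- ha.
Qed.

Lemma twisted_deriv_reg (k : nat) (f : C -> C) (z0 : C) (a : nat -> C) :
  germ f z0 0 a -> twisted_deriv k f z0 = (- (1)) ^ (k - 1) * a (k - 1)%nat.
Proof.
intros h. rewrite (twisted_deriv_eq _ _ _ _ _ h). now destruct (Ceq_dec 0 0).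
Qed.

Lemma bin_diag (l : nat) : bin l l = 1%nat.
Proof.
induction l as [|l IH]; [easy|]. simpl. rewrite IH, bin_gt by lia. easy.
Qed.

Lemma recentered_0 (a : nat -> C) (l : nat) : recentered a 0 l = a l.
Proof.
unfold recentered, psum_val.
rewrite (csum_val_eq _ _ (psum_0 _)), Nat.add_0_r, bin_diag. simpl. ring.
Qed.

Lemma opp1_pow_sqr (n : nat) : (- (1)) ^ n * (- (1)) ^ n = 1.
Proof.
rewrite <- Cpow_mult_l. replace (- (1) * - (1)) with (RtoC 1) by ring. apply Cpow_1_l.
Qed.

Lemma analytic_at_intro (f : C -> C) (z0 : C) (b : nat -> C) (r : R) :
  (0 < r)%R -> (forall v, (Cmod v < r)%R -> psum b v (f (z0 + v))) -> analytic_at f z0.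
Proof.
intros hr h. exists b, r. split; [easy|]. intros z hz.
apply is_pseries_psum. replace (f z) with (f (z0 + (z - z0))) by (f_equal; ring).
now apply h.
Qed.

Definition shift_coef (k : nat) (a : nat -> C) (n : nat) : C :=
  if le_lt_dec k n then a (n - k)%nat else 0.

Lemma psum_const (c w : C) : psum (fun n => if Nat.eq_dec n 0 then c else 0) w c.
Proof.
assert (h : csum (fun n => (if Nat.eq_dec n 0 then c else 0) * w ^ n)
  (sum_n (fun n => (if Nat.eq_dec n 0 then c else 0) * w ^ n) 0)).
{ apply csum_finite. intros n hn. destruct (Nat.eq_dec n 0); [lia|ring]. }
rewrite sum_n_C_O in h. simpl in h. now rewrite Cmult_1_r in h.
Qed.

Lemma psum_shift_coef (k : nat) (a : nat -> C) (w s : C) :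
  psum a w s -> psum (shift_coef k a) w (w ^ k * s).
Proof.
intros h. apply (is_series_drop_zeros _ k).
- intros n hn. unfold shift_coef. destruct (le_lt_dec k n); [lia|]. apply Cmult_0_l.
- eapply csum_ext; [|apply (csum_scal (w ^ k) _ _ h)]. intros n; cbv beta.
  unfold shift_coef. destruct (le_lt_dec k (k + n)); [|lia].
  replace (k + n - k)%nat with n by lia. rewrite Cpow_add_r. ring.
Qed.

(** At z0 + v the coefficient of order k-1 is [recentered a v (k - 1)], a power series in v. *)
Lemma twisted_deriv_analytic (k : nat) (f : C -> C) (z0 : C) (a : nat -> C) :
  germ f z0 0 a -> analytic_at (twisted_deriv k f) z0.
Proof.
intros h. destruct (germ_recenter _ _ _ _ h) as [r [hr [ha hrec]]].
apply analytic_at_intro with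
  (fun n => (- (1)) ^ (k - 1) * (RtoC (INR (bin (k - 1 + n) (k - 1))) * a (k - 1 + n)%nat)) r;
  [easy|].
intros v hv.
replace (twisted_deriv k f (z0 + v)) with ((- (1)) ^ (k - 1) * recentered a v (k - 1)).
- apply (psum_scal _ _ _ _ (psum_recentered_coef a r v (k - 1) ha hv)).
- destruct (Ceq_dec v 0) as [->|hv0].
  + rewrite Cplus_0_r, recentered_0. symmetry. now apply twisted_deriv_reg.
  + rewrite (twisted_deriv_reg k _ _ _ (hrec v (conj (proj1 (Cmod_gt_0 v) hv0) hv))).
    field. now apply Cpow_nz.
Qed.

(** Near a simple pole with residue c the two signs (-1)^(k-1) cancel, and the value at z0 + v is c
    / v^k plus a power series in v: a pole of order k whose numerator equals c at z0. At the pole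
    itself the default value 0 is the one prescribed by [meromorphic]. *)
Lemma twisted_deriv_meromorphic (k : nat) (f : C -> C) :
  (1 <= k)%nat -> (forall z0, exists c a, germ f z0 c a) ->
  meromorphic (twisted_deriv k f).
Proof.
intros hk hf z0. destruct (hf z0) as [c [a h]].
destruct (Ceq_dec c 0) as [->|hc].
{ left. now apply twisted_deriv_analytic with a. }
right. split.
2:{ rewrite (twisted_deriv_eq k _ _ _ _ h). now destruct (Ceq_dec c 0). }
destruct (germ_recenter _ _ _ _ h) as [r [hr [ha hrec]]].
set (l := (k - 1)%nat).
set (g := fun z => c + (z - z0) ^ k * ((- (1)) ^ l * recentered a (z - z0) l)).
exists k, g, r. split; [easy|]. split; [|split; [|split; [easy|]]].
- apply analytic_at_intro with
    (fun n => (if Nat.eq_dec n 0 then c else 0) + shift_coef k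
      (fun n => (- (1)) ^ l * (RtoC (INR (bin (l + n) l)) * a (l + n)%nat)) n) r; [easy|].
  intros v hv. unfold g. replace (z0 + v - z0) with v by ring.
  apply psum_plus.
  + apply psum_const.
  + apply psum_shift_coef, psum_scal. now apply psum_recentered_coef with r.
- unfold g. replace (z0 - z0) with (RtoC 0) by ring.
  destruct k as [|k']; [lia|]. rewrite Cpow_S. intros e. apply hc. rewrite <- e. ring.
- intros z hz hzr.
  assert (hv : z - z0 <> 0) by now apply Cminus_eq_contra.
  replace z with (z0 + (z - z0)) at 1 by ring.
  rewrite (twisted_deriv_reg k _ _ _ (hrec _ (conj (proj1 (Cmod_gt_0 _) hv) hzr))).
  fold l. unfold g. replace (S l) with k by (unfold l; lia).
  replace (c + (z - z0) ^ k * ((- (1)) ^ l * recentered a (z - z0) l))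
    with (((- (1)) ^ l * (- (1)) ^ l) * c
      + (z - z0) ^ k * ((- (1)) ^ l * recentered a (z - z0) l))
    by (rewrite opp1_pow_sqr; ring).
  field. now apply Cpow_nz.
Qed.

(** * The identity theorem *)

(** The exponent M treats both alternatives of [meromorphic] at once: it is 0 at a regular point and
    the order at a pole. *)
Definition laurent (f : C -> C) (z0 : C) (M : nat) (a : nat -> C) : Prop :=
  exists r : R, (0 < r)%R /\ abs_conv a r /\
    forall w, (0 < Cmod w < r)%R -> psum a w (w ^ M * f (z0 + w)).

Lemma analytic_at_psum (f : C -> C) (z0 : C) :
  analytic_at f z0 -> exists a r, (0 < r)%R /\ abs_conv a r /\
    forall w, (Cmod w < r)%R -> psum a w (f (z0 + w)).
Proof.
intros [a [r [hr h]]].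
assert (h' : forall w, (Cmod w < r)%R -> psum a w (f (z0 + w))).
{ intros w hw. specialize (h (z0 + w)). replace (z0 + w - z0) with w in h by ring.
  apply (proj1 (is_pseries_psum a w (f (z0 + w)))). exact (h hw). }
(* [analytic_at] provides convergence; absolute convergence follows at radii below that of a point
   of convergence, here of modulus 3r/4. *)
exists a, (r / 2)%R. split; [lra|]. split.
- assert (hc : Cmod (RtoC (3 * r / 4)) = (3 * r / 4)%R) by (rewrite Cmod_R, Rabs_pos_eq; lra).
  apply (psum_abs_conv a (RtoC (3 * r / 4)) (f (z0 + RtoC (3 * r / 4)))); [apply h'|]; lra.
- intros w hw. apply h'. lra.
Qed.

Lemma analytic_at_value (f : C -> C) (z0 : C) (a : nat -> C) (r : R) :
  (0 < r)%R -> (forall w, (Cmod w < r)%R -> psum a w (f (z0 + w))) -> f z0 = a 0%nat.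
Proof.
intros hr h. apply (psum_unique a 0); [|apply psum_0].
replace (f z0) with (f (z0 + 0)) by (f_equal; ring). apply h. rewrite Cmod_0. lra.
Qed.

Lemma meromorphic_laurent (f : C -> C) (z0 : C) :
  meromorphic f -> exists M a, laurent f z0 M a /\
    ((M = 0%nat /\ f z0 = a 0%nat) \/ ((1 <= M)%nat /\ a 0%nat <> 0 /\ f z0 = 0)).
Proof.
intros hf. destruct (hf z0) as [h|[[m [g [r [hm [hg [hg0 [hr h]]]]]]] h0]].
- destruct (analytic_at_psum _ _ h) as [a [r [hr [ha hs]]]].
  exists 0%nat, a. split.
  + exists r. split; [easy|]. split; [easy|]. intros w hw. simpl. rewrite Cmult_1_l.
    now apply hs.
  + left. split; [easy|]. now apply analytic_at_value with r.
- destruct (analytic_at_psum _ _ hg) as [a [p [hp [ha hs]]]].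
  exists m, a. split.
  + exists (Rmin p r). split; [now apply Rmin_pos|]. split.
    * apply abs_conv_le with (2 := ha). split; [left; now apply Rmin_pos|apply Rmin_l].
    * intros w [hw0 hw]. assert (hwn := Cmod_pos_nz w hw0).
      rewrite h.
      -- replace (z0 + w - z0) with w by ring.
         replace (w ^ m * (g (z0 + w) / w ^ m)) with (g (z0 + w)).
         2:{ field. now apply Cpow_nz. }
         apply hs. eapply Rlt_le_trans; [apply hw|apply Rmin_l].
      -- intros e. apply hwn. replace w with ((z0 + w) - z0) by ring. rewrite e. ring.
      -- replace (z0 + w - z0) with w by ring.
         eapply Rlt_le_trans; [apply hw|apply Rmin_r].
  + right. rewrite <- (analytic_at_value g z0 a p); easy.
Qed.

Lemma abs_conv_shift_coef (k : nat) (a : nat -> C) (r p : R) :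
  (0 <= p < r)%R -> abs_conv a r -> abs_conv (shift_coef k a) p.
Proof.
intros hp ha. assert (hc : Cmod (RtoC r) = r) by (rewrite Cmod_R, Rabs_pos_eq; lra).
apply (psum_abs_conv _ (RtoC r) (RtoC r ^ k * psum_val a (RtoC r))).
- apply psum_shift_coef. apply abs_conv_psum with r; [easy|lra].
- lra.
Qed.

(** Multiplied by w^(M+N), both functions become power series that agree at points accumulating at
    0, so their coefficients are equal. *)
Lemma meromorphic_local_identity (f g : C -> C) (z0 : C) :
  meromorphic f -> meromorphic g ->
  (forall d : R, (0 < d)%R -> exists w, (0 < Cmod w < d)%R /\ f (z0 + w) = g (z0 + w)) ->
  exists r : R, (0 < r)%R /\ forall w, (Cmod w < r)%R -> f (z0 + w) = g (z0 + w).
Proof.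
intros hf hg hacc.
destruct (meromorphic_laurent f z0 hf) as [M [a [[r [hr [ha h]]] hcf]]].
destruct (meromorphic_laurent g z0 hg) as [N [b [[p [hp [hb h']]] hcg]]].
set (q := (Rmin r p / 2)%R).
assert (hq : (0 < q)%R).
{ unfold q. assert (0 < Rmin r p)%R; [|lra]. now apply Rmin_pos. }
assert (hqr : (q < r)%R) by (unfold q; pose proof (Rmin_l r p); unfold q in hq; lra).
assert (hqp : (q < p)%R) by (unfold q; pose proof (Rmin_r r p); unfold q in hq; lra).
assert (hco : forall n, shift_coef N a n = shift_coef M b n).
{ intros n. apply Ceq_minus. revert n.
  apply (psum_zero_coef (fun n => shift_coef N a n - shift_coef M b n) q hq).
  - apply abs_conv_minus; [lra| |].
    + apply abs_conv_shift_coef with r; [lra|easy].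
    + apply abs_conv_shift_coef with p; [lra|easy].
  - intros d hd. destruct (hacc (Rmin d q)) as [w [[hw0 hw] e]]; [now apply Rmin_pos|].
    assert (hw1 : (Cmod w < d)%R) by (eapply Rlt_le_trans; [apply hw|apply Rmin_l]).
    assert (hw2 : (Cmod w < q)%R) by (eapply Rlt_le_trans; [apply hw|apply Rmin_r]).
    exists w. split; [easy|].
    assert (h1 := psum_shift_coef N _ _ _ (h w ltac:(lra))).
    assert (h2 := psum_shift_coef M _ _ _ (h' w ltac:(lra))).
    assert (h3 := psum_minus _ _ _ _ _ h1 h2). rewrite e in h3.
    match type of h3 with psum _ _ ?s => replace (RtoC 0) with s by ring end. exact h3. }
exists q. split; [easy|]. intros w hw.
destruct (Ceq_dec w 0) as [->|hw0].
- rewrite Cplus_0_r. specialize (hco 0%nat). unfold shift_coef in hco.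
  (* At the centre itself: if only one function had a pole, its nonzero leading coefficient would
     equal a zero coefficient of the other; if both have one, both values are 0 by convention. *)
  destruct hcf as [[-> hf0]|[hM [ha0 hf0]]]; destruct hcg as [[-> hg0]|[hN [hb0 hg0]]].
  + simpl in hco. congruence.
  + simpl in hco. destruct (le_lt_dec N 0) in hco; [lia|]. now exfalso; apply hb0.
  + simpl in hco. destruct (le_lt_dec M 0) in hco; [lia|]. now exfalso; apply ha0.
  + congruence.
- assert (hm := proj1 (Cmod_gt_0 w) hw0).
  assert (h1 := psum_shift_coef N _ _ _ (h w ltac:(lra))).
  assert (h2 := psum_shift_coef M _ _ _ (h' w ltac:(lra))).
  apply (psum_ext _ (shift_coef M b)) in h1; [|easy].
  assert (e := psum_unique _ _ _ _ h1 h2).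
  assert (hNz := Cpow_nz w N hw0). assert (hMz := Cpow_nz w M hw0).
  replace (f (z0 + w)) with ((w ^ N * (w ^ M * f (z0 + w))) / (w ^ N * w ^ M))
    by (field; easy).
  rewrite e. field. easy.
Qed.

(** Connectedness of the segment from z1 to z: [Q s] is agreement near the point of parameter s,
    [E t] agreement along [0, t]. Points just below the supremum m of [E] feed the local identity at
    m; since [Q] is an open condition, m < 1 is impossible. *)
Lemma meromorphic_identity (f g : C -> C) (z1 : C) (r : R) :
  meromorphic f -> meromorphic g -> (0 < r)%R ->
  (forall w, (Cmod w < r)%R -> f (z1 + w) = g (z1 + w)) ->
  forall z, f z = g z.
Proof.
intros hf hg hr h z.
destruct (Ceq_dec z z1) as [->|hz].
{ replace z1 with (z1 + 0) by ring. apply h. now rewrite Cmod_0. }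
set (v := z - z1). assert (hv : v <> 0) by now apply Cminus_eq_contra.
assert (hvm := proj1 (Cmod_gt_0 v) hv).
set (Q := fun s : R => exists p : R, (0 < p)%R /\
  forall w, (Cmod w < p)%R -> f (z1 + RtoC s * v + w) = g (z1 + RtoC s * v + w)).
set (E := fun t : R => (0 <= t <= 1)%R /\ forall s, (0 <= s <= t)%R -> Q s).
assert (hQ0 : Q 0%R).
{ exists r. split; [easy|]. intros w hw. rewrite Cmult_0_l, Cplus_0_r. now apply h. }
assert (hE0 : E 0%R).
{ split; [lra|]. intros s hs. replace s with 0%R by lra. easy. }
destruct (completeness E) as [m [hub hlub]].
{ exists 1%R. intros t [ht _]. lra. }
{ now exists 0%R. }
assert (hm0 : (0 <= m)%R) by now apply hub.
assert (hm1 : (m <= 1)%R) by (apply hlub; intros t [ht _]; lra).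
assert (hbelow : forall s, (0 <= s < m)%R -> Q s).
{ intros s hs. apply NNPP. intros hn.
  assert (m <= s)%R; [|lra]. apply hlub. intros t ht.
  apply Rnot_lt_le. intros hlt. apply hn, ht. lra. }
assert (hdist : forall s t : R, Cmod (RtoC s * v - RtoC t * v) = (Rabs (s - t) * Cmod v)%R).
{ intros s t. replace (RtoC s * v - RtoC t * v) with (RtoC (s - t) * v)
    by (rewrite RtoC_minus; ring). now rewrite Cmod_mult, Cmod_R. }
assert (hQm : Q m).
{ destruct (Req_dec m 0) as [->|hmn]; [easy|].
  destruct (meromorphic_local_identity f g (z1 + RtoC m * v) hf hg) as [p [hp hp']].
  2:{ now exists p. }
  intros d hd.
  set (e := Rmin (m / 2) (d / (2 * Cmod v))).
  assert (hde : (0 < d / (2 * Cmod v))%R) by (apply Rdiv_lt_0_compat; lra).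
  assert (he : (0 < e)%R) by (apply Rmin_pos; lra).
  assert (he1 : (e <= m / 2)%R) by apply Rmin_l.
  assert (he2 : (e <= d / (2 * Cmod v))%R) by apply Rmin_r.
  apply Rle_div_r in he2; [|lra].
  exists (RtoC (m - e) * v - RtoC m * v). split.
  - rewrite hdist. replace (m - e - m)%R with (- e)%R by ring.
    rewrite Rabs_Ropp, Rabs_pos_eq by lra. nra.
  - replace (z1 + RtoC m * v + (RtoC (m - e) * v - RtoC m * v))
      with (z1 + RtoC (m - e) * v + 0) by ring.
    destruct (hbelow (m - e)%R ltac:(lra)) as [p [hp hpp]]. apply hpp. now rewrite Cmod_0. }
destruct hQm as [p [hp hpp]].
assert (hnear : forall s, (Rabs (s - m) * Cmod v < p)%R -> Q s).
{ intros s hs. exists (p - Rabs (s - m) * Cmod v)%R. split; [lra|]. intros w hw.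
  replace (z1 + RtoC s * v + w)
    with (z1 + RtoC m * v + ((RtoC s * v - RtoC m * v) + w)) by ring.
  apply hpp. eapply Rle_lt_trans; [apply Cmod_triangle|]. rewrite hdist. lra. }
assert (hm : m = 1%R).
{ destruct (Rle_lt_or_eq_dec _ _ hm1) as [hlt|]; [exfalso|easy].
  set (e := Rmin (1 - m) (p / (2 * Cmod v))).
  assert (hde : (0 < p / (2 * Cmod v))%R) by (apply Rdiv_lt_0_compat; lra).
  assert (he : (0 < e)%R) by (apply Rmin_pos; lra).
  assert (he1 : (e <= 1 - m)%R) by apply Rmin_l.
  assert (he2 : (e <= p / (2 * Cmod v))%R) by apply Rmin_r.
  apply Rle_div_r in he2; [|lra].
  assert (hEe : E (m + e)%R); [|specialize (hub _ hEe); lra].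
  split; [lra|]. intros s hs.
  destruct (Rlt_le_dec s m) as [hsm|hsm]; [apply hbelow; lra|].
  apply hnear. rewrite Rabs_pos_eq by lra. nra. }
rewrite hm in hpp. replace z with (z1 + RtoC 1 * v + 0) by (unfold v; ring).
apply hpp. now rewrite Cmod_0.
Qed.

(** * Unit complex numbers *)

Definition tpi : C := RtoC (2 * PI) * Ci.

Lemma Re_tpi (w : C) : Re (tpi * w) = (- (2 * PI * Im w))%R.
Proof. unfold tpi, Ci, RtoC, Cmult, Re, Im; cbn [fst snd]. ring. Qed.

Lemma Im_tpi (w : C) : Im (tpi * w) = (2 * PI * Re w)%R.
Proof. unfold tpi, Ci, RtoC, Cmult, Re, Im; cbn [fst snd]. ring. Qed.

Lemma tpi_nz : tpi <> 0.
Proof.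
unfold tpi. apply Cmult_neq_0; [|apply Ci_nz].
intros h. apply RtoC_inj in h. pose proof PI_RGT_0. lra.
Qed.

Lemma Cexp_tpi_Z (n : Z) : Cexp (tpi * RtoC (IZR n)) = 1.
Proof.
unfold Cexp. rewrite Re_tpi, Im_tpi. simpl.
rewrite Rmult_0_r, Ropp_0, exp_0.
replace (2 * PI * IZR n)%R with (2 * (IZR n * PI))%R by ring.
rewrite cos_2a_sin, sin_2a, (sin_eq_0_1 (IZR n * PI)) by (now exists n).
unfold RtoC. f_equal; ring.
Qed.

Lemma Cexp_eq_1 (z : C) : Cexp z = 1 -> exists n : Z, z = tpi * RtoC (IZR n).
Proof.
intros h.
assert (hr : Re z = 0%R).
{ apply exp_inv. rewrite <- Cmod_Cexp, h, Cmod_1. now rewrite exp_0. }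
assert (hc : cos (Im z) = 1%R).
{ apply (f_equal Re) in h. unfold Cexp in h. simpl in h. rewrite hr, exp_0 in h. lra. }
replace (Im z) with (2 * (Im z / 2))%R in hc by field.
rewrite cos_2a_sin in hc.
destruct (sin_eq_0_0 (Im z / 2)) as [n hn]; [nra|].
exists n. destruct z as [x y]. simpl in *. subst x. unfold tpi, Cmult; simpl.
f_equal; lra.
Qed.

(** arccos of the real part is the angle in the closed upper half plane; below the real axis its
    complement to a full turn is taken, which keeps l in [0, 1). *)
Lemma unit_e2pii (c : C) :
  Cmod c = 1%R -> exists l : R, (0 <= l < 1)%R /\ c = e2pii (RtoC l).
Proof.
intros h. destruct c as [x y].
pose proof PI_RGT_0 as hpi.
assert (hxy : (x * x + y * y = 1)%R).
{ unfold Cmod in h; simpl in h.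
  replace (x * x + y * y)%R with (x * (x * 1) + y * (y * 1))%R by ring.
  rewrite <- (sqrt_sqrt (x * (x * 1) + y * (y * 1))) by nra. rewrite h. ring. }
assert (hx : (-1 <= x <= 1)%R) by nra.
assert (he : forall l, e2pii (RtoC l) = (cos (2 * PI * l), sin (2 * PI * l))).
{ intros l. unfold e2pii, Cexp. fold tpi. rewrite Re_tpi, Im_tpi. simpl.
  rewrite Rmult_0_r, Ropp_0, exp_0. f_equal; ring. }
pose proof (acos_bound x) as hb.
pose proof (cos_acos x hx) as hcos. pose proof (sin_acos x hx) as hsin.
replace (1 - x²)%R with (Rsqr y) in hsin by (unfold Rsqr; lra).
rewrite sqrt_Rsqr_abs in hsin.
destruct (Rle_lt_dec 0 y) as [hy|hy].
- exists (acos x / (2 * PI))%R. split.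
  + split; [apply Rdiv_le_0_compat; lra|]. apply Rlt_div_l; lra.
  + rewrite he. replace (2 * PI * (acos x / (2 * PI)))%R with (acos x) by (field; lra).
    now rewrite hcos, hsin, Rabs_pos_eq.
- rewrite Rabs_left in hsin by easy.
  assert (ha : (0 < acos x)%R).
  { destruct hb as [[hb|hb] _]; [easy|]. rewrite <- hb, sin_0 in hsin. lra. }
  exists (1 - acos x / (2 * PI))%R. split.
  + assert (0 < acos x / (2 * PI))%R by (apply Rdiv_lt_0_compat; lra).
    assert (acos x / (2 * PI) < 1)%R by (apply Rlt_div_l; lra). lra.
  + rewrite he.
    replace (2 * PI * (1 - acos x / (2 * PI)))%R with (- acos x + 2 * PI)%R by (field; lra).
    rewrite cos_plus, sin_plus, cos_2PI, sin_2PI, cos_neg, sin_neg, hcos, hsin.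
    f_equal; ring.
Qed.

Lemma e2pii_inj (l l' : R) :
  (0 <= l < 1)%R -> (0 <= l' < 1)%R -> e2pii (RtoC l) = e2pii (RtoC l') -> l = l'.
Proof.
intros hl hl' h.
assert (h1 : Cexp (tpi * RtoC (l - l')) = 1).
{ apply (f_equal (fun c => c * Cexp (tpi * RtoC (- l')))) in h.
  unfold e2pii in h. fold tpi in h. rewrite <- !Cexp_plus, <- !Cmult_plus_distr_l in h.
  rewrite <- !RtoC_plus in h. replace (l' + - l')%R with 0%R in h by ring.
  unfold Rminus. rewrite h, Cmult_0_r. apply Cexp_0. }
destruct (Cexp_eq_1 _ h1) as [n hn].
assert (h2 : RtoC (l - l') = RtoC (IZR n)).
{ replace (RtoC (l - l')) with (/ tpi * (tpi * RtoC (l - l'))) by (field; apply tpi_nz).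
  rewrite hn. field. apply tpi_nz. }
apply RtoC_inj in h2.
assert (hn1 : (-1 < n)%Z) by (apply lt_IZR; lra).
assert (hn2 : (n < 1)%Z) by (apply lt_IZR; lra).
replace n with 0%Z in h2 by lia. lra.
Qed.

(** * Maximum principle *)

(** If m >= 1 were the least index with a_m nonzero, a suitable small w would raise the modulus
    above |a_0| by |a_m w^m| up to a smaller error. *)
Lemma max_modulus_coef (a : nat -> C) (r : R) :
  (0 < r)%R -> abs_conv a r ->
  (forall w s, (Cmod w < r)%R -> psum a w s -> (Cmod s <= Cmod (a 0%nat))%R) ->
  forall n, (1 <= n)%nat -> a n = 0.
Proof.
intros hr ha h.
destruct (Ceq_dec (a 0%nat) 0) as [ha0|ha0].
{ intros n _. revert n. apply (psum_zero_coef a r hr ha).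
  intros d hd. destruct (small_point (Rmin d r)) as [w [hw0 hw]]; [now apply Rmin_pos|].
  assert (hw1 : (Cmod w < d)%R) by (eapply Rlt_le_trans; [apply hw|apply Rmin_l]).
  assert (hw2 : (Cmod w < r)%R) by (eapply Rlt_le_trans; [apply hw|apply Rmin_r]).
  exists w. split; [easy|].
  pose proof (abs_conv_psum a r w ha ltac:(lra)) as hs.
  replace (RtoC 0) with (psum_val a w); [easy|].
  apply Cmod_eq_0. pose proof (h w _ hw2 hs) as hle. rewrite ha0, Cmod_0 in hle.
  pose proof (Cmod_ge_0 (psum_val a w)). lra. }
intros n. induction n as [m IH] using lt_wf_ind. intros hm.
destruct (Ceq_dec (a m) 0) as [|ham]; [easy|exfalso].
assert (hm0 := proj1 (Cmod_gt_0 _) ham). assert (h00 := proj1 (Cmod_gt_0 _) ha0).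
set (b := fun n => a (m + n)%nat).
assert (hb : abs_conv b r).
{ unfold b. clear -hr ha. induction m as [|m IH].
  - now apply (abs_conv_ext a).
  - apply abs_conv_decr in IH; [|easy]. eapply abs_conv_ext; [|exact IH].
    intros n; cbv beta. f_equal. lia. }
destruct (psum_near_0 b r hr hb) as [K [hK hnear]].
assert (hbm : b 0%nat = a m) by (unfold b; f_equal; lia).
(* For |w| = p the terms after a_m w^m have modulus at most K p^(m+1), which is below |a_m| p^m
   because p (K + 1) < |a_m|. *)
set (p := (Rmin r (Cmod (a m) / (K + 1)) / 2)%R).
assert (hd : (0 < Cmod (a m) / (K + 1))%R) by (apply Rdiv_lt_0_compat; lra).
assert (hp : (0 < p)%R).
{ unfold p. assert (0 < Rmin r (Cmod (a m) / (K + 1)))%R; [now apply Rmin_pos|lra]. }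
assert (hpr : (p < r)%R) by (unfold p in *; pose proof (Rmin_l r (Cmod (a m) / (K + 1))); lra).
assert (hpK : (p < Cmod (a m) / (K + 1))%R).
{ unfold p in *; pose proof (Rmin_r r (Cmod (a m) / (K + 1))); lra. }
apply Rlt_div_r in hpK; [|lra].
(* Choose the argument of [w] so that [a_m w^m] points in the direction of [a_0]. *)
set (ka := (Cmod (a 0%nat) / Cmod (a m))%R).
assert (hka : (0 < ka)%R) by now apply Rdiv_lt_0_compat.
assert (hkan : RtoC ka <> 0) by (intros e; apply RtoC_inj in e; lra).
destruct (unit_e2pii (a 0%nat / (a m * RtoC ka))) as [l [_ hl]].
{ rewrite Cmod_div, Cmod_mult, Cmod_R, Rabs_pos_eq by (try lra; now apply Cmult_neq_0).
  unfold ka. field. lra. }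
set (w := RtoC p * Cexp (tpi * RtoC (l / INR m))).
assert (hINR : (INR m <> 0)%R) by (apply not_0_INR; lia).
assert (hwm : a m * w ^ m = RtoC (p ^ m / ka) * a 0%nat).
{ unfold w. rewrite Cpow_mult_l, Cexp_pow.
  replace (RtoC (INR m) * (tpi * RtoC (l / INR m))) with (tpi * RtoC l).
  - change (Cexp (tpi * RtoC l)) with (e2pii (RtoC l)). rewrite <- hl.
    rewrite RtoC_div, RtoC_pow by lra. field. easy.
  - rewrite RtoC_div by easy. field. intros e; apply RtoC_inj in e; easy. }
assert (hw : Cmod w = p).
{ unfold w. rewrite Cmod_mult, Cmod_R, Rabs_pos_eq, Cmod_Cexp, Re_tpi by lra.
  simpl. rewrite Rmult_0_r, Ropp_0, exp_0. ring. }
pose proof (abs_conv_psum b r w hb ltac:(lra)) as ht.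
set (t := psum_val b w) in *.
pose proof (hnear w t ltac:(lra) ht) as hn. rewrite hbm, hw in hn.
assert (hs : psum a w (a 0%nat + w ^ m * t)).
{ eapply psum_ext; [|apply (psum_plus _ _ _ _ _ (psum_const (a 0%nat) w)
     (psum_shift_coef m _ _ _ ht))].
  intros j; cbv beta. unfold shift_coef, b.
  destruct (Nat.eq_dec j 0) as [->|hj]; destruct (le_lt_dec m _) as [hmj|hmj].
  - lia.
  - ring.
  - rewrite Cplus_0_l. f_equal. lia.
  - rewrite IH; [ring|lia|lia]. }
pose proof (h w _ ltac:(lra) hs) as hle.
replace (a 0%nat + w ^ m * t) with ((RtoC (1 + p ^ m / ka) * a 0%nat) - (- (w ^ m * (t - a m)))) in hle.
2:{ rewrite RtoC_plus, Cmult_plus_distr_r, <- hwm. ring. }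
assert (hpm : (0 < p ^ m)%R) by now apply pow_lt.
assert (hq : (0 < p ^ m / ka)%R) by now apply Rdiv_lt_0_compat.
pose proof (Cmod_triangle (RtoC (1 + p ^ m / ka) * a 0%nat - - (w ^ m * (t - a m)))
  (- (w ^ m * (t - a m)))) as htri.
replace (RtoC (1 + p ^ m / ka) * a 0%nat - - (w ^ m * (t - a m)) + - (w ^ m * (t - a m)))
  with (RtoC (1 + p ^ m / ka) * a 0%nat) in htri by ring.
rewrite Cmod_opp, !Cmod_mult, Cmod_pow, hw, Cmod_R, Rabs_pos_eq in htri by lra.
assert (e1 : ((1 + p ^ m / ka) * Cmod (a 0%nat) = Cmod (a 0%nat) + p ^ m * Cmod (a m))%R).
{ unfold ka. field. split; lra. }
rewrite e1 in htri.
assert (p ^ m * Cmod (t - a m) < p ^ m * Cmod (a m))%R.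
{ apply Rmult_lt_compat_l; [easy|]. nra. }
lra.
Qed.

(** Compactness enters as [cover]: a property that holds near every point for all small d holds on
    the square with a single d. It first bounds g, with d the inverse of the bound, and then, if the
    supremum M were not reached, produces a uniform gap d below M. *)
Lemma max_on_unit_square (g : R -> R -> R) :
  (forall u v e : R, (0 < e)%R -> exists d : R, (0 < d)%R /\
     forall x y, (Rabs (x - u) < d -> Rabs (y - v) < d -> Rabs (g x y - g u v) < e)%R) ->
  exists u v, forall x y, (0 <= x <= 1 -> 0 <= y <= 1 -> g x y <= g u v)%R.
Proof.
intros hg.
assert (cover : forall P : R -> R -> R -> Prop,
  (forall u v, exists d : R, (0 < d)%R /\
    forall x y d', (Rabs (x - u) < d -> Rabs (y - v) < d -> 0 < d' <= d -> P x y d')%R) ->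
  exists d : R, (0 < d)%R /\ forall x y, (0 <= x <= 1 -> 0 <= y <= 1 -> P x y d)%R).
{ intros P hP.
  set (del := fun u v => proj1_sig (constructive_indefinite_description _ (hP u v))).
  assert (hdel : forall u v, (0 < del u v)%R /\
    forall x y d', (Rabs (x - u) < del u v -> Rabs (y - v) < del u v ->
       0 < d' <= del u v -> P x y d')%R).
  { intros u v. unfold del. now destruct (constructive_indefinite_description _ (hP u v)). }
  destruct (compactness_value_2d 0 1 0 1 (fun u v => mkposreal _ (proj1 (hdel u v)))) as [d hd].
  exists d. split; [apply cond_pos|]. intros x y hx hy. apply NNPP. intros hn.
  apply (hd x y hx hy). intros [u [v [_ [_ [h1 [h2 h3]]]]]]. simpl in *.
  apply hn, (proj2 (hdel u v)); try easy. split; [apply cond_pos|easy]. }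
destruct (cover (fun x y d => g x y <= / d)%R) as [d [hd hbd]].
{ intros u v. destruct (hg u v 1%R ltac:(lra)) as [d [hd h]].
  pose proof (Rabs_pos (g u v)) as hp.
  exists (Rmin d (/ (Rabs (g u v) + 1))). split.
  - apply Rmin_pos; [easy|]. apply Rinv_0_lt_compat. lra.
  - intros x y d' h1 h2 [h3 h4].
    assert (h5 : (Rabs (g x y - g u v) < 1)%R).
    { apply h; eapply Rlt_le_trans; try apply Rmin_l; [apply h1|apply h2]. }
    assert (h6 : (d' <= / (Rabs (g u v) + 1))%R) by (eapply Rle_trans; [apply h4|apply Rmin_r]).
    apply Rinv_le_contravar in h6; [|easy]. rewrite Rinv_inv in h6.
    apply Rabs_def2 in h5. pose proof (Rle_abs (g u v)). lra. }
destruct (completeness (fun s => exists x y, (0 <= x <= 1)%R /\ (0 <= y <= 1)%R /\ s = g x y))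
  as [M [hub hlub]].
{ exists (/ d)%R. intros s [x [y [hx [hy ->]]]]. now apply hbd. }
{ exists (g 0%R 0%R), 0%R, 0%R. repeat split; lra. }
apply NNPP. intros hn.
assert (hM : forall u v, (g u v < M)%R \/ exists x y, (0 <= x <= 1 /\ 0 <= y <= 1 /\ g u v < g x y)%R).
{ intros u v. apply NNPP. intros h. apply hn. exists u, v. intros x y hx hy.
  apply Rnot_lt_le. intros hlt. apply h. right. now exists x, y. }
assert (hM' : forall u v, (g u v < M)%R).
{ intros u v. destruct (hM u v) as [|[x [y [hx [hy h]]]]]; [easy|].
  eapply Rlt_le_trans; [apply h|]. apply hub. now exists x, y. }
destruct (cover (fun x y d => g x y <= M - d)%R) as [d' [hd' hbd']].
{ intros u v. specialize (hM' u v).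
  destruct (hg u v ((M - g u v) / 2)%R ltac:(lra)) as [e [he h]].
  exists (Rmin e ((M - g u v) / 2)). split; [apply Rmin_pos; lra|].
  intros x y q h1 h2 [h3 h4].
  assert (h5 : (Rabs (g x y - g u v) < (M - g u v) / 2)%R).
  { apply h; eapply Rlt_le_trans; try apply Rmin_l; [apply h1|apply h2]. }
  assert (h6 : (q <= (M - g u v) / 2)%R) by (eapply Rle_trans; [apply h4|apply Rmin_r]).
  apply Rabs_def2 in h5. lra. }
assert (M <= M - d')%R; [|lra].
apply hlub. intros s [x [y [hx [hy ->]]]]. now apply hbd'.
Qed.

(** * Quasi-periodic entire functions *)

Lemma Cmod_CpowZ (x : C) (n : Z) : Cmod x = 1%R -> Cmod (CpowZ x n) = 1%R.
Proof.
intros hx. assert (hx0 : x <> 0) by (apply Cmod_gt_0; lra).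
destruct n as [|p|p]; simpl.
- apply Cmod_1.
- now rewrite Cmod_pow, hx, pow1.
- rewrite Cmod_inv by now apply Cpow_nz. rewrite Cmod_pow, hx, pow1. apply Rinv_1.
Qed.

Lemma quasi_period_Z (f : C -> C) (om ch : C) :
  ch <> 0 -> (forall z, f (z + om) = ch * f z) ->
  forall (m : Z) z, f (z + RtoC (IZR m) * om) = CpowZ ch m * f z.
Proof.
intros hch h.
assert (hn : forall (n : nat) z, f (z + RtoC (INR n) * om) = ch ^ n * f z).
{ induction n as [|n IH]; intros z.
  - simpl. rewrite Cmult_0_l, Cplus_0_r. ring.
  - rewrite S_INR, RtoC_plus.
    replace (z + (RtoC (INR n) + 1) * om) with (z + RtoC (INR n) * om + om) by ring.
    rewrite h, IH, Cpow_S. ring. }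
intros [|p|p] z.
- simpl. rewrite Cmult_0_l, Cplus_0_r. ring.
- simpl CpowZ. rewrite <- hn, INR_IPR. reflexivity.
- assert (hp := Cpow_nz ch (Pos.to_nat p) hch).
  simpl CpowZ. change (IZR (Zneg p)) with (- IPR p)%R. rewrite <- INR_IPR.
  set (z' := z + RtoC (- INR (Pos.to_nat p)) * om).
  replace z with (z' + RtoC (INR (Pos.to_nat p)) * om).
  + rewrite hn. field. easy.
  + unfold z'. rewrite RtoC_opp. ring.
Qed.

Lemma quasi_periodic_entire_zero (f : C -> C) (tau th ph : C) :
  (0 < Im tau)%R -> Cmod th = 1%R -> Cmod ph = 1%R -> (th, ph) <> (RtoC 1, RtoC 1) ->
  (forall z, analytic_at f z) ->
  (forall z, f (z + tpi * tau) = th * f z) ->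
  (forall z, f (z + tpi) = ph * f z) ->
  forall z, f z = 0.
Proof.
intros htau hth hph hne hf h1 h2.
set (g := fun s t : R => Cmod (f (tpi * (RtoC s * tau + RtoC t)))).
destruct (max_on_unit_square g) as [u [v hmax]].
{ intros u v e he. set (z0 := tpi * (RtoC u * tau + RtoC v)).
  destruct (analytic_at_psum f z0 (hf z0)) as [a [r [hr [ha hs]]]].
  destruct (psum_near_0 a r hr ha) as [K [hK hn]].
  rewrite <- (analytic_at_value f z0 a r hr hs) in hn.
  (* [B] bounds the displacement of z when both real coordinates move by one, so changes below q / B
     keep w within radius q. *)
  set (B := (Cmod tpi * (Cmod tau + 1))%R).
  assert (hB : (0 < B)%R).
  { apply Rmult_lt_0_compat; [apply Cmod_gt_0, tpi_nz|]. pose proof (Cmod_ge_0 tau). lra. }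
  set (q := Rmin r (e / (K + 1))).
  assert (hq1 : (q <= r)%R) by apply Rmin_l.
  assert (hq2 : (q <= e / (K + 1))%R) by apply Rmin_r.
  assert (hq : (0 < q)%R) by (apply Rmin_pos; [easy|apply Rdiv_lt_0_compat; lra]).
  apply Rle_div_r in hq2; [|lra].
  exists (q / B)%R. split; [now apply Rdiv_lt_0_compat|]. intros x y hx hy.
  set (w := tpi * (RtoC (x - u) * tau + RtoC (y - v))).
  assert (hw : (Cmod w < q)%R).
  { apply Rle_lt_trans with (Cmod tpi * (Rabs (x - u) * Cmod tau + Rabs (y - v)))%R.
    - unfold w. rewrite Cmod_mult. apply Rmult_le_compat_l; [apply Cmod_ge_0|].
      eapply Rle_trans; [apply Cmod_triangle|]. rewrite Cmod_mult, !Cmod_R. apply Rle_refl.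
    - replace q with (Cmod tpi * (q / B * Cmod tau + q / B))%R.
      + apply Rmult_lt_compat_l; [apply Cmod_gt_0, tpi_nz|].
        pose proof (Cmod_ge_0 tau). nra.
      + unfold B. assert (0 < Cmod tpi)%R by apply Cmod_gt_0, tpi_nz.
        pose proof (Cmod_ge_0 tau). field. lra. }
  assert (hz : tpi * (RtoC x * tau + RtoC y) = z0 + w).
  { unfold z0, w. rewrite !RtoC_minus. ring. }
  unfold g. fold z0. rewrite hz.
  specialize (hn w _ ltac:(lra) (hs w ltac:(lra))).
  apply Rle_lt_trans with (Cmod (f (z0 + w) - f z0)).
  - apply Rabs_le. split.
    + pose proof (Cmod_triangle (f z0 - f (z0 + w)) (f (z0 + w))) as ht.
      rewrite (Cmod_minus_sym (f z0)) in ht.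
      replace (f z0 - f (z0 + w) + f (z0 + w)) with (f z0) in ht by ring. lra.
    + pose proof (Cmod_triangle (f (z0 + w) - f z0) (f z0)) as ht.
      replace (f (z0 + w) - f z0 + f z0) with (f (z0 + w)) in ht by ring. lra.
  - pose proof (Cmod_ge_0 w). nra. }
assert (hth0 : th <> 0) by (apply Cmod_gt_0; lra).
assert (hph0 : ph <> 0) by (apply Cmod_gt_0; lra).
set (zm := tpi * (RtoC u * tau + RtoC v)).
assert (hglob : forall z, (Cmod (f z) <= Cmod (f zm))%R).
{ intros z.
  (* Real coordinates of z / (2 pi i) in the basis tau, 1. Removing their integer parts costs powers
     of unimodular multipliers, so |f| is unchanged. *)
  set (x := (Im (z / tpi) / Im tau)%R). set (y := (Re (z / tpi) - x * Re tau)%R).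
  assert (hz : z = tpi * (RtoC x * tau + RtoC y)).
  { assert (he : z / tpi = RtoC x * tau + RtoC y).
    { apply injective_projections.
      - change (Re (z / tpi) = Re (RtoC x * tau + RtoC y)).
        rewrite re_plus, re_scal_l. change (Re (RtoC y)) with y. unfold y. ring.
      - change (Im (z / tpi) = Im (RtoC x * tau + RtoC y)).
        rewrite im_plus, im_scal_l. change (Im (RtoC y)) with 0%R. unfold x. field. lra. }
    rewrite <- he. field. apply tpi_nz. }
  set (m := (up x - 1)%Z). set (n := (up y - 1)%Z).
  assert (hm : (0 <= x - IZR m <= 1)%R).
  { unfold m. rewrite minus_IZR. pose proof (archimed x). lra. }
  assert (hn : (0 <= y - IZR n <= 1)%R).
  { unfold n. rewrite minus_IZR. pose proof (archimed y). lra. }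
  specialize (hmax _ _ hm hn).
  replace z with (tpi * (RtoC (x - IZR m) * tau + RtoC (y - IZR n))
    + RtoC (IZR m) * (tpi * tau) + RtoC (IZR n) * tpi).
  2:{ rewrite hz, !RtoC_minus. ring. }
  rewrite (quasi_period_Z f tpi ph hph0 h2), (quasi_period_Z f (tpi * tau) th hth0 h1).
  rewrite !Cmod_mult, !Cmod_CpowZ, !Rmult_1_l by easy. exact hmax. }
destruct (analytic_at_psum f zm (hf zm)) as [a [r [hr [ha hs]]]].
assert (ha0 := analytic_at_value f zm a r hr hs).
assert (hcoef : forall n, (1 <= n)%nat -> a n = 0).
{ apply (max_modulus_coef a r hr ha). intros w s hw hps.
  rewrite <- (psum_unique _ _ _ _ (hs w hw) hps), <- ha0. apply hglob. }
assert (hcst : forall z, f z = a 0%nat).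
{ apply (meromorphic_identity f (fun _ => a 0%nat) zm r); [| |easy|].
  - intros z. now left.
  - intros z. left. apply analytic_at_intro with
      (fun n => if Nat.eq_dec n 0 then a 0%nat else 0) 1%R; [lra|].
    intros w _. apply psum_const.
  - intros w hw. apply (psum_unique a w); [now apply hs|].
    eapply psum_ext; [|apply psum_const]. intros n; cbv beta.
    destruct (Nat.eq_dec n 0) as [->|hn]; [easy|]. symmetry. apply hcoef. lia. }
intros z. rewrite hcst. destruct (Ceq_dec (a 0%nat) 0) as [|hn]; [easy|exfalso].
apply hne. specialize (h1 z). specialize (h2 z). rewrite !hcst in h1, h2.
assert (e : forall c, a 0%nat = c * a 0%nat -> c = 1).
{ intros c hc. replace c with (c * a 0%nat / a 0%nat) by (field; easy).
  rewrite <- hc. field. easy. }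
now rewrite (e _ h1), (e _ h2).
Qed.

(** * Uniqueness of the meromorphic continuation *)

Lemma Cmod_e2pii (w : C) : Cmod (e2pii w) = exp (- (2 * PI * Im w)).
Proof. unfold e2pii. fold tpi. now rewrite Cmod_Cexp, Re_tpi. Qed.

(** phi determines lambda in [0, 1), so two candidates are sums of the same series on the strip, and
    the identity theorem propagates the equality. *)
Lemma twP_eq (k : nat) (ch : C * C) (tau : C) (P : C -> C) :
  (0 < Im tau)%R -> is_twP k ch tau P -> forall z, twP k ch z tau = P z.
Proof.
intros htau hP.
assert (hQ : is_twP k ch tau (fun z => twP k ch z tau)).
{ unfold twP. change (is_twP k ch tau (epsilon (inhabits (fun _ : C => RtoC 0)) (is_twP k ch tau))).
  apply epsilon_spec. now exists P. }
set (Q := fun z => twP k ch z tau) in *.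
destruct hP as [hPm [l [hl [hl1 hPs]]]]. destruct hQ as [hQm [l' [hl' [hl1' hQs]]]].
assert (l' = l) by (apply e2pii_inj; [easy|easy|congruence]). subst l'.
pose proof PI_RGT_0 as hpi.
assert (hT : (0 < PI * Im tau)%R) by now apply Rmult_lt_0_compat.
(* With T = 2 pi Im tau, the disc of centre -T/2 and radius T/2 fits exactly into the strip -T < Re
   z < 0. *)
apply (meromorphic_identity Q P (RtoC (- (PI * Im tau))) (PI * Im tau)); [easy|easy|easy|].
intros w hw.
assert (hreg : (Cmod (e2pii tau) < Cmod (Cexp (RtoC (- (PI * Im tau)) + w)) < 1)%R).
{ rewrite Cmod_e2pii, Cmod_Cexp, re_plus. simpl Re at 1 3.
  pose proof (re_le_Cmod w) as hre.
  assert (hre' : (Rabs (Re w) < PI * Im tau)%R) by lra.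
  apply Rabs_def2 in hre'. simpl (Re (RtoC _)).
  split; [apply exp_increasing; lra|]. rewrite <- exp_0. apply exp_increasing. lra. }
destruct (hPs _ hreg) as [t [[s1 [s2 [h1 [h2 ht]]]] ->]].
destruct (hQs _ hreg) as [t' [[s1' [s2' [h1' [h2' ht']]]] hq]].
rewrite hq, ht, ht'.
now rewrite (csum_unique _ _ _ h1 h1'), (csum_unique _ _ _ h2 h2').
Qed.

(** * Continuation of P_1 *)

Definition exp_taylor (c : nat -> C) (nu : nat -> R) (z0 : C) (a : nat -> C) : Prop :=
  (forall l, csum (fun m => c m * (RtoC (nu m ^ l / INR (fact l)) * Cexp (RtoC (nu m) * z0)))
    (a l)) /\
  exists r : R, (0 < r)%R /\ abs_conv a r /\
    forall w, (Cmod w <= r)%R ->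
      csum (fun m => c m * Cexp (RtoC (nu m) * (z0 + w))) (psum_val a w).

Lemma ex_series_exp (K s x : R) :
  (x < 0)%R -> ex_series (fun m => K * exp ((INR m + s) * x))%R.
Proof.
intros hx. apply (ex_series_ext (fun m => (K * exp (s * x)) * exp x ^ m)%R).
- intros m. apply Rminus_diag_uniq.
  replace ((INR m + s) * x)%R with (s * x + INR m * x)%R by ring. rewrite exp_plus.
  replace (exp (INR m * x)) with (exp x ^ m)%R; [ring|].
  induction m as [|m IH]; [simpl; now rewrite Rmult_0_l, exp_0|].
  rewrite S_INR, Rmult_plus_distr_r, Rmult_1_l, exp_plus, <- IH. simpl. ring.
- apply ex_series_scaled_geom. split; [left; apply exp_pos|].
  rewrite <- exp_0. now apply exp_increasing.
Qed.

(** The decay e^(-nu T) of the coefficients beats the growth e^(nu (Re z0 + r)) as long as Re z0 + r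
    < T; r is half the distance from z0 to that line. *)
Lemma exp_taylor_pos (c : nat -> C) (K s T : R) (z0 : C) :
  (0 <= s)%R -> (forall m, (Cmod (c m) <= K * exp ((INR m + s) * - T))%R) ->
  (Re z0 < T)%R -> exists a, exp_taylor c (fun m => INR m + s)%R z0 a.
Proof.
intros hs hc hT. set (r := ((T - Re z0) / 2)%R).
assert (hr : (0 < r)%R) by (unfold r; lra).
destruct (Cexp_series_taylor c (fun m => INR m + s)%R z0 r hr) as [a [h1 [h2 h3]]].
- apply (ex_series_R_le _ (fun m => K * exp ((INR m + s) * (- T + Re z0 + r)))%R).
  + intros m. pose proof (pos_INR m). rewrite (Rabs_pos_eq (INR m + s)) by lra.
    rewrite Rmult_assoc, <- exp_plus. split.
    * apply Rmult_le_pos; [apply Cmod_ge_0|left; apply exp_pos].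
    * apply Rle_trans with
        ((K * exp ((INR m + s) * - T)) * exp ((INR m + s) * Re z0 + (INR m + s) * r))%R.
      -- apply Rmult_le_compat_r; [left; apply exp_pos|apply hc].
      -- rewrite Rmult_assoc, <- exp_plus. apply Req_le. f_equal. f_equal. ring.
  + apply ex_series_exp. unfold r. lra.
- exists a. split; [easy|]. exists (r / 2)%R. split; [lra|]. split; [apply h3; lra|].
  intros w hw. apply h2. lra.
Qed.

Lemma exp_taylor_neg (c : nat -> C) (K s T : R) (z0 : C) :
  (0 <= s)%R -> (forall m, (Cmod (c m) <= K * exp ((INR m + s) * - T))%R) ->
  (- T < Re z0)%R -> exists a, exp_taylor c (fun m => - (INR m + s))%R z0 a.
Proof.
intros hs hc hT. set (r := ((T + Re z0) / 2)%R).
assert (hr : (0 < r)%R) by (unfold r; lra).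
destruct (Cexp_series_taylor c (fun m => - (INR m + s))%R z0 r hr) as [a [h1 [h2 h3]]].
- apply (ex_series_R_le _ (fun m => K * exp ((INR m + s) * (- T - Re z0 + r)))%R).
  + intros m. pose proof (pos_INR m). rewrite Rabs_Ropp, (Rabs_pos_eq (INR m + s)) by lra.
    rewrite Rmult_assoc, <- exp_plus. split.
    * apply Rmult_le_pos; [apply Cmod_ge_0|left; apply exp_pos].
    * apply Rle_trans with
        ((K * exp ((INR m + s) * - T)) * exp (- (INR m + s) * Re z0 + (INR m + s) * r))%R.
      -- apply Rmult_le_compat_r; [left; apply exp_pos|apply hc].
      -- rewrite Rmult_assoc, <- exp_plus. apply Req_le. f_equal. f_equal. ring.
  + apply ex_series_exp. unfold r. lra.
- exists a. split; [easy|]. exists (r / 2)%R. split; [lra|]. split; [apply h3; lra|].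
  intros w hw. apply h2. lra.
Qed.

Definition exp_sum (c : nat -> C) (nu : nat -> R) (z : C) : C :=
  csum_val (fun m => c m * Cexp (RtoC (nu m) * z)).

Lemma exp_taylor_sum (c : nat -> C) (nu : nat -> R) (z0 : C) (a : nat -> C) :
  exp_taylor c nu z0 a -> csum (fun m => c m * Cexp (RtoC (nu m) * z0)) (exp_sum c nu z0).
Proof.
intros [_ [r [hr [_ h]]]]. specialize (h 0). rewrite Cmod_0 in h. specialize (h ltac:(lra)).
rewrite Cplus_0_r in h. unfold exp_sum. now rewrite (csum_val_eq _ _ h).
Qed.

Lemma exp_taylor_germ (c : nat -> C) (nu : nat -> R) (z0 : C) (a : nat -> C) :
  exp_taylor c nu z0 a -> germ (exp_sum c nu) z0 0 a.
Proof.
intros [_ [r [hr [ha h]]]]. exists r. split; [easy|]. split; [easy|].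
intros w [hw0 hw]. assert (hwn := Cmod_pos_nz w hw0).
replace (exp_sum c nu (z0 + w) - 0 / w) with (psum_val a w).
- apply abs_conv_psum with r; [easy|lra].
- unfold exp_sum. rewrite (csum_val_eq _ _ (h w ltac:(lra))). field. easy.
Qed.

(** * The geometric part: divided by z, the generating function of the Bernoulli polynomials at
    lambda *)

Definition twist_exp (lam : R) (z : C) : C := Cexp (RtoC lam * z) / (Cexp z - 1).

Lemma psum_Cexp_scaled (mu : R) (z0 w : C) :
  psum (fun n => Cexp (RtoC mu * z0) * RtoC (mu ^ n / INR (fact n))) w
    (Cexp (RtoC mu * (z0 + w))).
Proof.
rewrite Cmult_plus_distr_l, Cexp_plus.
eapply csum_ext; [|apply csum_scal, csum_Cexp]. intros n; cbv beta.
rewrite Cpow_mult_l, RtoC_div, RtoC_pow by apply INR_fact_neq_0.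
field. intros h. apply RtoC_inj in h. now apply INR_fact_neq_0 in h.
Qed.

Lemma abs_conv_Cexp_scaled (mu : R) (z0 : C) :
  abs_conv (fun n => Cexp (RtoC mu * z0) * RtoC (mu ^ n / INR (fact n))) 1.
Proof.
apply (psum_abs_conv _ (RtoC 2) _ 1 (psum_Cexp_scaled mu z0 (RtoC 2))).
rewrite Cmod_R, Rabs_pos_eq; lra.
Qed.

(** Numerator and denominator are entire. Where e^z0 = 1 the denominator has coefficients u_0 = 0
    and u_1 = 1, so the singularity is a simple pole with residue e^(lambda z0). *)
Lemma twist_exp_germ (lam : R) (z0 : C) :
  exists c a, germ (twist_exp lam) z0 c a /\ (c <> 0 -> Cexp z0 = 1) /\ (z0 = 0 -> c = 1).
Proof.
set (g := fun n => Cexp (RtoC lam * z0) * RtoC (lam ^ n / INR (fact n))).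
set (u := fun n => Cexp (RtoC 1 * z0) * RtoC (1 ^ n / INR (fact n))
    - (if Nat.eq_dec n 0 then RtoC 1 else RtoC 0)).
assert (hg : abs_conv g 1) by apply abs_conv_Cexp_scaled.
assert (hu : abs_conv u 1).
{ apply abs_conv_minus; [lra|apply abs_conv_Cexp_scaled|].
  apply (psum_abs_conv _ (RtoC 2) _ 1 (psum_const 1 (RtoC 2))).
  rewrite Cmod_R, Rabs_pos_eq; lra. }
assert (hus : forall w, psum u w (Cexp (z0 + w) - 1)).
{ intros w. apply psum_minus; [|apply psum_const].
  pose proof (psum_Cexp_scaled 1 z0 w) as h. now rewrite (Cmult_1_l (z0 + w)) in h. }
assert (hu0 : u 0%nat = Cexp z0 - 1).
{ unfold u. simpl. rewrite Cmult_1_l.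
  replace (RtoC (1 / 1)) with (RtoC 1) by (f_equal; field). ring. }
destruct (Ceq_dec (Cexp z0) 1) as [he|he].
- assert (hu1 : u 1%nat = 1).
  { unfold u. simpl. rewrite Cmult_1_l, he.
    replace (RtoC (1 * 1 / 1)) with (RtoC 1) by (f_equal; field). ring. }
  destruct (psum_quot g (fun n => u (S n)) 1 Rlt_0_1 hg (abs_conv_decr _ _ Rlt_0_1 hu))
    as [p [hp [hb hq]]].
  { rewrite hu1. apply C1_nz. }
  set (b := quot g (fun n => u (S n))) in *.
  (* Division by the shifted denominator yields w times the function: the constant term is the
     residue, the remaining coefficients form the regular part. *)
  exists (b 0%nat), (fun n => b (S n)). split; [|split; [easy|]].
  + exists p. split; [easy|]. split; [now apply abs_conv_decr|].
    intros w [hw0 hw]. assert (hwn := Cmod_pos_nz w hw0).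
    pose proof (psum_decr _ _ _ hwn (hus w)) as hd.
    destruct (hq w _ _ ltac:(lra) (psum_Cexp_scaled lam z0 w) hd) as [ht hs].
    apply (psum_decr _ _ _ hwn) in hs.
    assert (hd' : Cexp (z0 + w) - 1 - u 0%nat = Cexp (z0 + w) - 1)
      by (rewrite hu0, he; ring).
    rewrite hd' in hs, ht.
    assert (hn : Cexp (z0 + w) - 1 <> 0).
    { intros e. apply ht. rewrite e. field. easy. }
    unfold twist_exp.
    match type of hs with psum _ _ ?s => replace (_ - _) with s; [exact hs|] end.
    field. easy.
  + intros ->. unfold b, quot, g; simpl. rewrite hu1, Cmult_0_r, Cexp_0.
    rewrite RtoC_div by lra. field.
- destruct (psum_quot g u 1 Rlt_0_1 hg hu) as [p [hp [hb hq]]].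
  { rewrite hu0. now apply Cminus_eq_contra. }
  exists 0, (quot g u). split; [|split; [easy|]].
  + exists p. split; [easy|]. split; [easy|].
    intros w [hw0 hw]. assert (hwn := Cmod_pos_nz w hw0).
    destruct (hq w _ _ ltac:(lra) (psum_Cexp_scaled lam z0 w) (hus w)) as [ht hs].
    unfold twist_exp. replace (_ - 0 / w) with (Cexp (RtoC lam * (z0 + w)) / (Cexp (z0 + w) - 1)).
    * exact hs.
    * field. easy.
  + intros ->. now rewrite Cexp_0 in he.
Qed.

(** One function has two expansions: for Re z < 0 over the frequencies n >= 0 of Z + lambda with
    sign -1, for Re z > 0 over the negative ones with sign +1. This switch is what produces the
    multiplier theta. *)
Lemma twist_exp_neg_sum (lam : R) (z : C) :
  (Re z < 0)%R ->
  csum (fun m => - (1) * Cexp (RtoC (INR m + lam) * z)) (twist_exp lam z).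
Proof.
intros hz.
assert (hx : (Cmod (Cexp z) < 1)%R).
{ rewrite Cmod_Cexp, <- exp_0. now apply exp_increasing. }
assert (hne : Cexp z - 1 <> 0).
{ intros e. replace (Cexp z) with (RtoC 1) in hx; [rewrite Cmod_1 in hx; lra|].
  replace (Cexp z) with (Cexp z - 1 + 1) by ring. rewrite e. ring. }
apply csum_geom, (csum_scal (- Cexp (RtoC lam * z))) in hx.
replace (twist_exp lam z) with (- Cexp (RtoC lam * z) * (1 / (1 - Cexp z))).
- eapply csum_ext; [|exact hx]. intros m; cbv beta.
  rewrite Cexp_pow, RtoC_plus, Cmult_plus_distr_r, Cexp_plus. ring.
- unfold twist_exp. field. split; [easy|].
  intros e. apply hne. replace (Cexp z - 1) with (- (1 - Cexp z)) by ring. rewrite e. ring.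
Qed.

Lemma twist_exp_pos_sum (lam : R) (z : C) :
  (0 < Re z)%R ->
  csum (fun m => Cexp (RtoC (- (INR m + (1 - lam))) * z)) (twist_exp lam z).
Proof.
intros hz.
assert (hx : (Cmod (Cexp (- z)) < 1)%R).
{ rewrite Cmod_Cexp, <- exp_0, re_opp. apply exp_increasing. lra. }
assert (hinv : Cexp z * Cexp (- z) = 1).
{ rewrite <- Cexp_plus. replace (z + - z) with (RtoC 0) by ring. apply Cexp_0. }
assert (hne : 1 - Cexp (- z) <> 0).
{ intros e. replace (Cexp (- z)) with (RtoC 1) in hx; [rewrite Cmod_1 in hx; lra|].
  replace (Cexp (- z)) with (1 - (1 - Cexp (- z))) by ring. rewrite e. ring. }
apply csum_geom, (csum_scal (Cexp (RtoC lam * z) * Cexp (- z))) in hx.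
replace (twist_exp lam z) with (Cexp (RtoC lam * z) * Cexp (- z) * (1 / (1 - Cexp (- z)))).
- eapply csum_ext; [|exact hx]. intros m; cbv beta.
  rewrite Cexp_pow, <- !Cexp_plus. f_equal.
  rewrite RtoC_opp, RtoC_plus, RtoC_minus. ring.
- unfold twist_exp. assert (hzn := Cexp_nz z).
  assert (hei : Cexp (- z) = / Cexp z).
  { replace (Cexp (- z)) with (Cexp z * Cexp (- z) / Cexp z) by (field; easy).
    rewrite hinv. field. easy. }
  rewrite hei in *.
  assert (hz1 : Cexp z - 1 <> 0).
  { intros e. apply hne. replace (1 - / Cexp z) with ((Cexp z - 1) / Cexp z) by (field; easy).
    rewrite e. field. easy. }
  field. split; easy.
Qed.

(** * P_1 on the strip |Re z| < 2 pi Im tau *)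

Definition twden (th tau : C) (n : R) : C := 1 - / th * e2pii (RtoC n * tau).

Definition freq_pos (lam : R) (m : nat) : R := (INR m + lam)%R.
Definition freq_neg (lam : R) (m : nat) : R := (- (INR m + (1 - lam)))%R.

(** With x = theta^(-1) q^n one has -1/(1-x) = -1 - x/(1-x): [coefp1] is the coefficient of P_1 for
    n >= 0, and [coefp] is what remains of it without the constant -1, decaying like x. *)
Definition coefp (th : C) (lam : R) (tau : C) (m : nat) : C :=
  - (/ th * e2pii (RtoC (freq_pos lam m) * tau)) / twden th tau (freq_pos lam m).
Definition coefp1 (th : C) (lam : R) (tau : C) (m : nat) : C :=
  - (1) / twden th tau (freq_pos lam m).
Definition coefm (th : C) (lam : R) (tau : C) (m : nat) : C :=
  - (1) / twden th tau (freq_neg lam m).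

Lemma Cmod_twist_term (th tau : C) (n : R) :
  Cmod th = 1%R -> Cmod (/ th * e2pii (RtoC n * tau)) = exp (n * - (2 * PI * Im tau)).
Proof.
intros hth.
rewrite Cmod_mult, Cmod_inv, hth, Cmod_e2pii, im_scal_l by (apply Cmod_gt_0; lra).
rewrite Rinv_1, Rmult_1_l. f_equal. ring.
Qed.

Lemma exp_mono (x y : R) : (x <= y)%R -> (exp x <= exp y)%R.
Proof. intros [h| ->]; [left; now apply exp_increasing|apply Rle_refl]. Qed.

(** |x| = e^(-nT) stays away from 1 for n at least the smallest positive frequency. The frequency 0
    occurs for lambda = 0, that is phi = 1; the denominator is then 1 - theta^(-1), nonzero because
    (theta, phi) differs from (1, 1). *)
Lemma twden_pos_bound (th tau : C) (lam : R) :
  (0 < Im tau)%R -> Cmod th = 1%R -> (0 <= lam < 1)%R -> (lam = 0%R -> th <> 1) ->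
  exists d : R, (0 < d)%R /\ forall m, (d <= Cmod (twden th tau (freq_pos lam m)))%R.
Proof.
intros htau hth hl hne. set (T := (2 * PI * Im tau)%R).
pose proof PI_RGT_0 as hpi.
assert (hT : (0 < T)%R) by (unfold T; apply Rmult_lt_0_compat; lra).
assert (htri : forall n, (1 - exp (n * - T) <= Cmod (twden th tau n))%R).
{ intros n. pose proof (Cmod_triangle (twden th tau n) (/ th * e2pii (RtoC n * tau))) as h.
  rewrite Cmod_twist_term in h by easy. fold T in h.
  replace (twden th tau n + / th * e2pii (RtoC n * tau)) with (RtoC 1) in h
    by (unfold twden; ring).
  rewrite Cmod_1 in h. lra. }
assert (hlow : forall mu m, (0 < mu <= freq_pos lam m)%R ->
  (1 - exp (mu * - T) <= Cmod (twden th tau (freq_pos lam m)))%R).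
{ intros mu m hmu. eapply Rle_trans; [|apply htri].
  assert (exp (freq_pos lam m * - T) <= exp (mu * - T))%R; [|lra]. apply exp_mono. nra. }
assert (hpos : forall mu, (0 < mu)%R -> (0 < 1 - exp (mu * - T))%R).
{ intros mu hmu. assert (exp (mu * - T) < exp 0)%R; [|rewrite exp_0 in *; lra].
  apply exp_increasing. nra. }
destruct (Req_dec lam 0) as [h0|h0].
- specialize (hne h0). exists (Rmin (Cmod (twden th tau 0)) (1 - exp (1 * - T))). split.
  + apply Rmin_pos; [|apply hpos; lra]. apply Cmod_gt_0. unfold twden.
    unfold e2pii. rewrite Cmult_0_l, Cmult_0_r, Cexp_0, Cmult_1_r.
    assert (hth0 : th <> 0) by (apply Cmod_gt_0; lra).
    intros e. apply hne.
    assert (hi : / th = 1).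
    { replace (/ th) with (1 - (1 - / th)) by ring. rewrite e. ring. }

    replace th with (/ / th) by (field; easy). rewrite hi. field.
  + intros [|m].
    * replace (freq_pos lam 0) with 0%R by (unfold freq_pos; simpl; lra). apply Rmin_l.
    * eapply Rle_trans; [apply Rmin_r|]. apply hlow. unfold freq_pos. rewrite S_INR.
      pose proof (pos_INR m). lra.
- exists (1 - exp (lam * - T))%R. split; [apply hpos; lra|].
  intros m. apply hlow. unfold freq_pos. pose proof (pos_INR m). lra.
Qed.

(** For n < 0, |x| = e^(|n| T) > 1 and |1 - x| >= |x| - 1 >= |x| (1 - q), where q = e^(-(1 - lambda)
    T) bounds 1/|x| since 1 - lambda is the least |n|. *)
Lemma twden_neg_bound (th tau : C) (lam : R) :
  (0 < Im tau)%R -> Cmod th = 1%R -> (0 <= lam < 1)%R ->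
  exists K : R, forall m, twden th tau (freq_neg lam m) <> 0 /\
    (Cmod (coefm th lam tau m) <= K * exp ((INR m + (1 - lam)) * - (2 * PI * Im tau)))%R.
Proof.
intros htau hth hl. set (T := (2 * PI * Im tau)%R).
pose proof PI_RGT_0 as hpi.
assert (hT : (0 < T)%R) by (unfold T; apply Rmult_lt_0_compat; lra).
set (q := exp ((1 - lam) * - T)).
assert (hq : (0 < 1 - q)%R).
{ unfold q. assert (exp ((1 - lam) * - T) < exp 0)%R; [|rewrite exp_0 in *; lra].
  apply exp_increasing. nra. }
exists (/ (1 - q))%R. intros m.
set (x := exp ((INR m + (1 - lam)) * - T)).
assert (hx : (0 < x)%R) by apply exp_pos.
assert (hxq : (x <= q)%R).
{ apply exp_mono. pose proof (pos_INR m). nra. }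
assert (hmod : Cmod (/ th * e2pii (RtoC (freq_neg lam m) * tau)) = (/ x)%R).
{ rewrite Cmod_twist_term by easy. fold T. unfold x. rewrite <- exp_Ropp. f_equal.
  unfold freq_neg. ring. }
assert (hD : (/ x * (1 - q) <= Cmod (twden th tau (freq_neg lam m)))%R).
{ pose proof (Cmod_triangle (1 - / th * e2pii (RtoC (freq_neg lam m) * tau)) (- (1))) as h.
  rewrite Cmod_opp, Cmod_1 in h.
  replace (1 - / th * e2pii (RtoC (freq_neg lam m) * tau) + - (1))
    with (- (/ th * e2pii (RtoC (freq_neg lam m) * tau))) in h by ring.
  rewrite Cmod_opp, hmod in h. fold (twden th tau (freq_neg lam m)) in h.
  assert (h1 : (/ x * (1 - q) <= / x * (1 - x))%R).
  { apply Rmult_le_compat_l; [|lra]. left; now apply Rinv_0_lt_compat. }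
  assert (h2 : (/ x * (1 - x) = / x - 1)%R) by (field; lra). lra. }
assert (hix : (0 < / x)%R) by now apply Rinv_0_lt_compat.
assert (hD0 : (0 < / x * (1 - q))%R) by now apply Rmult_lt_0_compat.
assert (hDn : twden th tau (freq_neg lam m) <> 0) by (apply Cmod_gt_0; lra).
split; [easy|].
unfold coefm. rewrite Cmod_div, Cmod_opp, Cmod_1 by easy.
unfold Rdiv. rewrite Rmult_1_l.
replace (/ (1 - q) * x)%R with (/ (/ x * (1 - q)))%R by (field; lra).
now apply Rinv_le_contravar.
Qed.

(* Analytic continuation of [P_1] from [-T < Re z < 0] to [-T < Re z < T], where
   [T = 2 pi Im tau]: the divergent part of the sum over [n >= 0] is resummed into
   [twist_exp]. *)
Definition wideP (th : C) (lam : R) (tau z : C) : C :=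
  twist_exp lam z + exp_sum (coefp th lam tau) (freq_pos lam) z
    + exp_sum (coefm th lam tau) (freq_neg lam) z.

Lemma CpowZ_of_nat (x : C) (n : nat) : CpowZ x (Z.of_nat n) = x ^ n.
Proof. destruct n as [|n]; [easy|]. simpl CpowZ. now rewrite SuccNat2Pos.id_succ. Qed.

Lemma CpowZ_opp_of_nat (x : C) (n : nat) : CpowZ x (- Z.of_nat n) = / x ^ n.
Proof.
destruct n as [|n]; [simpl; field|]. simpl CpowZ. now rewrite SuccNat2Pos.id_succ.
Qed.

Lemma CpowZ_succ (x : C) (n : Z) : x <> 0 -> CpowZ x (n + 1) = x * CpowZ x n.
Proof.
intros hx. destruct (Z_le_gt_dec 0 n) as [h|h].
- rewrite <- (Z2Nat.id n) by easy. set (k := Z.to_nat n).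
  replace (Z.of_nat k + 1)%Z with (Z.of_nat (S k)) by lia.
  now rewrite !CpowZ_of_nat.
- set (k := Z.to_nat (- n - 1)).
  replace n with (- Z.of_nat (S k))%Z by (unfold k; lia).
  replace (- Z.of_nat (S k) + 1)%Z with (- Z.of_nat k)%Z by lia.
  rewrite !CpowZ_opp_of_nat, Cpow_S. field. split; [now apply Cpow_nz|easy].
Qed.

Lemma exp_sum_period (lam : R) (c : nat -> C) (nu : nat -> R) (k : nat -> Z) (z : C) (a : nat -> C) :
  (forall m, nu m = IZR (k m) + lam)%R -> exp_taylor c nu z a ->
  exp_sum c nu (z + tpi) = e2pii (RtoC lam) * exp_sum c nu z.
Proof.
intros hnu h. apply exp_taylor_sum, (csum_scal (e2pii (RtoC lam))) in h.
unfold exp_sum at 1. apply csum_val_eq. eapply csum_ext; [|exact h].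
intros m; cbv beta. unfold e2pii. fold tpi.
replace (RtoC (nu m) * (z + tpi))
  with (RtoC (nu m) * z + (tpi * RtoC lam + tpi * RtoC (IZR (k m)))).
- rewrite !Cexp_plus, Cexp_tpi_Z. ring.
- rewrite hnu, RtoC_plus. ring.
Qed.

Lemma twist_exp_period (lam : R) (z : C) :
  twist_exp lam (z + tpi) = e2pii (RtoC lam) * twist_exp lam z.
Proof.
unfold twist_exp, e2pii. fold tpi.
assert (h1 : Cexp tpi = 1).
{ rewrite <- (Cexp_tpi_Z 1). f_equal. ring. }
rewrite Cmult_plus_distr_l, !Cexp_plus, h1, Cmult_1_r.
rewrite (Cmult_comm (RtoC lam) tpi). unfold Cdiv. ring.
Qed.

Lemma freq_neg_IZR (lam : R) (m : nat) : freq_neg lam m = (IZR (- Z.of_nat (S m)) + lam)%R.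
Proof. unfold freq_neg. rewrite opp_IZR, <- INR_IZR_INZ, S_INR. ring. Qed.

Lemma freq_pos_IZR (lam : R) (m : nat) : freq_pos lam m = (IZR (Z.of_nat m) + lam)%R.
Proof. unfold freq_pos. now rewrite <- INR_IZR_INZ. Qed.

Definition twist_ok (th : C) (lam : R) (tau : C) : Prop :=
  (0 < Im tau)%R /\ Cmod th = 1%R /\ (0 <= lam < 1)%R /\ (lam = 0%R -> th <> 1).

Lemma period_pos (tau : C) : (0 < Im tau)%R -> (0 < 2 * PI * Im tau)%R.
Proof. intros h. pose proof PI_RGT_0. apply Rmult_lt_0_compat; lra. Qed.

Lemma twden_pos_nz (th : C) (lam : R) (tau : C) (m : nat) :
  twist_ok th lam tau -> twden th tau (freq_pos lam m) <> 0.
Proof.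
intros [htau [hth [hl hne]]].
destruct (twden_pos_bound th tau lam htau hth hl hne) as [d [hd h]].
apply Cmod_gt_0. specialize (h m). lra.
Qed.

Lemma twden_neg_nz (th : C) (lam : R) (tau : C) (m : nat) :
  twist_ok th lam tau -> twden th tau (freq_neg lam m) <> 0.
Proof.
intros [htau [hth [hl hne]]].
destruct (twden_neg_bound th tau lam htau hth hl) as [K h]. apply h.
Qed.

Lemma coefp_taylor (th : C) (lam : R) (tau z : C) :
  twist_ok th lam tau -> (Re z < 2 * PI * Im tau)%R ->
  exists a, exp_taylor (coefp th lam tau) (freq_pos lam) z a.
Proof.
intros hok hz. pose proof hok as [htau [hth [hl hne]]].
destruct (twden_pos_bound th tau lam htau hth hl hne) as [d [hd h]].
apply (exp_taylor_pos _ (/ d) lam (2 * PI * Im tau)); [lra| |easy].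
intros m. unfold coefp. rewrite Cmod_div, Cmod_opp, Cmod_twist_term by
  (try easy; now apply twden_pos_nz).
unfold Rdiv. rewrite Rmult_comm. apply Rmult_le_compat_r; [left; apply exp_pos|].
now apply Rinv_le_contravar.
Qed.

Lemma coefm_taylor (th : C) (lam : R) (tau z : C) :
  twist_ok th lam tau -> (- (2 * PI * Im tau) < Re z)%R ->
  exists a, exp_taylor (coefm th lam tau) (freq_neg lam) z a.
Proof.
intros [htau [hth [hl hne]]] hz.
destruct (twden_neg_bound th tau lam htau hth hl) as [K h].
apply (exp_taylor_neg _ K (1 - lam) (2 * PI * Im tau)); [lra| |easy].
intros m. apply h.
Qed.

Lemma coefp1_taylor (th : C) (lam : R) (tau z : C) :
  twist_ok th lam tau -> (Re z < 0)%R ->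
  exists a, exp_taylor (coefp1 th lam tau) (freq_pos lam) z a.
Proof.
intros hok hz. pose proof hok as [htau [hth [hl hne]]].
destruct (twden_pos_bound th tau lam htau hth hl hne) as [d [hd h]].
apply (exp_taylor_pos _ (/ d) lam 0); [lra| |easy].
intros m. rewrite Ropp_0, Rmult_0_r, exp_0, Rmult_1_r.
unfold coefp1. rewrite Cmod_div, Cmod_opp, Cmod_1 by now apply twden_pos_nz.
unfold Rdiv. rewrite Rmult_1_l. now apply Rinv_le_contravar.
Qed.

Lemma wideP_strip (th : C) (lam : R) (tau z : C) :
  twist_ok th lam tau -> (- (2 * PI * Im tau) < Re z < 0)%R ->
  wideP th lam tau z = exp_sum (coefp1 th lam tau) (freq_pos lam) z
    + exp_sum (coefm th lam tau) (freq_neg lam) z.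
Proof.
intros hok hz. pose proof (period_pos tau (proj1 hok)) as hT.
unfold wideP. f_equal. symmetry. unfold exp_sum at 1. apply csum_val_eq.
destruct (coefp_taylor th lam tau z hok ltac:(lra)) as [a ha].
eapply csum_ext; [|apply (csum_plus _ _ _ _
  (twist_exp_neg_sum lam z ltac:(lra)) (exp_taylor_sum _ _ _ _ ha))].
intros m; cbv beta. fold (freq_pos lam m).
pose proof (twden_pos_nz th lam tau m hok) as hD.
assert (hth0 : th <> 0) by (apply Cmod_gt_0; destruct hok as [_ [-> _]]; lra).
unfold coefp, coefp1.
replace (/ th * e2pii (RtoC (freq_pos lam m) * tau)) with (1 - twden th tau (freq_pos lam m))
  by (unfold twden; ring).
field. easy.
Qed.

(** The shift multiplies e^(nz) by q^n = theta x and lands in the original strip. For n >= 0, -theta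
    x/(1-x) is theta times the coefficient [coefp]; for n < 0 it is theta (1 - 1/(1-x)), whose terms
    1 add up to [twist_exp] in its expansion for Re z > 0. *)
Lemma wideP_shift (th : C) (lam : R) (tau z : C) :
  twist_ok th lam tau -> (0 < Re z < 2 * PI * Im tau)%R ->
  wideP th lam tau (z + tpi * tau) = th * wideP th lam tau z.
Proof.
intros hok hz. pose proof (period_pos tau (proj1 hok)) as hT.
assert (hth0 : th <> 0) by (apply Cmod_gt_0; destruct hok as [_ [-> _]]; lra).
assert (hz' : Re (z + tpi * tau) = (Re z - 2 * PI * Im tau)%R) by (rewrite re_plus, Re_tpi; ring).
rewrite wideP_strip by (try easy; lra).
destruct (coefp_taylor th lam tau z hok ltac:(lra)) as [a ha].
destruct (coefm_taylor th lam tau z hok ltac:(lra)) as [b hb].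
apply exp_taylor_sum in ha, hb.
replace (th * wideP th lam tau z) with (th * exp_sum (coefp th lam tau) (freq_pos lam) z
  + th * (twist_exp lam z + exp_sum (coefm th lam tau) (freq_neg lam) z)) by (unfold wideP; ring).
assert (hexp : forall n, Cexp (RtoC n * (z + tpi * tau))
  = Cexp (RtoC n * z) * (th * (1 - twden th tau n))).
{ intros n. rewrite Cmult_plus_distr_l, Cexp_plus. f_equal.
  unfold twden, e2pii. fold tpi.
  replace (RtoC n * (tpi * tau)) with (tpi * (RtoC n * tau)) by ring. field. easy. }
f_equal; unfold exp_sum at 1; apply csum_val_eq.
- eapply csum_ext; [|apply (csum_scal th _ _ ha)]. intros m; cbv beta. rewrite hexp.
  pose proof (twden_pos_nz th lam tau m hok) as hD. unfold coefp, coefp1.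
  replace (/ th * e2pii (RtoC (freq_pos lam m) * tau)) with (1 - twden th tau (freq_pos lam m))
    by (unfold twden; ring).
  field. easy.
- eapply csum_ext; [|apply (csum_scal th _ _ (csum_plus _ _ _ _
    (twist_exp_pos_sum lam z ltac:(lra)) hb))].
  intros m; cbv beta. fold (freq_neg lam m). rewrite hexp.
  pose proof (twden_neg_nz th lam tau m hok) as hD. unfold coefm. field. easy.
Qed.

Lemma wideP_period (th : C) (lam : R) (tau z : C) :
  twist_ok th lam tau -> (- (2 * PI * Im tau) < Re z < 2 * PI * Im tau)%R ->
  wideP th lam tau (z + tpi) = e2pii (RtoC lam) * wideP th lam tau z.
Proof.
intros hok hz.
destruct (coefp_taylor th lam tau z hok ltac:(lra)) as [a ha].
destruct (coefm_taylor th lam tau z hok ltac:(lra)) as [b hb].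
unfold wideP. rewrite twist_exp_period.
rewrite (exp_sum_period lam _ _ (fun m => Z.of_nat m) z a (freq_pos_IZR lam) ha).
rewrite (exp_sum_period lam _ _ (fun m => (- Z.of_nat (S m))%Z) z b (freq_neg_IZR lam) hb).
ring.
Qed.

Lemma wideP_germ (th : C) (lam : R) (tau z : C) :
  twist_ok th lam tau -> (- (2 * PI * Im tau) < Re z < 2 * PI * Im tau)%R ->
  exists c a, germ (wideP th lam tau) z c a /\ (c <> 0 -> Cexp z = 1) /\ (z = 0 -> c = 1).
Proof.
intros hok hz.
destruct (coefp_taylor th lam tau z hok ltac:(lra)) as [a ha].
destruct (coefm_taylor th lam tau z hok ltac:(lra)) as [b hb].
destruct (twist_exp_germ lam z) as [c [e [h [h1 h2]]]].
pose proof (germ_plus _ _ _ _ _ _ _ (germ_plus _ _ _ _ _ _ _ h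
  (exp_taylor_germ _ _ _ _ ha)) (exp_taylor_germ _ _ _ _ hb)) as hg.
rewrite !Cplus_0_r in hg. exists c. eexists. split; [exact hg|]. easy.
Qed.

(** * Extension from the strip to the plane *)

Definition strip_index (tau z : C) : Z := up (Re z / (2 * PI * Im tau) - / 2)%R.

Definition baseP (th : C) (lam : R) (tau z : C) : C :=
  CpowZ th (- strip_index tau z) *
    wideP th lam tau (z + RtoC (IZR (strip_index tau z)) * (tpi * tau)).

Lemma strip_index_spec (tau z : C) :
  (0 < Im tau)%R ->
  (- (2 * PI * Im tau) <= 2 * (Re z - IZR (strip_index tau z) * (2 * PI * Im tau))
     < 2 * PI * Im tau)%R.
Proof.
intros htau. pose proof (period_pos tau htau) as hT. unfold strip_index.
set (T := (2 * PI * Im tau)%R) in *.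
destruct (archimed (Re z / T - / 2)) as [h1 h2].
set (j := IZR (up (Re z / T - / 2))) in *.
assert (hz : (Re z = Re z / T * T)%R) by (field; lra).
set (x := (Re z / T)%R) in *. rewrite hz. split; nra.
Qed.

Lemma Re_shift (tau z : C) (j : Z) :
  Re (z + RtoC (IZR j) * (tpi * tau)) = (Re z - IZR j * (2 * PI * Im tau))%R.
Proof. rewrite re_plus, re_scal_l, Re_tpi. ring. Qed.

Lemma CpowZ_opp_succ (x : C) (j : Z) : x <> 0 -> CpowZ x (- j) = x * CpowZ x (- (j + 1)).
Proof. intros hx. rewrite <- CpowZ_succ by easy. f_equal. lia. Qed.

(** Any index j bringing z into the wide strip gives the same value, so that one j can serve in a
    whole neighbourhood. Such a j differs from the chosen index by at most 1, and when the two
    differ, [wideP_shift] applies on the overlap. *)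
Lemma baseP_local (th : C) (lam : R) (tau z : C) (j : Z) :
  twist_ok th lam tau ->
  (- (2 * PI * Im tau) < Re z - IZR j * (2 * PI * Im tau) < 2 * PI * Im tau)%R ->
  baseP th lam tau z = CpowZ th (- j) * wideP th lam tau (z + RtoC (IZR j) * (tpi * tau)).
Proof.
intros hok hj. pose proof (period_pos tau (proj1 hok)) as hT.
assert (hth0 : th <> 0) by (apply Cmod_gt_0; destruct hok as [_ [-> _]]; lra).
assert (step : forall i, (0 < Re z - IZR i * (2 * PI * Im tau) < 2 * PI * Im tau)%R ->
  CpowZ th (- (i + 1)) * wideP th lam tau (z + RtoC (IZR (i + 1)) * (tpi * tau))
  = CpowZ th (- i) * wideP th lam tau (z + RtoC (IZR i) * (tpi * tau))).
{ intros i hi. rewrite (CpowZ_opp_succ th i hth0).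
  replace (z + RtoC (IZR (i + 1)) * (tpi * tau))
    with (z + RtoC (IZR i) * (tpi * tau) + tpi * tau) by (rewrite plus_IZR, RtoC_plus; ring).
  rewrite wideP_shift; [ring|easy|]. now rewrite Re_shift. }
pose proof (strip_index_spec tau z (proj1 hok)) as hs. unfold baseP.
set (i := strip_index tau z) in *. set (T := (2 * PI * Im tau)%R) in *.
assert (h1 : (i - 2 < j)%Z).
{ apply lt_IZR. rewrite minus_IZR. nra. }
assert (h2 : (j < i + 2)%Z).
{ apply lt_IZR. rewrite plus_IZR. nra. }
assert (h3 : (j = i \/ j = i + 1 \/ i = j + 1)%Z) by lia.
destruct h3 as [->|[->|hij]]; [easy| |].
- symmetry. apply step. rewrite plus_IZR in hj. lra.
- rewrite hij. apply step. rewrite hij, plus_IZR in hs. lra.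
Qed.

Lemma baseP_tau (th : C) (lam : R) (tau z : C) :
  twist_ok th lam tau -> baseP th lam tau (z + tpi * tau) = th * baseP th lam tau z.
Proof.
intros hok. pose proof (period_pos tau (proj1 hok)) as hT.
assert (hth0 : th <> 0) by (apply Cmod_gt_0; destruct hok as [_ [-> _]]; lra).
pose proof (strip_index_spec tau z (proj1 hok)) as hs.
set (j := strip_index tau z) in *.
assert (hz : Re (z + tpi * tau) = (Re z - 2 * PI * Im tau)%R) by (rewrite re_plus, Re_tpi; ring).
rewrite (baseP_local th lam tau z j) by (try easy; lra).
rewrite (baseP_local th lam tau (z + tpi * tau) (j - 1)) by (try easy; rewrite hz, minus_IZR; lra).
rewrite (CpowZ_opp_succ th (j - 1) hth0). replace (j - 1 + 1)%Z with j by lia.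
replace (z + tpi * tau + RtoC (IZR (j - 1)) * (tpi * tau))
  with (z + RtoC (IZR j) * (tpi * tau)) by (rewrite minus_IZR, RtoC_minus; ring).
ring.
Qed.

Lemma baseP_tpi (th : C) (lam : R) (tau z : C) :
  twist_ok th lam tau -> baseP th lam tau (z + tpi) = e2pii (RtoC lam) * baseP th lam tau z.
Proof.
intros hok. pose proof (period_pos tau (proj1 hok)) as hT.
pose proof (strip_index_spec tau z (proj1 hok)) as hs.
set (j := strip_index tau z) in *.
assert (hz : Re (z + tpi) = Re z).
{ rewrite re_plus. unfold tpi. rewrite re_mult_Ci. simpl. ring. }
rewrite (baseP_local th lam tau z j) by (try easy; lra).
rewrite (baseP_local th lam tau (z + tpi) j) by (try easy; rewrite hz; lra).
replace (z + tpi + RtoC (IZR j) * (tpi * tau))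
  with (z + RtoC (IZR j) * (tpi * tau) + tpi) by ring.
rewrite wideP_period; [ring|easy|]. rewrite Re_shift. lra.
Qed.

Lemma baseP_germ_local (th : C) (lam : R) (tau z c : C) (j : Z) (a : nat -> C) :
  twist_ok th lam tau ->
  (- (2 * PI * Im tau) < Re z - IZR j * (2 * PI * Im tau) < 2 * PI * Im tau)%R ->
  germ (wideP th lam tau) (z + RtoC (IZR j) * (tpi * tau)) c a ->
  germ (baseP th lam tau) z (CpowZ th (- j) * c) (fun n => CpowZ th (- j) * a n).
Proof.
intros hok hj h. apply (germ_scal (CpowZ th (- j))) in h.
set (x := (Re z - IZR j * (2 * PI * Im tau))%R) in *.
set (T := (2 * PI * Im tau)%R) in *.
(* Within this distance of z the translate by j stays inside the wide strip. *)
refine (germ_transport _ _ _ _ _ _ (Rmin (x + T) (T - x)) _ _ h).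
- apply Rmin_pos; lra.
- intros w [_ hw].
  assert (hw1 : (Cmod w < x + T)%R) by (eapply Rlt_le_trans; [apply hw|apply Rmin_l]).
  assert (hw2 : (Cmod w < T - x)%R) by (eapply Rlt_le_trans; [apply hw|apply Rmin_r]).
  pose proof (re_le_Cmod w) as hre.
  pose proof (Rle_abs (Re w)). pose proof (Rle_abs (- Re w)) as hre'. rewrite Rabs_Ropp in hre'.
  rewrite (baseP_local th lam tau (z + w) j hok).
  + f_equal. f_equal. ring.
  + rewrite re_plus. fold T. unfold x in *. lra.
Qed.

Lemma baseP_germ (th : C) (lam : R) (tau z : C) :
  twist_ok th lam tau ->
  exists c a, germ (baseP th lam tau) z c a /\
    (c <> 0 -> exists m n : Z, z = tpi * (RtoC (IZR m) * tau + RtoC (IZR n))).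
Proof.
intros hok. pose proof (period_pos tau (proj1 hok)) as hT.
pose proof (strip_index_spec tau z (proj1 hok)) as hs.
set (j := strip_index tau z) in *.
destruct (wideP_germ th lam tau (z + RtoC (IZR j) * (tpi * tau)) hok) as [c [a [h [h1 _]]]].
{ rewrite Re_shift. lra. }
apply baseP_germ_local in h; [|easy|lra].
eexists; eexists. split; [exact h|]. intros hc.
destruct (Cexp_eq_1 _ (h1 ltac:(intros ->; apply hc; ring))) as [n hn].
exists (- j)%Z, n. rewrite opp_IZR, RtoC_opp.
replace z with (z + RtoC (IZR j) * (tpi * tau) - RtoC (IZR j) * (tpi * tau)) by ring.
rewrite hn. ring.
Qed.

Lemma baseP_germ_0 (th : C) (lam : R) (tau : C) :
  twist_ok th lam tau -> exists a, germ (baseP th lam tau) 0 1 a.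
Proof.
intros hok. pose proof (period_pos tau (proj1 hok)) as hT.
destruct (wideP_germ th lam tau 0 hok) as [c [a [h [_ h1]]]].
{ simpl Re. lra. }
rewrite (h1 eq_refl) in h.
exists (fun n => CpowZ th (- 0) * a n).
replace (RtoC 1) with (CpowZ th (- 0) * 1) by (simpl; ring).
apply baseP_germ_local; [easy| |].
- simpl Re. lra.
- rewrite Cmult_0_l, Cplus_0_l. exact h.
Qed.

Lemma twisted_deriv_strip (th : C) (lam : R) (tau : C) (k : nat) (z : C) :
  twist_ok th lam tau -> (1 <= k)%nat -> (- (2 * PI * Im tau) < Re z < 0)%R ->
  is_twP_series k th lam z tau (twisted_deriv k (baseP th lam tau) z).
Proof.
intros hok hk hz. pose proof (period_pos tau (proj1 hok)) as hT.
destruct (coefp1_taylor th lam tau z hok ltac:(lra)) as [a ha].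
destruct (coefm_taylor th lam tau z hok ltac:(lra)) as [b hb].
pose proof (germ_plus _ _ _ _ _ _ _ (exp_taylor_germ _ _ _ _ ha) (exp_taylor_germ _ _ _ _ hb)) as hg.
rewrite Cplus_0_r in hg.
set (d := Rmin (- Re z) (Re z + 2 * PI * Im tau)).
apply (germ_transport _ (baseP th lam tau) z z _ _ d) in hg.
2:{ apply Rmin_pos; lra. }
2:{ intros w [_ hw]. unfold d in hw.
  assert (hw1 : (Cmod w < - Re z)%R) by (eapply Rlt_le_trans; [apply hw|apply Rmin_l]).
  assert (hw2 : (Cmod w < Re z + 2 * PI * Im tau)%R)
    by (eapply Rlt_le_trans; [apply hw|apply Rmin_r]).
  pose proof (re_le_Cmod w) as hre.
  pose proof (Rle_abs (Re w)). pose proof (Rle_abs (- Re w)) as hre'. rewrite Rabs_Ropp in hre'.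
  rewrite (baseP_local th lam tau (z + w) 0 hok) by (rewrite re_plus; lra).
  rewrite Cmult_0_l, Cplus_0_r, wideP_strip by (try easy; rewrite re_plus; lra).
  simpl. ring. }
rewrite (twisted_deriv_reg k _ _ _ hg).
set (l := (k - 1)%nat). set (F := RtoC (INR (fact l))).
assert (hF : F <> 0) by (intros e; apply RtoC_inj in e; now apply INR_fact_neq_0 in e).
(* F clears the 1/(k-1)! of the Taylor coefficients and the sign undoes the -1 in [coefp1] and
   [coefm]; combined with [twP_coef], the factor left is (-1)^(k-1). *)
exists (- F * (a l + b l)). split.
- exists (- F * a l), (- F * b l). split; [|split; [|ring]].
  + eapply csum_ext; [|apply (csum_scal (- F) _ _ (proj1 ha l))].
    intros m; cbv beta. rewrite <- freq_pos_IZR. unfold twP_term, coefp1. fold l.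
    pose proof (twden_pos_nz th lam tau m hok) as hD.
    change (1 - / th * e2pii (RtoC (freq_pos lam m) * tau)) with (twden th tau (freq_pos lam m)).
    rewrite RtoC_div by apply INR_fact_neq_0. fold F. field. easy.
  + eapply csum_ext; [|apply (csum_scal (- F) _ _ (proj1 hb l))].
    intros m; cbv beta. rewrite <- freq_neg_IZR. unfold twP_term, coefm. fold l.
    pose proof (twden_neg_nz th lam tau m hok) as hD.
    change (1 - / th * e2pii (RtoC (freq_neg lam m) * tau)) with (twden th tau (freq_neg lam m)).
    rewrite RtoC_div by apply INR_fact_neq_0. fold F. field. easy.
- unfold twP_coef. fold l. rewrite RtoC_div by apply INR_fact_neq_0. fold F.
  rewrite RtoC_pow. replace k with (S l) at 1 by (unfold l; lia).
  change (RtoC (-1)) with (RtoC (- (1))). rewrite Cpow_S, RtoC_opp. field. easy.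
Qed.

Lemma twP_baseP (k : nat) (th : C) (lam : R) (tau z : C) :
  twist_ok th lam tau -> (1 <= k)%nat ->
  twP k (th, e2pii (RtoC lam)) z tau = twisted_deriv k (baseP th lam tau) z.
Proof.
intros hok hk. apply twP_eq; [apply hok|]. split.
- apply twisted_deriv_meromorphic; [easy|]. intros z0.
  destruct (baseP_germ th lam tau z0 hok) as [c [a [h _]]]. now exists c, a.
- exists lam. split; [apply hok|]. split; [easy|]. intros w hw.
  apply twisted_deriv_strip; [easy|easy|].
  rewrite Cmod_e2pii, Cmod_Cexp in hw. split.
  + apply exp_lt_inv. apply hw.
  + apply exp_lt_inv. rewrite exp_0. apply hw.
Qed.

(** * Modular transformation *)

(** D may have wrong values at removable singularities. [twisted_deriv 1 D] replaces every value by
    the constant coefficient of the germ, which gives an entire function with the same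
    multipliers. *)
Lemma removable_quasi_periodic_zero (D : C -> C) (tau th ph : C) :
  (0 < Im tau)%R -> Cmod th = 1%R -> Cmod ph = 1%R -> (th, ph) <> (RtoC 1, RtoC 1) ->
  (forall z, exists a, germ D z 0 a) ->
  (forall z, D (z + tpi * tau) = th * D z) ->
  (forall z, D (z + tpi) = ph * D z) ->
  forall z a, germ D z 0 a -> forall n, a n = 0.
Proof.
intros htau hth hph hne hD h1 h2.
set (E := twisted_deriv 1 D).
assert (hE : forall z a, germ D z 0 a -> E z = a 0%nat).
{ intros z a ha. unfold E. rewrite (twisted_deriv_reg 1 D z a ha). simpl. ring. }
assert (hq : forall om ch, (forall z, D (z + om) = ch * D z) ->
  forall z, E (z + om) = ch * E z).
{ intros om ch h z. destruct (hD z) as [a ha].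
  rewrite (hE z a ha). apply (germ_scal ch) in ha. rewrite Cmult_0_r in ha.
  apply (hE (z + om) (fun n => ch * a n)).
  refine (germ_transport _ _ _ _ _ _ 1 Rlt_0_1 _ ha). intros w _.
  rewrite <- h. f_equal. ring. }
assert (hE0 : forall z, E z = 0).
{ apply (quasi_periodic_entire_zero E tau th ph); try easy.
  - intros z. destruct (hD z) as [a ha]. now apply twisted_deriv_analytic with a.
  - now apply hq.
  - now apply hq. }
intros z a ha.
destruct (germ_recenter _ _ _ _ ha) as [r [hr [hca hrec]]].
apply (psum_zero_coef a r hr hca). intros d hd.
destruct (small_point (Rmin d r)) as [w [hw0 hw]]; [now apply Rmin_pos|].
assert (hw1 : (Cmod w < d)%R) by (eapply Rlt_le_trans; [apply hw|apply Rmin_l]).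
assert (hw2 : (Cmod w < r)%R) by (eapply Rlt_le_trans; [apply hw|apply Rmin_r]).
exists w. split; [easy|].
(* At the nearby point z + w the corrected function is the sum of the series [a] at w, and it
   vanishes. *)
pose proof (hE _ _ (hrec w (conj hw0 hw2))) as he. rewrite hE0 in he. cbv beta in he.
rewrite he.
replace (0 * (- (1)) ^ 0 / w ^ 1 + recentered a w 0) with (recentered a w 0).
- apply (psum_ext (fun k => RtoC (INR (bin (0 + k) 0)) * a (0 + k)%nat)).
  + intros n. rewrite bin_0. simpl. ring.
  + now apply psum_recentered_coef with r.
- field. now apply Cmod_pos_nz.
Qed.

(** * The action on the characters and on the upper half plane *)

Lemma CpowZ_e2pii (s : R) (n : Z) : CpowZ (e2pii (RtoC s)) n = e2pii (RtoC (IZR n * s)).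
Proof.
assert (h : forall z, Cexp (z + tpi * RtoC s) = e2pii (RtoC s) * Cexp z).
{ intros z. rewrite Cexp_plus. apply Cmult_comm. }
pose proof (quasi_period_Z Cexp (tpi * RtoC s) _ (Cexp_nz _) h n 0) as hq.
rewrite Cexp_0, Cmult_1_r in hq. unfold e2pii at 2. fold tpi.
transitivity (Cexp (0 + RtoC (IZR n) * (tpi * RtoC s))); [now rewrite hq|].
f_equal. rewrite RtoC_mult. ring.
Qed.

Lemma e2pii_plus (s t : R) : e2pii (RtoC s) * e2pii (RtoC t) = e2pii (RtoC (s + t)).
Proof.
unfold e2pii. rewrite <- Cexp_plus, RtoC_plus. f_equal. ring.
Qed.

Lemma e2pii_eq_1 (s : R) : e2pii (RtoC s) = 1 <-> exists n : Z, s = IZR n.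
Proof.
split.
- intros h. destruct (Cexp_eq_1 _ h) as [n hn]. exists n.
  fold tpi in hn. apply RtoC_inj.
  replace (RtoC s) with (tpi * RtoC s / tpi) by (field; apply tpi_nz).
  rewrite hn. field. apply tpi_nz.
- intros [n ->]. apply Cexp_tpi_Z.
Qed.

(** On the exponents s, t the action is the integral matrix gamma. Its inverse is integral because
    the determinant is 1, so integral images come from integral exponents. *)
Lemma act_char_trivial (a b c d : Z) (th ph : C) :
  (a * d - b * c)%Z = 1%Z -> Cmod th = 1%R -> Cmod ph = 1%R ->
  act_char a b c d (th, ph) = (RtoC 1, RtoC 1) -> (th, ph) = (RtoC 1, RtoC 1).
Proof.
intros hdet hth hph h.
destruct (unit_e2pii th hth) as [s [_ ->]]. destruct (unit_e2pii ph hph) as [t [_ ->]].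
unfold act_char in h. simpl fst in h. simpl snd in h.
rewrite !CpowZ_e2pii, !e2pii_plus in h. pose proof (f_equal fst h) as h1. pose proof (f_equal snd h) as h2.
cbn [fst snd] in h1, h2.
apply e2pii_eq_1 in h1, h2. destruct h1 as [p hp]. destruct h2 as [q hq].
apply (f_equal IZR) in hdet. rewrite minus_IZR, !mult_IZR in hdet.
f_equal; apply e2pii_eq_1.
- exists (d * p - b * q)%Z. rewrite minus_IZR, !mult_IZR, <- hp, <- hq.
  transitivity ((IZR a * IZR d - IZR b * IZR c) * s)%R; [rewrite hdet|]; ring.
- exists (a * q - c * p)%Z. rewrite minus_IZR, !mult_IZR, <- hp, <- hq.
  transitivity ((IZR a * IZR d - IZR b * IZR c) * t)%R; [rewrite hdet|]; ring.
Qed.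

Lemma autfac_nz (a b c d : Z) (tau : C) :
  (a * d - b * c)%Z = 1%Z -> (0 < Im tau)%R -> autfac c d tau <> 0.
Proof.
intros hdet htau h. unfold autfac in h.
pose proof (f_equal Im h) as h1. pose proof (f_equal Re h) as h2.
rewrite im_plus, im_scal_l in h1. rewrite re_plus, re_scal_l in h2.
change (Im (RtoC (IZR d))) with 0%R in h1. change (Im (RtoC 0)) with 0%R in h1.
change (Re (RtoC (IZR d))) with (IZR d) in h2. change (Re (RtoC 0)) with 0%R in h2.
assert (hc : IZR c = 0%R) by nra. rewrite hc in h2.
assert (hd : IZR d = 0%R) by lra.
apply eq_IZR in hc, hd. subst. lia.
Qed.

Lemma Im_act_tau (a b c d : Z) (tau : C) :
  (a * d - b * c)%Z = 1%Z -> (0 < Im tau)%R -> (0 < Im (act_tau a b c d tau))%R.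
Proof.
intros hdet htau. pose proof (autfac_nz a b c d tau hdet htau) as hal.
set (t := act_tau a b c d tau).
assert (h : t * autfac c d tau = RtoC (IZR a) * tau + RtoC (IZR b)).
{ unfold t, act_tau. field. easy. }
apply (f_equal IZR) in hdet. rewrite minus_IZR, !mult_IZR in hdet.
unfold autfac in h.
pose proof (f_equal Im h) as h1. pose proof (f_equal Re h) as h2. clear h.
rewrite im_mult, !im_plus, !re_plus, !im_scal_l, !re_scal_l in h1.
rewrite re_mult, !im_plus, !re_plus, !im_scal_l, !re_scal_l in h2.
change (Im (RtoC (IZR d))) with 0%R in *. change (Im (RtoC (IZR b))) with 0%R in *.
change (Re (RtoC (IZR d))) with (IZR d) in *. change (Re (RtoC (IZR b))) with (IZR b) in *.
set (x := Re tau) in *. set (y := Im tau) in *. set (u := Re t) in *. set (v := Im t) in *.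
(* This is Im(gamma.tau) |c tau + d|^2 = Im tau. *)
assert (hv : (v * ((IZR c * x + IZR d) ^ 2 + (IZR c * y) ^ 2) = y)%R).
{ transitivity ((u * (IZR c * y + 0) + v * (IZR c * x + IZR d)) * (IZR c * x + IZR d)
    - (u * (IZR c * x + IZR d) - v * (IZR c * y + 0)) * (IZR c * y))%R; [ring|].
  rewrite h1, h2. transitivity (y * (IZR a * IZR d - IZR b * IZR c))%R; [ring|].
  rewrite hdet. ring. }
assert (hq : (0 <= (IZR c * x + IZR d) ^ 2 + (IZR c * y) ^ 2)%R).
{ apply Rplus_le_le_0_compat; apply pow2_ge_0. }
set (q := ((IZR c * x + IZR d) ^ 2 + (IZR c * y) ^ 2)%R) in *. clearbody q.
apply Rnot_le_lt. intros hle. change (0 < y)%R in htau. nra.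
Qed.

Lemma twist_ok_intro (th ph tau : C) :
  Cmod th = 1%R -> Cmod ph = 1%R -> (th, ph) <> (RtoC 1, RtoC 1) -> (0 < Im tau)%R ->
  exists lam, ph = e2pii (RtoC lam) /\ twist_ok th lam tau.
Proof.
intros hth hph hne htau. destruct (unit_e2pii ph hph) as [l [hl ->]].
exists l. split; [easy|]. repeat split; try easy.
intros -> ->. apply hne. f_equal. apply e2pii_eq_1. now exists 0%Z.
Qed.

Lemma baseP_lattice (th : C) (lam : R) (tau z : C) (m n : Z) :
  twist_ok th lam tau ->
  baseP th lam tau (z + tpi * (RtoC (IZR m) * tau + RtoC (IZR n)))
  = CpowZ th m * CpowZ (e2pii (RtoC lam)) n * baseP th lam tau z.
Proof.
intros hok.
assert (hth0 : th <> 0) by (apply Cmod_gt_0; destruct hok as [_ [-> _]]; lra).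
replace (z + tpi * (RtoC (IZR m) * tau + RtoC (IZR n)))
  with (z + RtoC (IZR m) * (tpi * tau) + RtoC (IZR n) * tpi) by ring.
rewrite (quasi_period_Z _ tpi (e2pii (RtoC lam)) (Cexp_nz _) (fun z => baseP_tpi th lam tau z hok)).
rewrite (quasi_period_Z _ (tpi * tau) th hth0 (fun z => baseP_tau th lam tau z hok)). ring.
Qed.

Theorem proposition2p7 (theta phi : C)
  (htheta : Cmod theta = 1%R) (hphi : Cmod phi = 1%R)
  (hne : (theta, phi) <> (RtoC 1, RtoC 1))
  (k : nat) (hk : (1 <= k)%nat)
  (a b c d : Z) (hdet : (a * d - b * c)%Z = 1%Z)
  (z tau : C) (htau : (0 < Im tau)%R) :
  twP k (act_char a b c d (theta, phi)) (act_z c d tau z) (act_tau a b c d tau)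
  = Cpow (autfac c d tau) k * twP k (theta, phi) z tau.
Proof.
pose proof (autfac_nz a b c d tau hdet htau) as hal.
pose proof (Im_act_tau a b c d tau hdet htau) as htau'.
set (al := autfac c d tau) in *. set (tau' := act_tau a b c d tau) in *.
assert (hne' : act_char a b c d (theta, phi) <> (RtoC 1, RtoC 1)).
{ intros h. apply hne. now apply (act_char_trivial a b c d). }
unfold act_char in *. simpl fst in *. simpl snd in *.
set (th' := CpowZ theta a * CpowZ phi b) in *.
set (ph' := CpowZ theta c * CpowZ phi d) in *.
assert (hth' : Cmod th' = 1%R).
{ unfold th'. rewrite Cmod_mult, !Cmod_CpowZ by easy. ring. }
assert (hph' : Cmod ph' = 1%R).
{ unfold ph'. rewrite Cmod_mult, !Cmod_CpowZ by easy. ring. }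
destruct (twist_ok_intro theta phi tau htheta hphi hne htau) as [l [hl hok]].
destruct (twist_ok_intro th' ph' tau' hth' hph' hne' htau') as [l' [hl' hok']].
set (G := baseP theta l tau). set (G' := baseP th' l' tau').
rewrite hl, hl', !twP_baseP by easy. fold G G'.
assert (htau_eq : al * tau' = RtoC (IZR a) * tau + RtoC (IZR b)).
{ unfold tau', act_tau. fold al. field. easy. }
(* The factor [al] compensates the division of the residue by [al] under dilation. *)
set (D := fun w => G' w + (- al) * G (al * w)).
(* Since al tau' = a tau + b and al = c tau + d, the periods of w become lattice vectors with
   coordinates (a, b) and (c, d); their multipliers are the two components of the transformed
   character. *)
assert (hD1 : forall w, D (w + tpi * tau') = th' * D w).
{ intros w. unfold D, G', G. rewrite baseP_tau by easy.
  replace (al * (w + tpi * tau')) with (al * w + tpi * (RtoC (IZR a) * tau + RtoC (IZR b)))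
    by (rewrite <- htau_eq; ring).
  rewrite baseP_lattice, <- hl by easy. fold th'. ring. }
assert (hD2 : forall w, D (w + tpi) = ph' * D w).
{ intros w. unfold D, G', G. rewrite baseP_tpi, <- hl' by easy.
  replace (al * (w + tpi)) with (al * w + tpi * (RtoC (IZR c) * tau + RtoC (IZR d)))
    by (unfold al, autfac; ring).
  rewrite baseP_lattice, <- hl by easy. fold ph'. ring. }
(* The power al^(n+1) combines the factor in D with al^n from the dilation; at n = k-1 it is the
   weight al^k. *)
assert (hDg : forall w c1 c2 a1 a2, germ G' w c1 a1 -> germ G (al * w) c2 a2 ->
  germ D w (c1 - c2) (fun n => a1 n - al ^ S n * a2 n)).
{ intros w c1 c2 a1 a2 h1 h2.
  pose proof (germ_plus _ _ _ _ _ _ _ h1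
    (germ_scal (- al) _ _ _ _ (germ_dilate al G w c2 a2 hal h2))) as h.
  replace (c1 + - al * (c2 / al)) with (c1 - c2) in h by (field; easy).
  eapply germ_ext; [|exact h]. intros n; cbv beta. rewrite Cpow_S. ring. }
(* At 0 the residues 1 and 1 cancel, and quasi-periodicity of D carries this germ to all other
   lattice points. *)
assert (hlat : forall w (m n : Z), w = tpi * (RtoC (IZR m) * tau' + RtoC (IZR n)) ->
  exists e, germ D w 0 e).
{ intros w m n hw.
  destruct (baseP_germ_0 th' l' tau' hok') as [a1 h1].
  destruct (baseP_germ_0 theta l tau hok) as [a2 h2].
  assert (h2' : germ G (al * 0) 1 a2) by (now rewrite Cmult_0_r).
  pose proof (hDg _ _ _ _ _ h1 h2') as h.
  replace (1 - 1) with (RtoC 0) in h by ring.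
  apply (germ_scal (CpowZ ph' n * CpowZ th' m)) in h. rewrite Cmult_0_r in h.
  eexists. refine (germ_transport _ _ _ _ _ _ 1 Rlt_0_1 _ h). intros v _.
  rewrite hw, Cplus_0_l.
  replace (tpi * (RtoC (IZR m) * tau' + RtoC (IZR n)) + v)
    with (v + RtoC (IZR m) * (tpi * tau') + RtoC (IZR n) * tpi) by ring.
  rewrite (quasi_period_Z D tpi ph'), (quasi_period_Z D (tpi * tau') th'); try easy.
  - ring.
  - apply Cmod_gt_0; lra.
  - apply Cmod_gt_0; lra. }
assert (hrem : forall w, exists e, germ D w 0 e).
{ intros w.
  destruct (baseP_germ th' l' tau' w hok') as [c1 [a1 [h1 p1]]].
  destruct (baseP_germ theta l tau (al * w) hok) as [c2 [a2 [h2 p2]]].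
  destruct (Ceq_dec c1 0) as [->|hc1].
  2:{ destruct (p1 hc1) as [m [n hw]]. now apply (hlat w m n). }
  destruct (Ceq_dec c2 0) as [->|hc2].
  2:{ destruct (p2 hc2) as [m [n hw]].
      (* The inverse matrix gives the coordinates m', n' with m tau + n = al (m' tau' + n'): a pole
         of the second term also lies on the lattice of tau'. *)
      apply (hlat w (d * m - c * n)%Z (a * n - b * m)%Z).
      apply (f_equal IZR) in hdet. rewrite minus_IZR, !mult_IZR in hdet.
      apply (f_equal RtoC) in hdet. rewrite RtoC_minus, !RtoC_mult in hdet.
      replace w with (al * w / al) by (field; easy). rewrite hw.
      rewrite !minus_IZR, !mult_IZR, !RtoC_minus, !RtoC_mult.
      replace tau' with (al * tau' / al) by (field; easy). rewrite htau_eq.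
      replace (RtoC (IZR m) * tau + RtoC (IZR n))
        with ((RtoC (IZR a) * RtoC (IZR d) - RtoC (IZR b) * RtoC (IZR c))
               * (RtoC (IZR m) * tau + RtoC (IZR n))) by (rewrite hdet; ring).
      unfold al, autfac in *. field. easy. }
  exists (fun n => a1 n - al ^ S n * a2 n).
  replace (RtoC 0) with (RtoC 0 - 0) by ring. now apply hDg. }
unfold act_z. fold al.
destruct (baseP_germ th' l' tau' (z / al) hok') as [c1 [a1 [h1 _]]].
destruct (baseP_germ theta l tau z hok) as [c2 [a2 [h2 _]]].
assert (h2' : germ G (al * (z / al)) c2 a2).
{ now replace (al * (z / al)) with z by (field; easy). }
pose proof (hDg _ _ _ _ _ h1 h2') as hg.
destruct (hrem (z / al)) as [e he].
destruct (germ_unique _ _ _ _ _ _ hg he) as [hc _]. rewrite hc in hg.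
pose proof (removable_quasi_periodic_zero D tau' th' ph' htau' hth' hph' hne' hrem hD1 hD2
  _ _ hg (k - 1)%nat) as hcoef. cbv beta in hcoef.
apply Ceq_minus in hc. subst c2. apply Ceq_minus in hcoef.
fold G' in h1. fold G in h2.
rewrite (twisted_deriv_eq k _ _ _ _ h1), (twisted_deriv_eq k _ _ _ _ h2).
(* The residues are equal, so at a pole both sides have the default value 0. *)
destruct (Ceq_dec c1 0); [|ring].
rewrite hcoef. replace (S (k - 1)) with k by lia. ring.
Qed.
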